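(* Let $0<p<1$. For an entire function $f$ put $f_{\pi}(z)=e^{i\pi z}f(z)$ for $z\in\mathbb{C}_+$, $f_{-\pi}(z)=e^{-i\pi z}f(z)$ for $z\in\mathbb{C}_-$, and $j(f)=(f_\pi,f_{-\pi})$. Then $j(E^p)$ is complemented in $H^p(\mathbb{C}_+)\oplus H^p(\mathbb{C}_-)$; that is, there is a bounded linear projection of $H^p(\mathbb{C}_+)\oplus H^p(\mathbb{C}_-)$ onto $j(E^p)$.
   Context: An entire function $f$ is of exponential type $\tau>0$ if for every $\epsilon>0$ there is $C_\epsilon>0$ such that $|f(z)|\le C_\epsilon e^{(\tau+\epsilon)|z|}$ for all $z\in\mathbb{C}$. $E^p$ is the space of entire functions $f$ of exponential type $\pi$ with $f|_{\mathbb{R}}\in L^p(\mathbb{R})$, equipped with $\|f\|_{E^p}=\left(\int_{-\infty}^\infty |f(x)|^p\,dx\right)^{1/p}$ (a quasi-norm for $0<p<1$). $\mathbb{C}_+=\{x+iy: y>0\}$ and $\mathbb{C}_-=\{x+iy:y<0\}$. $H^p(\mathbb{C}_\pm)$ is the space of holomorphic functions $f$ on $\mathbb{C}_\pm$ with $\|f\|^p_{H^p(\mathbb{C}_\pm)}=\sup_{\pm y>0}\int_{-\infty}^\infty |f(x+iy)|^p\,dx<\infty$. The direct sum carries the usual product quasi-norm (e.g. the sum of the two quasi-norms). The map $j$ sends $E^p$ into $H^p(\mathbb{C}_+)\oplus H^p(\mathbb{C}_-)$. *)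

(* Defs.v *)
From HB Require Import structures.
From mathcomp Require Import all_boot all_order all_algebra.
From mathcomp Require Import complex.
From mathcomp Require Import all_classical all_reals all_analysis.

Set Implicit Arguments.
Unset Strict Implicit.
Unset Printing Implicit Defensive.

Import Order.TTheory GRing.Theory Num.Theory.
Import numFieldNormedType.Exports.
Import ComplexField.

Local Open Scope classical_set_scope.
Local Open Scope ring_scope.

(* The complex plane as a normed space over itself: [R[i]] alone would be
   taken as a vector space over [R], and [derivable] would not be the complex
   derivative. *)
Notation cplx R := (R[i]^o).

Section ComplexAnalysis.
Variable R : realType.
Local Notation C := (cplx R).

Definition cmod (z : C) : R := Normc.normc z.

Definition cexp (z : C) : C :=
  Complex (expR (complex.Re z) * cos (complex.Im z))
          (expR (complex.Re z) * sin (complex.Im z)).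

Definition holomorphic_on (U : set C) (f : C -> C) : Prop :=
  forall z : C, U z -> derivable f z (1 : C).

Definition entire (f : C -> C) : Prop := holomorphic_on setT f.

Definition exponential_type (tau : R) (f : C -> C) : Prop :=
  forall eps : R, 0 < eps -> exists2 c : R, 0 < c &
    forall z : C, cmod (f z) <= c * expR ((tau + eps) * cmod z).

(* The integral of |f|^p over the horizontal line of height y. *)
Definition line_integral (p y : R) (f : C -> C) : \bar R :=
  (\int[lebesgue_measure]_(x in [set: R]) ((cmod (f (Complex x y)) `^ p)%R)%:E)%E.

(* Measurability on the real line is automatic, by continuity of f. *)
Definition Ep (p : R) : set (C -> C) :=
  [set f | [/\ entire f, exponential_type pi f &
               (line_integral p 0 f < +oo)%E]].

Definition upper : set R := [set y | 0 < y].
Definition lower : set R := [set y | y < 0].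

(* The half-planes are [half_plane upper] and [half_plane lower]. *)
Definition half_plane (Y : set R) : set C := [set z | Y (complex.Im z)].

Definition hardy_qnorm (Y : set R) (p : R) (f : C -> C) : \bar R :=
  (ereal_sup [set line_integral p y f | y in Y] `^ p^-1)%E.

(* A function on a half-plane is represented by its extension by 0 to the whole
   plane, so that equality of functions on the half-plane is Leibniz equality
   of their representatives. *)
Definition hardy (Y : set R) (p : R) : set (C -> C) :=
  [set f | [/\ holomorphic_on (half_plane Y) f,
               (forall z, ~ half_plane Y z -> f z = 0) &
               (hardy_qnorm Y p f < +oo)%E]].

Definition hardy_sum (p : R) : set ((C -> C) * (C -> C)) :=
  hardy upper p `*` hardy lower p.

Definition hardy_sum_qnorm (p : R) (u : (C -> C) * (C -> C)) : \bar R :=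
  (hardy_qnorm upper p u.1 + hardy_qnorm lower p u.2)%E.

Definition jmap (f : C -> C) : (C -> C) * (C -> C) :=
  ((fun z => if 0 < complex.Im z then cexp (Complex 0 pi * z) * f z else 0),
   (fun z => if complex.Im z < 0 then cexp (- (Complex 0 pi * z)) * f z else 0)).

(* [P] is a bounded linear projection of the subspace [H] of [V], with
   quasi-norm [N], onto [M]; its values outside [H] are irrelevant. *)
Definition bounded_linear_projection (V : lmodType R[i]) (N : V -> \bar R)
    (H M : set V) (P : V -> V) : Prop :=
  [/\ (forall u, H u -> H (P u)),
      (forall (a : R[i]) u v, H u -> H v -> P (a *: u + v) = a *: P u + P v),
      (forall u, H u -> P (P u) = P u),
      P @` H = M &
      exists2 c : R, 0 <= c & forall u, H u -> (N (P u) <= c%:E * N u)%E].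

Definition complemented (V : lmodType R[i]) (N : V -> \bar R) (H M : set V) :
    Prop :=
  exists P : V -> V, bounded_linear_projection N H M P.

End ComplexAnalysis.
Arguments upper {R}.
Arguments lower {R}.

(* Main.v *)
Require Import Defs.
From mathcomp Require Import all_boot all_order all_algebra.
From mathcomp Require Import complex.
From mathcomp Require Import all_classical all_reals all_analysis.
From mathcomp Require Import measurable_realfun.
From mathcomp Require Import ring lra.

(* With [k w = (sin (d w) / (d w))^N / w], [d = pi / N] and [(N + 1) p >= 2], the
   contour integral [T g z = -1/c0 * \int e^{-i pi u} g(u) k(u - z) du] over a line
   [Im u = eta] above [z] does not depend on [eta], so [T g] is entire; as [k] has
   type [pi], so has [T g].  Splitting the line into unit intervals and using
   [(a + b)^p <= a^p + b^p], the decay of [k] bounds the L^p norm of [T g] on the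
   real line by sums of suprema of [|g|^p] over unit intervals, hence by the
   Hardy norm of [g].  The sum of [T g] and of its mirror image for the lower
   half-plane sends [j f] to [f], by the residue theorem for [k] on the
   rectangles [-n, n] x [-eta, eta].  That [j] maps E^p into the Hardy spaces is
   the Plancherel-Polya inequality: a Phragmen-Lindelof argument for the
   subharmonic function [z |-> \int_{-L}^L |g(z + t)|^p dt]. *)

Set Implicit Arguments.
Unset Strict Implicit.
Unset Printing Implicit Defensive.

Import Order.TTheory GRing.Theory Num.Theory.
Import numFieldNormedType.Exports.
Local Open Scope classical_set_scope.
Local Open Scope ring_scope.
Local Open Scope complex_scope.

(** * The modulus on the complex plane *)

Section Modulus.
Variable R : realType.
Local Notation C := (cplx R).
Implicit Types (z w : C) (x y : R).

(** For p < 1 an L^p bound on a line controls no integral of |g|, so a Cauchy-type integral cannot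
    be estimated by the Hardy norm directly. Two things compensate. The contour stays at height at
    least 3, where squares around its points lie in the half-plane and a sub-mean-value inequality
    for |g|^p controls suprema over unit intervals; and (N + 1) p >= 2 makes the p-th power of the
    kernel decay like 1 / (1 + x^2). The height of the contour follows z: at 3 + max(0, Im z) the
    factors e^{pi Im u} and e^{pi (Im u - Im z)} multiply to e^{6 pi + pi |Im z|}, which is type pi.
    The sub-mean-value inequality may lose a constant, and is drawn from Cauchy's formula at the
    maximum of a weighted |g|^p. The maximum principle may lose nothing; it rests on a four-point
    inequality with error O(t^3), beaten by the gain ep t^2 of a quadratic perturbation. Contours
    are rectangles throughout, and 2 pi i appears as the symbol [c0]. Since the operator is a left
    inverse of j, idempotence and the range of the projection come for free. *)

Lemma cmod_ge0 z : 0 <= cmod z.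
Proof. by case: z => a b; rewrite /cmod /=; apply: sqrtr_ge0. Qed.

Lemma cmodM z w : cmod (z * w) = cmod z * cmod w.
Proof. exact: Normc.normcM. Qed.

Lemma cmodD z w : cmod (z + w) <= cmod z + cmod w.
Proof. exact: le_normcD. Qed.

Lemma cmodN z : cmod (- z) = cmod z.
Proof. exact: normcN. Qed.

Lemma cmod_real x : cmod (x%:C : C) = `|x|.
Proof. by rewrite /cmod /= expr0n addr0 sqrtr_sqr. Qed.

Lemma cmod0 : cmod (0 : C) = 0.
Proof. exact: Normc.normc0. Qed.

Lemma cmod1 : cmod (1 : C) = 1.
Proof. exact: Normc.normc1. Qed.

Lemma cmod_i : cmod (Complex 0 1 : C) = 1.
Proof. by rewrite /cmod /= expr0n add0r expr1n sqrtr1. Qed.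

Lemma cmodV z : cmod z^-1 = (cmod z)^-1.
Proof. exact: Normc.normcV. Qed.

Lemma cmodX z n : cmod (z ^+ n) = cmod z ^+ n.
Proof. by elim: n => [|n IH]; rewrite ?expr0 ?cmod1 // !exprS cmodM IH. Qed.

Lemma cmod_eq0 z : (cmod z == 0) = (z == 0).
Proof.
by apply/eqP/eqP => [/Normc.eq0_normc|->]; rewrite ?cmod0.
Qed.

Lemma cmod_gt0 z : (0 < cmod z) = (z != 0).
Proof. by rewrite lt_def cmod_ge0 andbT cmod_eq0. Qed.

Lemma cmodBC z w : cmod (z - w) = cmod (w - z).
Proof. by rewrite -cmodN opprB. Qed.

Lemma cmodB z w : cmod (z - w) <= cmod z + cmod w.
Proof. by rewrite -(cmodN w); apply: cmodD. Qed.

Lemma cmod_distl z w : cmod z - cmod w <= cmod (z - w).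
Proof.
by rewrite lerBlDr; apply: le_trans (cmodD _ _); rewrite subrK.
Qed.

Lemma cmod_dist z w : `|cmod z - cmod w| <= cmod (z - w).
Proof.
rewrite ler_norml cmod_distl andbT lerNl opprB cmodBC; exact: cmod_distl.
Qed.

Lemma cmod_sqr z : cmod z ^+ 2 = complex.Re z ^+ 2 + complex.Im z ^+ 2.
Proof. by case: z => a b; rewrite /cmod /= sqr_sqrtr // addr_ge0 // sqr_ge0. Qed.

Lemma Re_le_cmod z : `|complex.Re z| <= cmod z.
Proof.
rewrite -(ler_pXn2r (n := 2)) ?nnegrE ?cmod_ge0 //.
by rewrite real_normK ?num_real // cmod_sqr lerDl sqr_ge0.
Qed.

Lemma Im_le_cmod z : `|complex.Im z| <= cmod z.
Proof.
rewrite -(ler_pXn2r (n := 2)) ?nnegrE ?cmod_ge0 //.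
by rewrite real_normK ?num_real // cmod_sqr lerDr sqr_ge0.
Qed.

Lemma cmod_le_ReIm z : cmod z <= `|complex.Re z| + `|complex.Im z|.
Proof.
rewrite -(ler_pXn2r (n := 2)) ?nnegrE ?cmod_ge0 ?addr_ge0 //.
rewrite cmod_sqr sqrrD !real_normK ?num_real // addrAC lerDl.
by rewrite mulrn_wge0 // mulr_ge0.
Qed.

Lemma normc_cmod z : `|z| = (cmod z)%:C :> R[i].
Proof. by []. Qed.

Lemma lt_normc z x : (`|z| < x%:C :> R[i]) = (cmod z < x).
Proof. by rewrite normc_cmod ltcR. Qed.

Lemma ReD z w : complex.Re (z + w) = complex.Re z + complex.Re w.
Proof. by case: z w => [? ?] [? ?]. Qed.
Lemma ImD z w : complex.Im (z + w) = complex.Im z + complex.Im w.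
Proof. by case: z w => [? ?] [? ?]. Qed.
Lemma ReN z : complex.Re (- z) = - complex.Re z.
Proof. by case: z => [? ?]. Qed.
Lemma ImN z : complex.Im (- z) = - complex.Im z.
Proof. by case: z => [? ?]. Qed.

End Modulus.

(** * Epsilon-delta forms of continuity and complex differentiability *)

Section Bridge.
Variable R : realType.
Local Notation C := (cplx R).

(** The order of [R[i]] compares only numbers with equal imaginary parts, so the complex radii of
    neighbourhoods in [C] are real numbers in disguise. *)
Lemma gt0_complex (e : R[i]) : 0 < e -> exists2 r : R, 0 < r & e = r%:C.
Proof.
by case: e => a b; rewrite ltcE /= => /andP[/eqP -> a0]; exists a.
Qed.

Lemma nbhs_cmodP (z : C) (P : set C) :
  nbhs z P <-> exists2 d : R, 0 < d & forall w, cmod (w - z) < d -> P w.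
Proof.
split.
- move/nbhs_ballP => [e /= /gt0_complex[r r0 ->] H]; exists r => // w wz.
  by apply: H; rewrite /ball /= lt_normc cmodBC.
- move=> [d d0 H]; apply/nbhs_ballP; exists d%:C => /=; first by rewrite ltcR.
  by move=> w; rewrite /ball /= lt_normc => wz; apply: H; rewrite cmodBC.
Qed.

Lemma ccontP (f : C -> C) z : {for z, continuous f} <->
  forall e : R, 0 < e -> exists2 d : R, 0 < d &
    forall w, cmod (w - z) < d -> cmod (f w - f z) < e.
Proof.
split.
- move=> H e e0; have /H : nbhs (f z) [set w | cmod (w - f z) < e].
    by apply/nbhs_cmodP; exists e.
  by move/nbhs_cmodP => [d d0 K]; exists d.
- move=> H A /nbhs_cmodP [e e0 K]; have [d d0 L] := H e e0.
  by apply/nbhs_cmodP; exists d => // w /L; apply: K.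
Qed.

Lemma rcontP (f : R -> C) (x : R) : {for x, continuous f} <->
  forall e : R, 0 < e -> exists2 d : R, 0 < d &
    forall y, `|y - x| < d -> cmod (f y - f x) < e.
Proof.
split.
- move=> H e e0; have /H : nbhs (f x) [set w | cmod (w - f x) < e].
    by apply/nbhs_cmodP; exists e.
  move/nbhs_ballP => [d /= d0 K]; exists d => // y yx.
  by apply: K; rewrite /ball /= distrC.
- move=> H A /nbhs_cmodP [e e0 K]; have [d d0 L] := H e e0.
  apply/nbhs_ballP; exists d => //= y; rewrite /ball /= distrC => /L.
  exact: K.
Qed.

Lemma crcontP (f : C -> R) z : {for z, continuous f} <->
  forall e : R, 0 < e -> exists2 d : R, 0 < d &
    forall w, cmod (w - z) < d -> `|f w - f z| < e.
Proof.
split.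
- move=> H e e0; have /H : nbhs (f z) [set w | `|w - f z| < e].
    by apply/nbhs_ballP; exists e => //= w; rewrite /ball /= distrC.
  by move/nbhs_cmodP => [d d0 K]; exists d.
- move=> H A /nbhs_ballP [e /= e0 K]; have [d d0 L] := H e e0.
  apply/nbhs_cmodP; exists d => // w /L wz; apply: K.
  by rewrite /ball /= distrC.
Qed.

(** The remainder form has no quotient and admits [h = 0]; Goursat's theorem, the chain rule and the
    derivative of [cexp] all work with it. *)
Lemma derivableE (f : C -> C) z : derivable f z (1 : C) <->
  exists D : C, forall e : R, 0 < e -> exists2 d : R, 0 < d &
    forall h, cmod h < d -> cmod (f (z + h) - f z - D * h) <= e * cmod h.
Proof.
split.
- move=> H; exists ('D_1 f z) => e e0.
  have /(_ [set w | cmod (w - 'D_1 f z) < e]) := H.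
  case; first by apply/nbhs_cmodP; exists e.
  move=> /= d' /gt0_complex[d d0 ->] K; exists d => // h hd.
  have [->|h0] := eqVneq h 0; first by rewrite addr0 mulr0 subr0 subrr cmod0 mulr0.
  have /= := K h; rewrite /ball_ /= sub0r normrN lt_normc => /(_ hd h0).
  rewrite [h *: 1]mulr1 (addrC h z) => Kh.
  rewrite -ler_pdivrMr ?cmod_gt0 // -cmodV -cmodM mulrBl mulfK // mulrC.
  exact: ltW.
- move=> [D H]; apply/cvg_ex; exists D => A /nbhs_cmodP [e e0 HA].
  have [|d d0 K] := H (e / 2); first by rewrite divr_gt0.
  exists d%:C => /=; first by rewrite ltcR.
  move=> h; rewrite /ball_ /= sub0r normrN lt_normc => hd h0; apply: HA.
  rewrite [h *: 1]mulr1 (addrC h z).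
  have -> : h^-1 *: (f (z + h) - f z) - D = (f (z + h) - f z - D * h) / h.
    by rewrite [RHS]mulrBl mulfK // [h^-1 *: _]mulrC.
  rewrite cmodM cmodV ltr_pdivrMr ?cmod_gt0 //.
  apply: le_lt_trans (K _ hd) _; rewrite ltr_pM2r ?cmod_gt0 //; lra.
Qed.

Lemma derivable_ccont (f : C -> C) z : derivable f z (1 : C) ->
  {for z, continuous f}.
Proof.
move=> /derivableE [D H]; apply/ccontP => e e0.
have [d d0 K] := H 1 ltr01.
have c0 : 0 < 1 + cmod D by rewrite ltr_wpDr ?cmod_ge0.
exists (Num.min d (e / (1 + cmod D))); first by rewrite lt_min d0 divr_gt0.
move=> w; rewrite lt_min => /andP[wd we].
have := K _ wd; rewrite subrKC => Kw.
rewrite -(subrK (D * (w - z)) (f w - f z)); apply: le_lt_trans (cmodD _ _) _.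
rewrite cmodM; apply: le_lt_trans (lerD Kw (lexx _)) _.
by rewrite -mulrDl mulrC -ltr_pdivlMr.
Qed.

End Bridge.

(** * Integrals of continuous real functions over segments *)

Section RealIntegral.
Variable R : realType.
Implicit Types (a b c : R) (f g : R -> R).

(** Not the oriented integral: for [b < a] the segment is empty and the value is 0. *)
Definition rint a b f : R := \int[lebesgue_measure]_(x in `[a, b]) f x.

(** Continuity in full neighbourhoods, also at the end points. This is stronger than continuity
    within the segment and passes to subsegments without any work. *)
Definition cont_on (T : topologicalType) a b (f : R -> T) :=
  forall x, a <= x <= b -> {for x, continuous f}.

Lemma cont_on_sub (T : topologicalType) a b c d (f : R -> T) :
  a <= c -> d <= b -> cont_on a b f -> cont_on c d f.
Proof. by move=> ac db H x /andP[cx xd]; apply: H; lra. Qed.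

Lemma cont_on_within a b f : cont_on a b f -> {within `[a, b], continuous f}.
Proof.
move=> H; apply: continuous_in_subspaceT => x; rewrite inE /= in_itv /=.
exact: H.
Qed.

Lemma cont_integrable a b f : cont_on a b f ->
  lebesgue_measure.-integrable `[a, b] (EFin \o f).
Proof.
move=> H; apply: continuous_compact_integrable; first exact: segment_compact.
exact: cont_on_within.
Qed.

Lemma cont_onD a b f g : cont_on a b f -> cont_on a b g ->
  cont_on a b (fun x => f x + g x).
Proof. by move=> hf hg x xab; apply: continuousD; [exact: hf|exact: hg]. Qed.

Lemma cont_onM a b f g : cont_on a b f -> cont_on a b g ->
  cont_on a b (fun x => f x * g x).
Proof. by move=> hf hg x xab; apply: continuousM; [exact: hf|exact: hg]. Qed.

Lemma cont_on_cst (T : topologicalType) a b (k : T) :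
  cont_on a b (fun _ => k).
Proof. by move=> x _; apply: cst_continuous. Qed.

Lemma rintD a b f g : cont_on a b f -> cont_on a b g ->
  rint a b (fun x => f x + g x) = rint a b f + rint a b g.
Proof. by move=> /cont_integrable hf /cont_integrable hg; apply: RintegralD. Qed.

Lemma rintZ a b k f : cont_on a b f ->
  rint a b (fun x => k * f x) = k * rint a b f.
Proof. by move=> /cont_integrable hf; apply: RintegralZl. Qed.

Lemma eq_rint a b f g : (forall x, a <= x <= b -> f x = g x) ->
  rint a b f = rint a b g.
Proof.
by move=> H; apply: eq_Rintegral => x; rewrite inE /= in_itv /=; apply: H.
Qed.

Lemma rint_le a b f g : cont_on a b f -> cont_on a b g ->
  (forall x, a <= x <= b -> f x <= g x) -> rint a b f <= rint a b g.
Proof.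
move=> /cont_integrable hf /cont_integrable hg H.
by apply: le_Rintegral => // x; rewrite /= in_itv /=; apply: H.
Qed.

Lemma rint_ge0 a b f : (forall x, a <= x <= b -> 0 <= f x) -> 0 <= rint a b f.
Proof. by move=> H; apply: Rintegral_ge0 => x; rewrite /= in_itv; apply: H. Qed.

Lemma rint_abs a b f : cont_on a b f ->
  `|rint a b f| <= rint a b (fun x => `|f x|).
Proof. by move=> /cont_integrable hf; apply: le_normr_Rintegral. Qed.

Lemma rint_cst a b k : a <= b -> rint a b (fun _ => k) = k * (b - a).
Proof.
move=> ab; rewrite /rint Rintegral_cst //= lebesgue_measure_itv /=.
rewrite lte_fin; case: ltP => // ba; rewrite (_ : b = a) ?subrr //.
by apply/le_anti; rewrite ab ba.
Qed.

Lemma rint_split a b c f : a <= b -> b <= c -> cont_on a c f ->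
  rint a c f = rint a b f + rint b c f.
Proof.
move=> ab bc hf; apply/eqP; rewrite addrC -subr_eq; apply/eqP.
rewrite /rint (@Rintegral_itvB _ _ _ _ b (cont_integrable hf)) ?bnd_simp //.
apply: Rintegral_itv_obnd_cbnd.
apply: integrableS (cont_integrable (cont_on_sub ab (lexx c) hf)) => //.
by apply: subset_itvr; rewrite bnd_simp.
Qed.

Lemma rint_cont_norm a b f : cont_on a b f -> cont_on a b (fun x => `|f x|).
Proof.
move=> hf x xab; apply: (@continuous_comp _ _ _ f Num.norm); first exact: hf.
exact: norm_continuous.
Qed.

Lemma rint_shift a b s f : a <= b -> cont_on (a + s) (b + s) f ->
  rint (a + s) (b + s) f = rint a b (fun x => f (x + s)).
Proof.
move=> ab hf; rewrite /rint /Rintegral.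
pose F (x : R) : R := x + s.
have dF x : is_derive x (1 : R) (F : R -> R^o) 1.
  by rewrite -[1 in X in is_derive _ _ _ X]addr0; apply: is_deriveD.
have F'E : F^`()%classic = cst 1 by apply/funext => x; rewrite derive1E derive_val.
rewrite -/(F a) -/(F b) (integration_by_substitution_increasing ab).
- congr fine; apply: eq_integral => x _ /=.
  by rewrite F'E /= mulr1.
- by move=> x y _ _ xy; rewrite /F ltrD2r.
- by rewrite F'E => x _; apply: cst_continuous.
- by rewrite F'E; apply: is_cvg_cst.
- by rewrite F'E; apply: is_cvg_cst.
- have cF : continuous F.
    move=> x; apply: differentiable_continuous; apply/derivable1_diffP.
    exact: ex_derive.
  split; first by move=> x _; exact: ex_derive.
  + exact: cvg_at_right_filter (cF a).
  + exact: cvg_at_left_filter (cF b).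
- exact: cont_on_within.
Qed.

Lemma rint_opp a b f : a <= b -> cont_on (- b) (- a) f ->
  rint (- b) (- a) f = rint a b (fun x => f (- x)).
Proof.
move=> ab hf; rewrite /rint /Rintegral integration_by_substitution_oppr //.
exact: cont_on_within.
Qed.

Lemma rint_id a b : a <= b -> rint a b id = (b ^+ 2 - a ^+ 2) / 2.
Proof.
rewrite le_eqVlt => /predU1P[->|ab].
  by rewrite subrr mul0r /rint set_itv1 Rintegral_set1.
pose F (x : R) : R := x ^+ 2 / 2.
have dF x : is_derive x (1 : R) (F : R -> R^o) x.
  have H : is_derive x (1 : R) (fun y : R => 2^-1 *: (y ^+ 2 : R^o)) x.
    by apply: is_derive_eq; rewrite /GRing.scale /=; field.
  by rewrite (_ : F = fun y => 2^-1 *: (y ^+ 2 : R^o)) //; apply/funext => y; rewrite /F mulrC.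
have cF : continuous F.
  move=> x; apply: differentiable_continuous; apply/derivable1_diffP.
  exact: ex_derive.
rewrite /rint /Rintegral (@continuous_FTC2 _ id F) //.
- by rewrite /F /=; field.
- by apply: continuous_subspaceT => x; apply: cvg_id.
- split; first by move=> x _; exact: ex_derive.
  + exact: cvg_at_right_filter (cF a).
  + exact: cvg_at_left_filter (cF b).
- by move=> x _; rewrite derive1E derive_val.
Qed.

End RealIntegral.

(** * Componentwise integrals of complex-valued functions *)

Section ComplexIntegral.
Variable R : realType.
Local Notation C := (cplx R).
Implicit Types (a b c : R) (F G : R -> C).

Definition cint a b F : C :=
  Complex (rint a b (fun x => complex.Re (F x)))
          (rint a b (fun x => complex.Im (F x))).

Lemma cont_on_Re a b F : cont_on a b F ->
  cont_on a b (fun x => complex.Re (F x)).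
Proof.
move=> H x /H /rcontP K; apply/(@cvgrPdist_lt _ R^o) => e /K [d d0 L].
apply/nbhs_ballP; exists d => //= y; rewrite /ball /= distrC => /L.
by apply: le_lt_trans; rewrite distrC -ReN -ReD Re_le_cmod.
Qed.

Lemma cont_on_Im a b F : cont_on a b F ->
  cont_on a b (fun x => complex.Im (F x)).
Proof.
move=> H x /H /rcontP K; apply/(@cvgrPdist_lt _ R^o) => e /K [d d0 L].
apply/nbhs_ballP; exists d => //= y; rewrite /ball /= distrC => /L.
by apply: le_lt_trans; rewrite distrC -ImN -ImD Im_le_cmod.
Qed.

Lemma cont_on_cmod a b F : cont_on a b F -> cont_on a b (fun x => cmod (F x)).
Proof.
move=> H x /H /rcontP K; apply/(@cvgrPdist_lt _ R^o) => e /K [d d0 L].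
apply/nbhs_ballP; exists d => //= y; rewrite /ball /= distrC => /L.
by apply: le_lt_trans; rewrite distrC cmod_dist.
Qed.

Lemma cont_onDC a b F G : cont_on a b F -> cont_on a b G ->
  cont_on a b (fun x => F x + G x).
Proof. by move=> hf hg x xab; apply: continuousD; [exact: hf|exact: hg]. Qed.

Lemma cont_onMC a b F G : cont_on a b F -> cont_on a b G ->
  cont_on a b (fun x => F x * G x).
Proof. by move=> hf hg x xab; apply: (@continuousM R[i]); [exact: hf|exact: hg]. Qed.

Lemma cintD a b F G : cont_on a b F -> cont_on a b G ->
  cint a b (fun x => F x + G x) = cint a b F + cint a b G.
Proof.
move=> hF hG; rewrite /cint.
have -> : (fun x => complex.Re (F x + G x)) =
  (fun x => complex.Re (F x) + complex.Re (G x)) by apply/funext => x; rewrite ReD.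
have -> : (fun x => complex.Im (F x + G x)) =
  (fun x => complex.Im (F x) + complex.Im (G x)) by apply/funext => x; rewrite ImD.
by rewrite !rintD; [|exact: cont_on_Im..|exact: cont_on_Re|exact: cont_on_Re].
Qed.

Lemma cintZ a b (k : C) F : cont_on a b F ->
  cint a b (fun x => k * F x) = k * cint a b F.
Proof.
move=> hF; case: k => u v; rewrite /cint.
have hR := cont_on_Re hF; have hI := cont_on_Im hF.
have kR w : cont_on a b (fun x => w * complex.Re (F x)).
  by apply: cont_onM => //; apply: cont_on_cst.
have kI w : cont_on a b (fun x => w * complex.Im (F x)).
  by apply: cont_onM => //; apply: cont_on_cst.
have -> : (fun x => complex.Re (Complex u v * F x)) =
  (fun x => u * complex.Re (F x) + (- v) * complex.Im (F x)).
  by apply/funext => x; case: (F x) => p q /=; rewrite mulNr.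
have -> : (fun x => complex.Im (Complex u v * F x)) =
  (fun x => u * complex.Im (F x) + v * complex.Re (F x)).
  by apply/funext => x; case: (F x) => p q /=; rewrite [v * p]mulrC.
rewrite !rintD // !rintZ //.
by apply/eqP; rewrite eq_complex /= mulNr !eqxx.
Qed.

Lemma eq_cint a b F G : (forall x, a <= x <= b -> F x = G x) ->
  cint a b F = cint a b G.
Proof.
by move=> H; congr Complex; apply: eq_rint => x /H ->.
Qed.

Lemma cint_cst a b (k : C) : a <= b -> cint a b (fun _ => k) = k * (b - a)%:C.
Proof.
move=> ab; rewrite /cint !rint_cst //; case: k => u v.
by apply/eqP; rewrite eq_complex /= !mulr0 subr0 add0r !eqxx.
Qed.

Lemma cint_split a b c F : a <= b -> b <= c -> cont_on a c F ->
  cint a c F = cint a b F + cint b c F.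
Proof.
move=> ab bc hF; rewrite /cint (rint_split ab bc (cont_on_Re hF)).
by rewrite (rint_split ab bc (cont_on_Im hF)).
Qed.

Lemma cint_shift a b s F : a <= b -> cont_on (a + s) (b + s) F ->
  cint (a + s) (b + s) F = cint a b (fun x => F (x + s)).
Proof.
move=> ab hF; rewrite /cint (rint_shift ab (cont_on_Re hF)).
by rewrite (rint_shift ab (cont_on_Im hF)).
Qed.

Lemma cint_opp a b F : a <= b -> cont_on (- b) (- a) F ->
  cint (- b) (- a) F = cint a b (fun x => F (- x)).
Proof.
move=> ab hF; rewrite /cint (rint_opp ab (cont_on_Re hF)).
by rewrite (rint_opp ab (cont_on_Im hF)).
Qed.

(** Makes the integral of an affine function around a rectangle computable; Goursat's argument
    subtracts such a function. *)
Lemma cint_affine a b (k l : C) : a <= b ->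
  cint a b (fun x => k + l * x%:C) =
  k * (b - a)%:C + l * ((b ^+ 2 - a ^+ 2) / 2)%:C.
Proof.
move=> ab.
have hid : cont_on a b (fun x => x%:C : C).
  move=> x _; apply/rcontP => e e0; exists e => // y.
  by rewrite -(rmorphB (real_complex R)) cmod_real.
have hl : cont_on a b (fun x => l * x%:C).
  by apply: (cont_onMC (F := fun _ => l)); [exact: cont_on_cst|exact: hid].
have hk : cont_on a b (fun _ => k) by exact: cont_on_cst.
rewrite (cintD hk hl) (cintZ _ hid).
rewrite cint_cst //; congr (_ + _ * _).
by rewrite /cint /= -rint_id // rint_cst // mul0r.
Qed.

(** Bounding the two components separately costs the factor 2, which is then carried by all later
    constants. *)
Lemma cint_le_rint a b F : cont_on a b F ->
  cmod (cint a b F) <= 2 * rint a b (fun x => cmod (F x)).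
Proof.
move=> hF; apply: le_trans (cmod_le_ReIm _) _ => /=.
have hm := cont_on_cmod hF.
rewrite mulr2n mulrDl mul1r; apply: lerD.
- apply: le_trans (rint_abs (cont_on_Re hF)) _; apply: rint_le => //.
  + exact: rint_cont_norm (cont_on_Re hF).
  + by move=> x _; apply: Re_le_cmod.
- apply: le_trans (rint_abs (cont_on_Im hF)) _; apply: rint_le => //.
  + exact: rint_cont_norm (cont_on_Im hF).
  + by move=> x _; apply: Im_le_cmod.
Qed.

Lemma cint_le a b M F : a <= b -> cont_on a b F ->
  (forall x, a <= x <= b -> cmod (F x) <= M) ->
  cmod (cint a b F) <= 2 * (M * (b - a)).
Proof.
move=> ab hF H; apply: le_trans (cint_le_rint hF) _.
rewrite ler_pM2l // -rint_cst //; apply: rint_le => //.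
  exact: cont_on_cmod.
exact: cont_on_cst.
Qed.

End ComplexIntegral.

(** * Rules of complex differentiation *)

Section Holomorphy.
Variable R : realType.
Local Notation C := (cplx R).
Implicit Types (f g : C -> C) (z : C).

Lemma hol_cst (k : C) z : derivable (fun _ : C => k) z (1 : C).
Proof. exact: derivable_cst. Qed.

Lemma hol_id z : derivable (fun w : C => w) z (1 : C).
Proof. exact: derivable_id. Qed.

Lemma holD f g z : derivable f z (1 : C) -> derivable g z (1 : C) ->
  derivable (fun w => f w + g w) z (1 : C).
Proof. exact: derivableD. Qed.

Lemma holN f z : derivable f z (1 : C) -> derivable (fun w => - f w) z (1 : C).
Proof. exact: derivableN. Qed.

Lemma holB f g z : derivable f z (1 : C) -> derivable g z (1 : C) ->
  derivable (fun w => f w - g w) z (1 : C).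
Proof. exact: derivableB. Qed.

Lemma holM f g z : derivable f z (1 : C) -> derivable g z (1 : C) ->
  derivable (fun w => f w * g w) z (1 : C).
Proof. exact: (@derivableM R[i] R[i]^o f g z 1). Qed.

Lemma holZ (k : C) f z : derivable f z (1 : C) ->
  derivable (fun w => k * f w) z (1 : C).
Proof. by apply: holM; apply: hol_cst. Qed.

Lemma holX f n z : derivable f z (1 : C) ->
  derivable (fun w => f w ^+ n) z (1 : C).
Proof.
move=> hf; elim: n => [|n IH].
  have -> : (fun w => f w ^+ 0) = fun _ => 1 by apply/funext => w; rewrite expr0.
  exact: hol_cst.
have -> : (fun w => f w ^+ n.+1) = fun w => f w * f w ^+ n.
  by apply/funext => w; rewrite exprS.
exact: holM.
Qed.

Lemma hol_comp f g z : derivable g z (1 : C) -> derivable f (g z) (1 : C) ->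
  derivable (fun w => f (g w)) z (1 : C).
Proof.
move=> /derivableE [Dg hg] /derivableE [Df hf]; apply/derivableE.
exists (Df * Dg) => e e0.
have a0 := cmod_ge0 Dg; have b0 := cmod_ge0 Df.
set a := cmod Dg in a0 *; set b := cmod Df in b0 *.
have a1 : 0 < 2 * (a + 1) by lra.
have b1 : 0 < 2 * (b + 1) by lra.
have [d1 d10 H1] := hf _ (divr_gt0 e0 a1).
have e2 : 0 < Num.min 1 (e / (2 * (b + 1))) by rewrite lt_min ltr01 divr_gt0.
have [d2 d20 H2] := hg _ e2.
exists (Num.min d2 (d1 / (2 * (a + 1)))).
  by rewrite lt_min d20 divr_gt0.
move=> h; rewrite lt_min => /andP[h2 h1]; have {H2} := H2 _ h2.
set k := g (z + h) - g z; move=> H2.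
have h0 := cmod_ge0 h.
have hk1 : cmod (k - Dg * h) <= cmod h.
  by apply: le_trans H2 _; rewrite ler_piMl // ge_min lexx.
have hk2 : cmod (k - Dg * h) <= e / (2 * (b + 1)) * cmod h.
  by apply: le_trans H2 _; rewrite ler_wpM2r // ge_min lexx orbT.
have hk : cmod k <= (a + 1) * cmod h.
  rewrite -(subrK (Dg * h) k); apply: le_trans (cmodD _ _) _.
  by rewrite cmodM -/a mulrDl mul1r addrC lerD2l.
have kd : cmod k < d1.
  apply: le_lt_trans hk _; move: h1; rewrite ltr_pdivlMr //; nra.
have := H1 _ kd; rewrite {1}/k subrKC => {}H1.
(* The remainder of [f] at the increment [k], plus [Df] times the remainder of [g]; the radii above
   give each of them half of [e * cmod h]. *)
have -> : f (g (z + h)) - f (g z) - Df * Dg * h =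
  (f (g (z + h)) - f (g z) - Df * k) + Df * (k - Dg * h) by ring.
apply: le_trans (cmodD _ _) _; rewrite cmodM -/b.
have t1 : e / (2 * (a + 1)) * cmod k <= e / 2 * cmod h.
  have -> : e / 2 * cmod h = e / (2 * (a + 1)) * ((a + 1) * cmod h).
    by field; lra.
  by rewrite ler_wpM2l // divr_ge0 // ltW.
have t2 : b * cmod (k - Dg * h) <= e / 2 * cmod h.
  apply: le_trans (ler_wpM2l b0 hk2) _.
  have -> : e / 2 * cmod h = (b + 1) * (e / (2 * (b + 1)) * cmod h).
    by field; lra.
  apply: ler_wpM2r; last by lra.
  by apply: mulr_ge0 => //; apply: divr_ge0; lra.
apply: le_trans (lerD (le_trans H1 t1) t2) _.
by rewrite -mulrDl -splitr.
Qed.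

Lemma hol_shift f (k : C) z : derivable f (z + k) (1 : C) ->
  derivable (fun w => f (w + k)) z (1 : C).
Proof.
move=> hf; apply: (@hol_comp f (fun w => w + k) z _ hf).
by apply: holD; [exact: hol_id|exact: hol_cst].
Qed.

Lemma holV f z : f z != 0 -> derivable f z (1 : C) ->
  derivable (fun w => (f w)^-1) z (1 : C).
Proof. by move=> fz hf; exact: (@derivableV R[i] R[i]^o f z 1 fz hf). Qed.

End Holomorphy.

(** * Integrals around rectangles *)

Section Rectangles.
Variable R : realType.
Local Notation C := (cplx R).
Implicit Types (a b c d x y : R) (f g : C -> C) (z w : C).

(** Counterclockwise: bottom minus top, and, with dz = i dt, right side minus left side. *)
Definition rect_int a b c d f : C :=
  cint a b (fun t => f (Complex t c)) - cint a b (fun t => f (Complex t d))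
  + Complex 0 1 * (cint c d (fun t => f (Complex b t))
                   - cint c d (fun t => f (Complex a t))).

Definition boundary a b c d x y :=
  [/\ a <= x <= b, c <= y <= d & [\/ x = a, x = b, y = c | y = d]].

Definition cont_bd a b c d f :=
  forall x y, boundary a b c d x y -> {for (Complex x y : C), continuous f}.

Lemma cont_horiz a b y f :
  (forall x, a <= x <= b -> {for (Complex x y : C), continuous f}) ->
  cont_on a b (fun t => f (Complex t y)).
Proof.
move=> H x xab; have /ccontP K := H x xab; apply/rcontP => e /K [d d0 L].
exists d => // x' xx; apply: L; apply: le_lt_trans (cmod_le_ReIm _) _ => /=.
by rewrite subrr normr0 addr0.
Qed.

Lemma cont_vert c d x f :
  (forall y, c <= y <= d -> {for (Complex x y : C), continuous f}) ->
  cont_on c d (fun t => f (Complex x t)).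
Proof.
move=> H y yab; have /ccontP K := H y yab; apply/rcontP => e /K [d' d0 L].
exists d' => // x' xx; apply: L; apply: le_lt_trans (cmod_le_ReIm _) _ => /=.
by rewrite subrr normr0 add0r.
Qed.

Section Sides.
Variables (a b c d : R) (f : C -> C).
Hypotheses (ab : a <= b) (cd : c <= d) (cf : cont_bd a b c d f).

Lemma bd_bottom : cont_on a b (fun t => f (Complex t c)).
Proof. by apply: cont_horiz => x xab; apply: cf; split; rewrite ?lexx //; apply: Or43. Qed.
Lemma bd_top : cont_on a b (fun t => f (Complex t d)).
Proof. by apply: cont_horiz => x xab; apply: cf; split; rewrite ?lexx ?andbT //; apply: Or44. Qed.
Lemma bd_right : cont_on c d (fun t => f (Complex b t)).
Proof. by apply: cont_vert => x xab; apply: cf; split; rewrite ?lexx ?andbT //; apply: Or42. Qed.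
Lemma bd_left : cont_on c d (fun t => f (Complex a t)).
Proof. by apply: cont_vert => x xab; apply: cf; split; rewrite ?lexx //; apply: Or41. Qed.

(** By [cint_le] each side contributes at most twice its length times [M], and there are two sides
    of each length. *)
Lemma rect_int_le M :
  (forall x y, boundary a b c d x y -> cmod (f (Complex x y)) <= M) ->
  cmod (rect_int a b c d f) <= 4 * M * ((b - a) + (d - c)).
Proof.
move=> H.
have h1 : cmod (cint a b (fun t => f (Complex t c))) <= 2 * (M * (b - a)).
  by apply: cint_le bd_bottom _ => // x xab; apply: H; split; rewrite ?lexx //; apply: Or43.
have h2 : cmod (cint a b (fun t => f (Complex t d))) <= 2 * (M * (b - a)).
  by apply: cint_le bd_top _ => // x xab; apply: H; split; rewrite ?lexx ?andbT //; apply: Or44.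
have h3 : cmod (cint c d (fun t => f (Complex b t))) <= 2 * (M * (d - c)).
  by apply: cint_le bd_right _ => // x xab; apply: H; split; rewrite ?lexx ?andbT //; apply: Or42.
have h4 : cmod (cint c d (fun t => f (Complex a t))) <= 2 * (M * (d - c)).
  by apply: cint_le bd_left _ => // x xab; apply: H; split; rewrite ?lexx //; apply: Or41.
apply: le_trans (cmodD _ _) _; rewrite cmodM cmod_i mul1r.
apply: le_trans (lerD (cmodB _ _) (cmodB _ _)) _.
apply: le_trans (lerD (lerD h1 h2) (lerD h3 h4)) _; rewrite le_eqVlt.
by apply/orP; left; apply/eqP; ring.
Qed.

End Sides.

Lemma cont_bdD a b c d f g : cont_bd a b c d f -> cont_bd a b c d g ->
  cont_bd a b c d (fun w => f w + g w).
Proof. by move=> hf hg x y xy; apply: continuousD; [exact: hf|exact: hg]. Qed.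

Lemma cont_bdM a b c d f g : cont_bd a b c d f -> cont_bd a b c d g ->
  cont_bd a b c d (fun w => f w * g w).
Proof.
by move=> hf hg x y xy; apply: (@continuousM R[i]); [exact: hf|exact: hg].
Qed.

Lemma cont_bdZ a b c d (k : C) f : cont_bd a b c d f ->
  cont_bd a b c d (fun w => k * f w).
Proof.
move=> hf x y xy; apply: (@continuousM R[i] _ (fun _ => k)); last exact: hf.
exact: cst_continuous.
Qed.

Lemma rect_intD a b c d f g : a <= b -> c <= d ->
  cont_bd a b c d f -> cont_bd a b c d g ->
  rect_int a b c d (fun w => f w + g w) =
  rect_int a b c d f + rect_int a b c d g.
Proof.
move=> ab cd hf hg; rewrite /rect_int.
rewrite (cintD (bd_bottom cd hf) (bd_bottom cd hg)).
rewrite (cintD (bd_top cd hf) (bd_top cd hg)).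
rewrite (cintD (bd_left ab hf) (bd_left ab hg)).
rewrite (cintD (bd_right ab hf) (bd_right ab hg)); ring.
Qed.

Lemma rect_intZ a b c d (k : C) f : a <= b -> c <= d ->
  cont_bd a b c d f ->
  rect_int a b c d (fun w => k * f w) = k * rect_int a b c d f.
Proof.
move=> ab cd hf; rewrite /rect_int.
rewrite (cintZ k (bd_bottom cd hf)) (cintZ k (bd_top cd hf)).
rewrite (cintZ k (bd_left ab hf)) (cintZ k (bd_right ab hf)); ring.
Qed.

Lemma eq_rect_int a b c d f g : a <= b -> c <= d ->
  (forall x y, boundary a b c d x y -> f (Complex x y) = g (Complex x y)) ->
  rect_int a b c d f = rect_int a b c d g.
Proof.
move=> ab cd H; rewrite /rect_int; congr (_ - _ + _ * (_ - _)); apply: eq_cint => x xx;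
  apply: H; split; rewrite ?lexx ?andbT //.
- exact: Or43.
- exact: Or44.
- exact: Or42.
- exact: Or41.
Qed.

Lemma rect_split_v a m b c d f : a <= m -> m <= b -> c <= d ->
  cont_bd a b c d f ->
  rect_int a b c d f = rect_int a m c d f + rect_int m b c d f.
Proof.
move=> am mb cd hf; rewrite /rect_int.
rewrite (cint_split am mb (bd_bottom cd hf)) (cint_split am mb (bd_top cd hf)).
ring.
Qed.

Lemma rect_split_h a b c m d f : c <= m -> m <= d -> a <= b ->
  cont_bd a b c d f ->
  rect_int a b c d f = rect_int a b c m f + rect_int a b m d f.
Proof.
move=> cm md ab hf; rewrite /rect_int.
rewrite (cint_split cm md (bd_left ab hf)) (cint_split cm md (bd_right ab hf)).
ring.
Qed.

Lemma rect_shift a b c d x0 y0 f : a <= b -> c <= d ->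
  cont_bd (a + x0) (b + x0) (c + y0) (d + y0) f ->
  rect_int (a + x0) (b + x0) (c + y0) (d + y0) f =
  rect_int a b c d (fun w => f (w + Complex x0 y0)).
Proof.
move=> ab cd hf.
have ab' : a + x0 <= b + x0 by rewrite lerD2r.
have cd' : c + y0 <= d + y0 by rewrite lerD2r.
rewrite /rect_int (cint_shift ab (bd_bottom cd' hf)) (cint_shift ab (bd_top cd' hf)).
by rewrite (cint_shift cd (bd_left ab' hf)) (cint_shift cd (bd_right ab' hf)).
Qed.

Lemma rect_affine a b c d (k l : C) : a <= b -> c <= d ->
  rect_int a b c d (fun w => k + l * w) = 0.
Proof.
move=> ab cd; rewrite /rect_int.
have hor y : cint a b (fun t => k + l * Complex t y) =
    (k + l * Complex 0 y) * (b - a)%:C + l * ((b ^+ 2 - a ^+ 2) / 2)%:C.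
  rewrite -cint_affine //; apply: eq_cint => x _.
  rewrite -addrA -mulrDr; congr (_ + _ * _).
  by apply/eqP; rewrite eq_complex /= addr0 add0r !eqxx.
have ver x : cint c d (fun t => k + l * Complex x t) =
    (k + l * x%:C) * (d - c)%:C + (l * Complex 0 1) * ((d ^+ 2 - c ^+ 2) / 2)%:C.
  rewrite -cint_affine //; apply: eq_cint => y _.
  rewrite -addrA -mulrA -mulrDr; congr (_ + _ * _).
  by apply/eqP; rewrite eq_complex /= !mul0r !mulr0 !mul1r subr0 !addr0 !add0r !eqxx.
rewrite !hor !ver; clear hor ver; case: k l => [k1 k2] [l1 l2].
apply/eqP; rewrite eq_complex /=; apply/andP; split; apply/eqP; ring.
Qed.

End Rectangles.

Arguments cmod : simpl never.

(** * Goursat's theorem for rectangles *)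

Section Goursat.
Variable R : realType.
Local Notation C := (cplx R).
Implicit Types (a b c d x y : R) (f g : C -> C) (z w : C).

Definition in_rect a b c d x y := (a <= x <= b) && (c <= y <= d).

Definition hol_rect a b c d f :=
  forall x y, in_rect a b c d x y -> derivable f (Complex x y : C) (1 : C).

Lemma hol_rect_sub a b c d a' b' c' d' f :
  a <= a' -> b' <= b -> c <= c' -> d' <= d ->
  hol_rect a b c d f -> hol_rect a' b' c' d' f.
Proof.
move=> aa bb cc dd H x y /andP[/andP[x1 x2] /andP[y1 y2]].
apply: H; apply/andP; split; apply/andP; split.
- exact: le_trans x1.
- exact: le_trans bb.
- exact: le_trans y1.
- exact: le_trans dd.
Qed.

Lemma hol_rect_bd a b c d f : hol_rect a b c d f -> cont_bd a b c d f.
Proof. by move=> H x y [xab ycd _]; apply/derivable_ccont/H/andP. Qed.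

(** The integral is the sum over the four quarters, so these cannot all fall below [K / 4] in
    modulus. *)
Lemma quarter_step a c (w h K : R) f : 0 <= w -> 0 <= h -> hol_rect a (a + w) c (c + h) f ->
  K <= cmod (rect_int a (a + w) c (c + h) f) ->
  exists a' c', [/\ a <= a', a' + w / 2 <= a + w, c <= c', c' + h / 2 <= c + h &
    K / 4 <= cmod (rect_int a' (a' + w / 2) c' (c' + h / 2) f)].
Proof.
move=> w0 h0 hf HK.
have hsub a' b' c' d' : a <= a' -> b' <= a + w -> c <= c' -> d' <= c + h ->
    cont_bd a' b' c' d' f.
  by move=> ? ? ? ?; apply: hol_rect_bd; apply: hol_rect_sub hf.
have E : rect_int a (a + w) c (c + h) f =
    rect_int a (a + w / 2) c (c + h / 2) f +
    rect_int a (a + w / 2) (c + h / 2) (c + h / 2 + h / 2) f +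
    (rect_int (a + w / 2) (a + w / 2 + w / 2) c (c + h / 2) f +
    rect_int (a + w / 2) (a + w / 2 + w / 2) (c + h / 2) (c + h / 2 + h / 2) f).
  rewrite -!(addrA _ (_ / 2) (_ / 2)) -!splitr.
  rewrite (@rect_split_v _ a (a + w / 2)); [|lra..|by apply: hsub; lra].
  rewrite (@rect_split_h _ a _ c (c + h / 2)); [|lra..|by apply: hsub; lra].
  by rewrite (@rect_split_h _ (a + w / 2) _ c (c + h / 2)); [|lra..|by apply: hsub; lra].
case: (lerP (K / 4) (cmod (rect_int a (a + w / 2) c (c + h / 2) f))) => h1.
  by exists a, c; split => //; clear -w0 h0; lra.
case: (lerP (K / 4) (cmod (rect_int a (a + w / 2) (c + h / 2) (c + h / 2 + h / 2) f))) => h2.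
  by exists a, (c + h / 2); split => //; clear -w0 h0; lra.
case: (lerP (K / 4) (cmod (rect_int (a + w / 2) (a + w / 2 + w / 2) c (c + h / 2) f))) => h3.
  by exists (a + w / 2), c; split => //; clear -w0 h0; lra.
case: (lerP (K / 4) (cmod (rect_int (a + w / 2) (a + w / 2 + w / 2) (c + h / 2) (c + h / 2 + h / 2) f))) => h4.
  by exists (a + w / 2), (c + h / 2); split => //; clear -w0 h0; lra.
suff : K < K by rewrite ltxx.
apply: le_lt_trans HK _; rewrite E.
apply: le_lt_trans (cmodD _ _) _.
apply: le_lt_trans (lerD (cmodD _ _) (cmodD _ _)) _.
move: h1 h2 h3 h4; do 4!move: (cmod _) => ?; clear; lra.
Qed.

(** Nesting puts every left end below every right end, so the supremum of the left ends lies in all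
    intervals. *)
Lemma nested_point (s w : nat -> R) :
  (forall n, s n <= s n.+1) -> (forall n, s n.+1 + w n.+1 <= s n + w n) ->
  (forall n, 0 <= w n) -> exists x, forall n, s n <= x <= s n + w n.
Proof.
move=> s1 s2 w0.
have smon n m : (n <= m)%N -> s n <= s m.
  move=> /subnK <-; elim: (m - n)%N => [|k IH] //=.
  by apply: le_trans IH _; rewrite addSn.
have wmon n m : (n <= m)%N -> s m + w m <= s n + w n.
  move=> /subnK <-; elim: (m - n)%N => [|k IH] //=.
  by apply: le_trans IH; rewrite addSn.
have sw n m : s n <= s m + w m.
  case: (leqP n m) => nm.
    by apply: le_trans (smon _ _ nm) _; rewrite lerDl.
  by apply: le_trans (wmon _ _ (ltnW nm)); rewrite lerDl.
have hs : has_sup (range s).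
  by split; [exists (s 0%N), 0%N|exists (s 0%N + w 0%N) => _ [n _ <-]].
exists (sup (range s)) => n; apply/andP; split.
  by apply: sup_upper_bound => //; exists n.
by apply: sup_le_ub => [|_ [m _ <-]]; [exists (s 0%N), 0%N|].
Qed.

Theorem goursat a b c d f : a <= b -> c <= d -> hol_rect a b c d f ->
  rect_int a b c d f = 0.
Proof.
move=> ab cd hf; apply/eqP; rewrite -cmod_eq0; apply/negPn/negP => I0.
set K := cmod (rect_int a b c d f).
have K0 : 0 < K by rewrite lt_neqAle cmod_ge0 eq_sym I0.
pose W := b - a; pose H := d - c.
have W0 : 0 <= W by rewrite subr_ge0.
have H0 : 0 <= H by rewrite subr_ge0.
pose w n := W / 2 ^+ n; pose h n := H / 2 ^+ n.
have w0 n : 0 <= w n by rewrite divr_ge0 ?exprn_ge0.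
have h0 n : 0 <= h n by rewrite divr_ge0 ?exprn_ge0.
have wS n : w n.+1 = w n / 2 by rewrite /w exprSr invfM mulrA.
have hS n : h n.+1 = h n / 2 by rewrite /h exprSr invfM mulrA.
pose good n (p : R * R) := [/\ a <= p.1, p.1 + w n <= b, c <= p.2, p.2 + h n <= d &
  K / 4 ^+ n <= cmod (rect_int p.1 (p.1 + w n) p.2 (p.2 + h n) f)].
(* Stated as an implication so that the choice is total: from a corner that is not [good] any point
   will do, and a single function [F] can be iterated. *)
have step : forall np : nat * (R * R), exists q : R * R, good np.1 np.2 ->
    [/\ good np.1.+1 q, np.2.1 <= q.1, q.1 + w np.1.+1 <= np.2.1 + w np.1,
      np.2.2 <= q.2 & q.2 + h np.1.+1 <= np.2.2 + h np.1].
  move=> [n [p1 p2]] /=; have [|ng] := pselect (good n (p1, p2)); last by exists (0, 0).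
  move=> [/= A1 A2 A3 A4 A5].
  have [|a' [c' [B1 B2 B3 B4 B5]]] := quarter_step (w0 n) (h0 n) _ A5.
    exact: hol_rect_sub hf.
  exists (a', c') => _; rewrite /good wS hS /=; split => //; split => //.
  + exact: le_trans B1.
  + exact: le_trans A2.
  + exact: le_trans B3.
  + exact: le_trans A4.
  by rewrite exprSr invfM mulrA.
have {step}[F HF] := choice step.
pose s := fix s n := if n is m.+1 then F (m, s m) else (a, c).
have gs n : good n (s n).
  elim: n => [|n IH]; last by have [] := HF (n, s n) IH.
  split => //=; rewrite ?lexx //; rewrite /w /h /W /H expr0 !divr1 ?subrKC ?lexx //.
have [||//|x0 hx] := @nested_point (fun n => (s n).1) w.
- by move=> n; have [] := HF (n, s n) (gs n).
- by move=> n; have [] := HF (n, s n) (gs n).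
have [||//|y0 hy] := @nested_point (fun n => (s n).2) h.
- by move=> n; have [] := HF (n, s n) (gs n).
- by move=> n; have [] := HF (n, s n) (gs n).
have /hf/derivableE [D HD] : in_rect a b c d x0 y0.
  have := hx 0%N; have := hy 0%N; rewrite /= /w /h expr0 !divr1 /W /H !subrKC.
  by rewrite /in_rect => -> ->.
set z0 : C := Complex x0 y0 in HD.
pose S := (W + H) ^+ 2.
have S0 : 0 <= S by rewrite sqr_ge0.
(* Makes [4 * e * S < K]; the remainder estimate below gives [4 * e * S / 4 ^+ n] as an upper bound
   for a quantity that is at least [K / 4 ^+ n]. *)
pose e := K / (8 * (S + 1)).
have S8 : 0 < 8 * (S + 1) by lra.
have e0 : 0 < e by rewrite divr_gt0.
have [r r0 Hr] := HD _ e0.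
have [n hn] : exists n, w n + h n < r.
  have : (2^-1 : R) ^+ n @[n --> \oo] --> (0 : R^o).
    by apply: cvg_expr; rewrite ger0_norm ?invr_ge0 // invf_lt1 // ltr1n.
  move=> /cvgrPdist_lt /(_ (r / (W + H + 1))) [].
    by rewrite divr_gt0 //; lra.
  move=> n _ /(_ n (leqnn _)) /=; rewrite sub0r normrN ger0_norm ?exprn_ge0 ?invr_ge0 //.
  move=> Hn; exists n; rewrite /w /h -exprVn -mulrDl.
  move: Hn; rewrite ltr_pdivlMr; last by lra.
  have : 0 < (2^-1 : R) ^+ n by rewrite exprn_gt0 // invr_gt0.
  set t := _ ^+ n; nra.
have [/= A1 A2 A3 A4 A5] := gs n.
set a1 := (s n).1 in A1 A2 A5; set c1 := (s n).2 in A3 A4 A5.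
(* The affine part of the expansion at [z0] integrates to 0, which leaves a remainder of size [e]
   times the half-perimeter. *)
pose g (z : C) := f z - (f z0 - D * z0 + D * z).
have haff (z : C) : derivable (fun z : C => f z0 - D * z0 + D * z) z (1 : C).
  by apply: holD; [exact: hol_cst|apply: holZ; exact: hol_id].
have hf1 : hol_rect a1 (a1 + w n) c1 (c1 + h n) f.
  exact: hol_rect_sub hf.
have hg : hol_rect a1 (a1 + w n) c1 (c1 + h n) g.
  by move=> x y xy; apply: holB; [exact: hf1|exact: haff].
have E : rect_int a1 (a1 + w n) c1 (c1 + h n) f = rect_int a1 (a1 + w n) c1 (c1 + h n) g.
  have wn := w0 n; have hn0 := h0 n.
  have -> : f = fun z => g z + (f z0 - D * z0 + D * z).
    by apply/funext => z; rewrite /g subrK.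
  rewrite rect_intD ?lerDl //; last 2 first.
  - by apply: hol_rect_bd.
  - by move=> x y _; apply: derivable_ccont.
  rewrite rect_affine ?lerDl // addr0; congr rect_int.
have bound : cmod (rect_int a1 (a1 + w n) c1 (c1 + h n) g) <=
    4 * (e * (w n + h n)) * (w n + h n).
  rewrite -[X in _ * (X + _)](addKr a1) -[X in _ * (_ + X)](addKr c1).
  rewrite ![- _ + _]addrC; apply: rect_int_le; rewrite ?lerDl //.
    exact: hol_rect_bd.
  move=> x y [/andP[x1 x2] /andP[y1 y2] _].
  have xy : cmod (Complex x y - z0) <= w n + h n.
    have /andP[H1 H2] := hx n; have /andP[H3 H4] := hy n.
    rewrite -/a1 -/c1 in x1 x2 y1 y2 *.
    apply: le_trans (cmod_le_ReIm _) _ => /=; clear -x1 x2 y1 y2 H1 H2 H3 H4.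
    by apply: lerD; rewrite ler_norml; apply/andP; split; lra.
  have := Hr (Complex x y - z0) (le_lt_trans xy hn).
  rewrite subrKC => Hxy.
  have -> : g (Complex x y) = f (Complex x y) - f z0 - D * (Complex x y - z0).
    by rewrite /g; ring.
  by apply: le_trans Hxy _; rewrite ler_pM2l.
have : K / 4 ^+ n <= 4 * e * S / 4 ^+ n.
  apply: le_trans A5 _; rewrite E; apply: le_trans bound _.
  rewrite le_eqVlt; apply/orP; left; apply/eqP.
  rewrite /w /h /S (_ : 4 ^+ n = 2 ^+ n * 2 ^+ n :> R).
    by field; rewrite expf_neq0.
  by rewrite -exprMn -natrM.
rewrite ler_pM2r ?invr_gt0 ?exprn_gt0 //.
rewrite (_ : 4 * e * S = K * (4 * S / (8 * (S + 1)))); last first.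
  by rewrite /e; field; lra.
rewrite -{1}[K]mulr1 ler_pM2l // ler_pdivlMr //; lra.
Qed.

End Goursat.

(** * Residues at simple poles and Cauchy's formula *)

Section Residue.
Variable R : realType.
Local Notation C := (cplx R).
Implicit Types (a b c d x y r : R) (f g : C -> C) (z w : C).

Lemma Complex_Re_Im z : Complex (complex.Re z) (complex.Im z) = z.
Proof. by case: z. Qed.

Definition hol_punct a b c d z f := forall x y, in_rect a b c d x y ->
  (Complex x y : C) != z -> derivable f (Complex x y : C) (1 : C).

Lemma Complex_neq x y x' y' : (Complex x y != Complex x' y' :> R[i]) =
  (x != x') || (y != y').
Proof. by rewrite eq_complex /= negb_and. Qed.

(** Cutting below, above, left and right of the small square leaves four pieces that avoid the
    puncture, each with zero integral by Goursat. *)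
Lemma puncture a b c d x0 y0 r f : 0 < r ->
  a <= x0 - r -> x0 + r <= b -> c <= y0 - r -> y0 + r <= d ->
  hol_punct a b c d (Complex x0 y0) f ->
  rect_int a b c d f = rect_int (x0 - r) (x0 + r) (y0 - r) (y0 + r) f.
Proof.
move=> r0 ax xb cy yd hf.
have hx : x0 - r <= x0 + r by lra.
have hy : y0 - r <= y0 + r by lra.
have ab : a <= b by lra.
have cd : c <= d by lra.
have bd a' b' c' d' : a <= a' -> b' <= b -> c <= c' -> d' <= d ->
   [/\ a' != x0, b' != x0, c' != y0 & d' != y0] -> cont_bd a' b' c' d' f.
  move=> a1 b1 c1 d1 [a2 b2 c2 d2] x y [/andP[x1 x2] /andP[y1 y2] h].
  apply/derivable_ccont/hf.
    by apply/andP; split; apply/andP; split; lra.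
  by rewrite Complex_neq; case: h => ->; rewrite ?a2 ?b2 ?c2 ?d2 ?orbT.
have hol a' b' c' d' : a <= a' -> b' <= b -> c <= c' -> d' <= d ->
   [\/ x0 < a', b' < x0, y0 < c' | d' < y0] -> hol_rect a' b' c' d' f.
  move=> a1 b1 c1 d1 h x y /andP[/andP[x1 x2] /andP[y1 y2]].
  apply/hf; first by apply/andP; split; apply/andP; split; lra.
  by rewrite Complex_neq; case: h => h; apply/orP; [left|left|right|right];
    apply/eqP; lra.
have ne : [/\ a != x0, b != x0, c != y0 & d != y0] by split; apply/eqP; lra.
have ne1 : y0 - r != y0 by apply/eqP; lra.
have ne2 : y0 + r != y0 by apply/eqP; lra.
have ne3 : x0 - r != x0 by apply/eqP; lra.
have ne4 : x0 + r != x0 by apply/eqP; lra.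
case: ne => na nb nc nd.
rewrite (@rect_split_h _ a b c (y0 - r)) //; [|lra|by apply: bd].
rewrite goursat //; last by apply: hol => //; [lra|apply: Or44; lra].
rewrite add0r (@rect_split_h _ a b (y0 - r) (y0 + r)) //; [|by apply: bd].
rewrite [X in _ + X]goursat //; last by apply: hol => //; [lra|apply: Or43; lra].
rewrite addr0 (@rect_split_v _ a (x0 - r)) //; [|lra|by apply: bd].
rewrite goursat //; last by apply: hol => //; [lra|apply: Or42; lra].
rewrite add0r (@rect_split_v _ (x0 - r) (x0 + r)) //; [|by apply: bd].
rewrite [X in _ + X]goursat //; last by apply: hol => //; [lra|apply: Or41; lra].
by rewrite addr0.
Qed.

(** The number 2 pi i, kept as a symbol whose size enters only through [c0_ge]. *)
Definition c0 : C := rect_int (-1) 1 (-1) 1 (fun w => w^-1).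

Lemma Complex_neq0 x y : x != 0 \/ y != 0 -> (Complex x y : C) != 0.
Proof.
move=> h; rewrite -[0]/(Complex (0 : R) 0) Complex_neq.
by case: h => ->; rewrite ?orbT.
Qed.

Lemma hol_inv z : z != 0 -> derivable (fun w : C => w^-1) z (1 : C).
Proof. by move=> z0; apply: (holV (f := fun w => w)) => //; exact: hol_id. Qed.

(** On each side of the square the imaginary part has density [(1 + t ^+ 2)^-1], which is at least
    1/2 over a length of 2; so each side contributes at least 1. *)
Lemma c0_ge : 4 <= cmod c0.
Proof.
apply: le_trans (Im_le_cmod c0); apply: le_trans (ler_norm _).
have cb : cont_bd (-1) 1 (-1) 1 (fun w : C => w^-1).
  move=> x y [_ _ h]; apply/derivable_ccont/hol_inv/Complex_neq0.
  by case: h => ->; [left|left|right|right]; apply/eqP; lra.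
have l1 : (-1 : R) <= 1 by lra.
have key (f : R -> R) : cont_on (-1) 1 f -> (forall t, -1 <= t <= 1 -> f t = (1 + t ^+ 2)^-1) ->
    1 <= rint (-1) 1 f.
  move=> cf fE; have E : rint (-1 : R) 1 (fun _ => 2^-1) = 1 by rewrite rint_cst //; field.
  rewrite -[X in X <= _]E.
  apply: rint_le => //; first exact: cont_on_cst.
  move=> t t1; rewrite fE // lef_pV2 ?posrE //; first nra.
  by have := sqr_ge0 t; lra.
have E : complex.Im c0 =
    rint (-1 : R) 1 (fun t => complex.Im (Complex t (-1))^-1)
    - rint (-1 : R) 1 (fun t => complex.Im (Complex t 1)^-1)
    + (rint (-1 : R) 1 (fun t => complex.Re (Complex 1 t)^-1)
    - rint (-1 : R) 1 (fun t => complex.Re (Complex (-1) t)^-1)).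
  by rewrite /c0 /rect_int /= mul0r mul1r add0r.
have ReV x y : complex.Re (Complex x y : C)^-1 = x / (x ^+ 2 + y ^+ 2) by [].
have ImV x y : complex.Im (Complex x y : C)^-1 = - (y / (x ^+ 2 + y ^+ 2)) by [].
have k1 : 1 <= rint (-1 : R) 1 (fun t => complex.Im (Complex t (-1))^-1).
  apply: key; first exact: cont_on_Im (bd_bottom l1 cb).
  by move=> t _; rewrite ImV mulN1r opprK sqrrN expr1n addrC.
have k2 : 1 <= - rint (-1 : R) 1 (fun t => complex.Im (Complex t 1)^-1).
  rewrite -[X in 1 <= X]mulN1r -rintZ; last exact: cont_on_Im (bd_top l1 cb).
  apply: key.
    by apply: cont_onM; [exact: cont_on_cst|exact: cont_on_Im (bd_top l1 cb)].
  by move=> t _; rewrite ImV mulN1r opprK mul1r expr1n addrC.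
have k3 : 1 <= rint (-1 : R) 1 (fun t => complex.Re (Complex 1 t)^-1).
  apply: key; first exact: cont_on_Re (bd_right l1 cb).
  by move=> t _; rewrite ReV mul1r expr1n.
have k4 : 1 <= - rint (-1 : R) 1 (fun t => complex.Re (Complex (-1) t)^-1).
  rewrite -[X in 1 <= X]mulN1r -rintZ; last exact: cont_on_Re (bd_left l1 cb).
  apply: key.
    by apply: cont_onM; [exact: cont_on_cst|exact: cont_on_Re (bd_left l1 cb)].
  by move=> t _; rewrite ReV !mulN1r opprK sqrrN expr1n.
have := lerD (lerD k1 k2) (lerD k3 k4); rewrite E.
set s1 := rint _ _ _; set s2 := rint _ _ _; set s3 := rint _ _ _; set s4 := rint _ _ _.
by clear; lra.
Qed.

Lemma c0_neq0 : c0 != 0.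
Proof. by rewrite -cmod_gt0; apply: lt_le_trans c0_ge. Qed.

Lemma square_inv r : 0 < r <= 1 -> rect_int (- r) r (- r) r (fun w : C => w^-1) = c0.
Proof.
move=> /andP[r0 r1]; rewrite /c0 (@puncture (-1) 1 (-1) 1 0 0 r) ?sub0r ?add0r //.
- by rewrite lerN2.
- by rewrite lerN2.
- by move=> x y _ xy; apply: hol_inv.
Qed.

(** [A] is the residue, given as the limit of [w * f (w + z0)]. After [A / w] is subtracted the
    integrand is o(1/r) on the boundary of a square of half-side r, whose perimeter is 8 r; so the
    rest of the integral vanishes as r shrinks. *)
Theorem residue a b c d x0 y0 f (A : C) : a < x0 < b -> c < y0 < d ->
  hol_punct a b c d (Complex x0 y0) f ->
  (forall e : R, 0 < e -> exists2 r : R, 0 < r & forall w, w != 0 -> cmod w < r ->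
     cmod (w * f (w + Complex x0 y0) - A) <= e) ->
  rect_int a b c d f = c0 * A.
Proof.
move=> /andP[ax xb] /andP[cy yd] hf hA.
apply/eqP; rewrite -subr_eq0 -cmod_eq0; apply/eqP/le_anti/andP; split; last exact: cmod_ge0.
apply/ler_addgt0Pr => e e0; rewrite add0r.
have [|r1 r10 H] := hA (e / 32); first by rewrite divr_gt0.
(* On the boundary of the square [r <= cmod w <= 2 * r], hence a third of [r1]; the cap 1 is for
   [square_inv], and the other entries keep the square inside the rectangle. *)
pose r := Num.min (Num.min 1 (r1 / 3))
  (Num.min (Num.min (x0 - a) (b - x0)) (Num.min (y0 - c) (d - y0))).
have : 0 < r by rewrite !lt_min ltr01 divr_gt0 //= !subr_gt0 ax xb cy yd.
have : r <= r by [].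
rewrite {2}/r !le_min -!andbA => /and5P[rr1 rr2 rr3 rr4 /andP[rr5 rr6]] r0.
move: rr1 rr2 rr3 rr4 rr5 rr6 r0; move: r => r rr1 rr2 rr3 rr4 rr5 rr6 r0.
rewrite (@puncture _ _ _ _ x0 y0 r) //; try lra.
have E1 : x0 - r = - r + x0 by rewrite addrC.
have E2 : y0 - r = - r + y0 by rewrite addrC.
rewrite E1 E2 (addrC x0) (addrC y0).
set z0 : C := Complex x0 y0 in hf H *.
have rr : - r <= r by lra.
have bdf x y : boundary (- r) r (- r) r x y ->
   (Complex x y : C) != 0 /\ derivable f (Complex x y + z0 : C) (1 : C).
  move=> [/andP[x1 x2] /andP[y1 y2] h].
  have h0 : (Complex x y : C) != 0.
    apply: Complex_neq0; by case: h => ->; [left|left|right|right]; apply/eqP; lra.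
  split => //; apply: (hf (x + x0) (y + y0)).
    by apply/andP; split; apply/andP; split; lra.
  by rewrite (_ : Complex _ _ = Complex x y + z0) // -subr_eq0 addrK.
rewrite rect_shift //; last first.
  move=> x y [/andP[x1 x2] /andP[y1 y2] h].
  have [|_] := bdf (x - x0) (y - y0).
    split; [lra|lra|].
    by case: h => ->; rewrite ?addrK; [apply: Or41|apply: Or42|apply: Or43|apply: Or44].
  have -> : Complex (x - x0) (y - y0) + z0 = Complex x y.
    by apply/eqP; rewrite eq_complex /= !subrK !eqxx.
  exact: derivable_ccont.
rewrite -/z0.
pose g w : C := f (w + z0) - A * w^-1.
have cf : cont_bd (- r) r (- r) r (fun w => f (w + z0)).
  move=> x y /bdf[_ h]; apply/derivable_ccont.
  exact: hol_shift.
have ci : cont_bd (- r) r (- r) r (fun w : C => w^-1).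
  by move=> x y /bdf[h _]; apply/derivable_ccont/hol_inv.
have ca : cont_bd (- r) r (- r) r (fun w : C => A * w^-1).
  by move=> x y /bdf[h _]; apply/derivable_ccont/holZ/hol_inv.
have cg : cont_bd (- r) r (- r) r g.
  move=> x y xy; apply: continuousD; first exact: cf.
  by apply: continuousN; apply: ca.
have -> : rect_int (- r) r (- r) r (fun w => f (w + z0)) =
   rect_int (- r) r (- r) r g + c0 * A.
  have r01 : 0 < r <= 1 by rewrite r0.
  have E3 := rect_intZ A rr rr ci; rewrite (square_inv r01) mulrC in E3.
  rewrite -E3 -(rect_intD rr rr cg ca).
  by congr rect_int; apply/funext => w; rewrite /g subrK.
rewrite addrK.
have gb x y : boundary (- r) r (- r) r x y -> cmod (g (Complex x y)) <= e / 32 / r.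
  move=> hb; have [w0 _] := bdf _ _ hb; case: hb => /andP[x1 x2] /andP[y1 y2] h.
  set w : C := Complex x y in w0 *.
  have wr : cmod w < r1.
    apply: le_lt_trans (cmod_le_ReIm w) _ => /=.
    have : `|x| <= r by rewrite ler_norml x1.
    have : `|y| <= r by rewrite ler_norml y1.
    by lra.
  have rw : r <= cmod w.
    case: h => h.
    - by apply: le_trans (Re_le_cmod w); rewrite /= h normrN ger0_norm // ltW.
    - by apply: le_trans (Re_le_cmod w); rewrite /= h ger0_norm // ltW.
    - by apply: le_trans (Im_le_cmod w); rewrite /= h normrN ger0_norm // ltW.
    - by apply: le_trans (Im_le_cmod w); rewrite /= h ger0_norm // ltW.
  have -> : g w = (w * f (w + z0) - A) / w by rewrite /g; field.
  rewrite cmodM cmodV; apply: ler_pM (H _ w0 wr) _.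
  - exact: cmod_ge0.
  - by rewrite invr_ge0 cmod_ge0.
  - by rewrite lef_pV2 // posrE // (lt_le_trans r0).
apply: le_trans (rect_int_le rr rr cg gb) _.
have -> : 4 * (e / 32 / r) * (r - - r + (r - - r)) = e / 2.
  by field; rewrite gt_eqF.
by clear -e0; lra.
Qed.

Corollary cauchy_formula a b c d x0 y0 f : a < x0 < b -> c < y0 < d ->
  hol_rect a b c d f ->
  rect_int a b c d (fun w => f w / (w - Complex x0 y0)) = c0 * f (Complex x0 y0).
Proof.
move=> hx hy hf; apply: (residue hx hy).
  move=> x y xy h; apply: holM; first exact: hf.
  apply: holV; first by rewrite subr_eq0.
  by apply: holB; [exact: hol_id|exact: hol_cst].
move=> e e0; have /derivable_ccont/ccontP : derivable f (Complex x0 y0 : C) (1 : C).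
  by apply: hf; apply/andP; split; apply/andP; split; apply/ltW; case/andP: hx hy => ? ? /andP[].
move=> /(_ _ e0) [r r0 H]; exists r => // w w0 wr.
rewrite addrK mulrCA divff // mulr1; apply/ltW/H.
by rewrite addrK.
Qed.

End Residue.

(** * Second-order Taylor expansion with remainder *)

Section Taylor.
Variable R : realType.
Local Notation C := (cplx R).
Implicit Types (x y r : R) (f g : C -> C) (z w : C).

(** With u = w - z, expand 1/(u - h) = 1/u + h/u^2 + h^2/u^3 + h^3/(u^3 (u - h)) under Cauchy's
    formula. The coefficients [A1] and [A2] are contour integrals over the square of half-side [r],
    which fits into the disc of radius [2 * r]. *)
Lemma taylor2 f z r (M : R) : 0 < r ->
  (forall w, cmod (w - z) <= 2 * r -> derivable f w (1 : C) /\ cmod (f w) <= M) ->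
  exists A1 A2 : C, [/\ cmod A1 <= 4 * M / r, cmod A2 <= 4 * M / r ^+ 2 &
    forall h, cmod h <= r / 2 ->
      cmod (f (z + h) - f z - A1 * h - A2 * h ^+ 2) <= 8 * M * cmod h ^+ 3 / r ^+ 3].
Proof.
move=> r0 Hf; case: z Hf => x0 y0; set z : C := Complex x0 y0 => Hf.
have rx : x0 - r <= x0 + r by lra.
have ry : y0 - r <= y0 + r by lra.
pose I := rect_int (x0 - r) (x0 + r) (y0 - r) (y0 + r).
have M0 : 0 <= M.
  apply: le_trans (cmod_ge0 (f z)) (Hf z _).2; rewrite subrr cmod0; lra.
have inr x y : in_rect (x0 - r) (x0 + r) (y0 - r) (y0 + r) x y ->
    cmod (Complex x y - z) <= 2 * r.
  move=> /andP[/andP[x1 x2] /andP[y1 y2]].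
  apply: le_trans (cmod_le_ReIm _) _ => /=; rewrite [2 * r]mulr_natl mulr2n.
  by apply: lerD; rewrite ler_norml; apply/andP; split; lra.
have hf : hol_rect (x0 - r) (x0 + r) (y0 - r) (y0 + r) f.
  by move=> x y /inr /Hf[].
have bd x y : boundary (x0 - r) (x0 + r) (y0 - r) (y0 + r) x y ->
    [/\ cmod (f (Complex x y)) <= M, derivable f (Complex x y : C) (1 : C) &
     r <= cmod (Complex x y - z)].
  move=> [xx yy h]; have /inr/Hf[? ?] : in_rect (x0 - r) (x0 + r) (y0 - r) (y0 + r) x y.
    by rewrite /in_rect xx yy.
  split => //; case: h => ->.
  - by apply: le_trans (Re_le_cmod _); rewrite /= addrC addKr normrN ger0_norm // ltW.
  - by apply: le_trans (Re_le_cmod _); rewrite /= addrC addKr ger0_norm // ltW.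
  - by apply: le_trans (Im_le_cmod _); rewrite /= addrC addKr normrN ger0_norm // ltW.
  - by apply: le_trans (Im_le_cmod _); rewrite /= addrC addKr ger0_norm // ltW.
have c04 := @c0_ge R.
have c00 := @c0_neq0 R.
(* For this square [rect_int_le] gives [16 * B * r], and dividing by [c0], of modulus at least 4,
   leaves [4 * B * r]. *)
have Ile g (B : R) : cont_bd (x0 - r) (x0 + r) (y0 - r) (y0 + r) g ->
    (forall x y, boundary (x0 - r) (x0 + r) (y0 - r) (y0 + r) x y -> cmod (g (Complex x y)) <= B) ->
    cmod ((c0 R)^-1 * I g) <= 4 * B * r.
  move=> cg gB; rewrite cmodM cmodV ler_pdivrMl; last by apply: lt_le_trans c04.
  apply: le_trans (rect_int_le rx ry cg gB) _.
  have B0 : 0 <= B.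
    apply: le_trans (cmod_ge0 (g (Complex (x0 - r) y0))) (gB _ _ _).
    by split; [lra|lra|apply: Or41].
  have -> : 4 * B * (x0 + r - (x0 - r) + (y0 + r - (y0 - r))) = 4 * (4 * B * r) by ring.
  by apply: ler_wpM2r c04; rewrite !mulr_ge0 // ltW.
pose u w : C := w - z.
have hu w : derivable u w (1 : C).
  by apply: holB; [exact: hol_id|exact: hol_cst].
have u0 x y : boundary (x0 - r) (x0 + r) (y0 - r) (y0 + r) x y -> u (Complex x y) != 0.
  by move=> /bd[_ _ h]; rewrite -cmod_gt0; apply: lt_le_trans h.
pose g n w := f w * (u w ^+ n)^-1.
have cgn n : cont_bd (x0 - r) (x0 + r) (y0 - r) (y0 + r) (g n).
  move=> x y xy; have [_ h _] := bd _ _ xy; apply/derivable_ccont/(holM h).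
  apply: (@holV _ (fun w => u w ^+ n)); last by apply: holX; exact: hu.
  by rewrite expf_neq0 // u0.
have gle n x y : boundary (x0 - r) (x0 + r) (y0 - r) (y0 + r) x y -> cmod (g n (Complex x y)) <= M / r ^+ n.
  move=> /bd[h1 _ h2]; rewrite /g cmodM cmodV cmodX; apply: ler_pM => //.
  - exact: cmod_ge0.
  - by rewrite invr_ge0 exprn_ge0 // cmod_ge0.
  - rewrite lef_pV2 ?posrE ?exprn_gt0 //; last by apply: lt_le_trans h2.
    by apply: lerXn2r => //; rewrite nnegrE ?cmod_ge0 // ltW.
exists ((c0 R)^-1 * I (g 2%N)), ((c0 R)^-1 * I (g 3%N)); split.
- apply: le_trans (Ile _ _ (cgn 2%N) (gle 2%N)) _; rewrite le_eqVlt; apply/orP; left.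
  by apply/eqP; field; rewrite gt_eqF.
- apply: le_trans (Ile _ _ (cgn 3%N) (gle 3%N)) _; rewrite le_eqVlt; apply/orP; left.
  by apply/eqP; field; rewrite gt_eqF.
move=> h hr.
pose g4 w := g 3%N w * (u w - h)^-1.
have uh x y : boundary (x0 - r) (x0 + r) (y0 - r) (y0 + r) x y -> r / 2 <= cmod (u (Complex x y) - h).
  by move=> /bd[_ _ H]; apply: le_trans (cmod_distl _ _); rewrite /u; lra.
have uh0 x y : boundary (x0 - r) (x0 + r) (y0 - r) (y0 + r) x y -> u (Complex x y) - h != 0.
  by move=> /uh H; rewrite -cmod_gt0; apply: lt_le_trans H; lra.
have cg4 : cont_bd (x0 - r) (x0 + r) (y0 - r) (y0 + r) g4.
  apply: cont_bdM; first exact: cgn.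
  move=> x y xy; apply/derivable_ccont.
  apply: (@holV _ (fun w => u w - h)); first exact: uh0.
  by apply: holB; [exact: hu|exact: hol_cst].
have gle4 x y : boundary (x0 - r) (x0 + r) (y0 - r) (y0 + r) x y -> cmod (g4 (Complex x y)) <= M / r ^+ 3 * (r / 2)^-1.
  move=> xy; rewrite /g4 cmodM cmodV; apply: ler_pM.
  - exact: cmod_ge0.
  - by rewrite invr_ge0 cmod_ge0.
  - exact: gle.
  - rewrite lef_pV2 ?posrE ?uh //; first by rewrite cmod_gt0 uh0.
    by rewrite divr_gt0.
have E : I (fun w => f w / (w - (z + h))) =
   I (g 1%N) + (h * I (g 2%N) + (h ^+ 2 * I (g 3%N) + h ^+ 3 * I g4)).
  have ck (k : C) G : cont_bd (x0 - r) (x0 + r) (y0 - r) (y0 + r) G ->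
      cont_bd (x0 - r) (x0 + r) (y0 - r) (y0 + r) (fun w => k * G w).
    exact: cont_bdZ.
  have c34 := cont_bdD (ck (h ^+ 2) _ (cgn 3%N)) (ck (h ^+ 3) _ cg4).
  have c24 := cont_bdD (ck h _ (cgn 2%N)) c34.
  have E3 := rect_intD rx ry (ck (h ^+ 2) _ (cgn 3%N)) (ck (h ^+ 3) _ cg4).
  have E2 := rect_intD rx ry (ck h _ (cgn 2%N)) c34.
  have E1 := rect_intD rx ry (cgn 1%N) c24.
  have Z4 := rect_intZ (h ^+ 3) rx ry cg4.
  have Z3 := rect_intZ (h ^+ 2) rx ry (cgn 3%N).
  have Z2 := rect_intZ h rx ry (cgn 2%N).
  have -> : I (g 1%N) + (h * I (g 2%N) + (h ^+ 2 * I (g 3%N) + h ^+ 3 * I g4)) =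
      I (fun w => g 1%N w + (h * g 2%N w + (h ^+ 2 * g 3%N w + h ^+ 3 * g4 w))).
    apply/esym/(etrans E1); congr (_ + _); apply: (etrans E2).
    by congr (_ + _) => //; apply: (etrans E3); congr (_ + _).
  apply: (eq_rect_int rx ry) => x y xy; have := u0 _ _ xy; have := uh0 _ _ xy.
  rewrite /g4 /g (_ : Complex x y - (z + h) = u (Complex x y) - h); last by rewrite /u; ring.
  move: (f _) (u _) => F U Uh U0; by field; rewrite U0 Uh.
have hz : I (g 1%N) = c0 R * f z.
  have bx : x0 - r < x0 < x0 + r by clear -r0; lra.
  have b_y : y0 - r < y0 < y0 + r by clear -r0; lra.
  rewrite -(cauchy_formula bx b_y hf); exact: eq_rect_int.
have hzh : I (fun w => f w / (w - (z + h))) = c0 R * f (z + h).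
  have := Re_le_cmod h; have := Im_le_cmod h; rewrite !ler_norml.
  case: h hr {g4 uh uh0 cg4 gle4 E} => h1 h2 hr /= /andP[? ?] /andP[? ?].
  rewrite (_ : z + Complex h1 h2 = Complex (x0 + h1) (y0 + h2)) //.
  by apply: cauchy_formula => //; lra.
have {hz hzh}E : f (z + h) - f z - (c0 R)^-1 * I (g 2%N) * h - (c0 R)^-1 * I (g 3%N) * h ^+ 2 =
   h ^+ 3 * ((c0 R)^-1 * I g4).
  apply: (mulfI c00); rewrite !mulrBr -hzh -hz E; move: (I _) (I _) (I _) c00 => i2 i3 i4 c00.
  by field; exact: c00.
rewrite E cmodM cmodX mulrC.
have -> : 8 * M * cmod h ^+ 3 / r ^+ 3 = 4 * (M / r ^+ 3 * (r / 2)^-1) * r * cmod h ^+ 3.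
  by field; rewrite gt_eqF.
by apply: ler_wpM2r; [rewrite exprn_ge0 // cmod_ge0|apply: Ile].
Qed.

End Taylor.

(** * The complex exponential *)

Section Exponential.
Variable R : realType.
Local Notation C := (cplx R).
Implicit Types (x y r : R) (z w : C).

Lemma cexpD z w : cexp (z + w) = cexp z * cexp w.
Proof.
case: z w => [a b] [c d]; rewrite /cexp /= expRD cosD sinD.
by apply/eqP; rewrite eq_complex /=; apply/andP; split; apply/eqP; ring.
Qed.

Lemma cexp0 : cexp (0 : C) = 1.
Proof. by apply/eqP; rewrite eq_complex /= expR0 cos0 sin0 mulr0 mulr1 !eqxx. Qed.

Lemma cmod_cexp z : cmod (cexp z) = expR (complex.Re z).
Proof.
rewrite -[LHS]ger0_norm ?cmod_ge0 // -sqrtr_sqr cmod_sqr /= !exprMn -mulrDr cos2Dsin2 mulr1.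
by rewrite sqrtr_sqr ger0_norm // expR_ge0.
Qed.

Lemma cexp_neq0 z : cexp z != 0.
Proof. by rewrite -cmod_gt0 cmod_cexp expR_gt0. Qed.

Lemma is_derive_eps (f : R -> R) x d : is_derive x (1 : R) (f : R -> R^o) d ->
  forall e : R, 0 < e -> exists2 r : R, 0 < r &
    forall h, `|h| < r -> `|f (x + h) - f x - d * h| <= e * `|h|.
Proof.
move=> [H <-] e e0; have /cvgrPdist_lt /(_ e e0) := H.
case=> /= r r0 K; exists r => // h hr.
have [->|h0] := eqVneq h 0; first by rewrite addr0 mulr0 subr0 subrr normr0 mulr0.
have := K h; rewrite /ball_ /= sub0r normrN => /(_ hr h0).
rewrite [h *: 1]mulr1 (addrC h x) => /ltW Kh.
rewrite -ler_pdivrMr ?normr_gt0 // -normfV -normrM mulrBl mulfK //.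
rewrite distrC [_ / h]mulrC; exact: Kh.
Qed.

Lemma cexp_eps e : 0 < e -> exists2 r : R, 0 < r &
  forall h : C, cmod h < r -> cmod (cexp h - 1 - h) <= e * cmod h.
Proof.
move=> e0.
(* The real and imaginary remainders come out below [3 * k * n] and [5 * k * n], hence the
   eighth. *)
pose k := Num.min 1 (e / 8).
have k0 : 0 < k by rewrite lt_min ltr01 divr_gt0.
have k1 : k <= 1 by rewrite ge_min lexx.
have ke : 8 * k <= e by rewrite -ler_pdivlMl // mulrC ge_min lexx orbT.
clearbody k.
have [r1 r10 H1] := is_derive_eps (is_derive_expR 0) k0.
have [r2 r20 H2] := is_derive_eps (is_derive_cos 0) k0.
have [r3 r30 H3] := is_derive_eps (is_derive_sin 0) k0.
exists (Num.min (Num.min r1 r2) (Num.min r3 k)).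
  by rewrite !lt_min r10 r20 r30 k0.
move=> h; rewrite !lt_min -!andbA => /and4P[h1 h2 h3 h4].
have xh := Re_le_cmod h; have yh := Im_le_cmod h.
have n0 := cmod_ge0 h.
apply: le_trans (cmod_le_ReIm _) _.
case: h xh yh n0 h1 h2 h3 h4 => x y; set n := cmod _; rewrite /= => xh yh n0 h1 h2 h3 h4.
have := H1 x (le_lt_trans xh h1); have := H2 y (le_lt_trans yh h2).
have := H3 y (le_lt_trans yh h3).
rewrite !add0r expR0 cos0 sin0 oppr0 !mul1r mul0r !subr0 !addr0.
set s := sin y; set c := cos y; set E := expR x => Hs Hc HE.
have c1 : `|c| <= 1 by rewrite ler_norml cos_geN1 cos_le1.
have x0 : 0 <= `|x| by []. have y0 : 0 <= `|y| by [].
have P1 : `|E * c - 1 - x| <= 3 * k * n.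
  have -> : E * c - 1 - x = (E - 1 - x) * c + (1 + x) * (c - 1) by ring.
  apply: le_trans (ler_normD _ _) _; rewrite !normrM.
  have : `|1 + x| <= 2 by apply: le_trans (ler_normD _ _) _; rewrite normr1; lra.
  move: HE Hc c1; rewrite ?subr0; move: `|E - 1 - x| `|c - 1| `|c| `|1 + x| (normr_ge0 (E - 1 - x)) (normr_ge0 (c - 1)) (normr_ge0 c) (normr_ge0 (1 + x)).
  move: `|x| `|y| xh yh x0 y0 => X Y XN YN X0 Y0 a b c' d a0 b0 c0' d0 A B C' D.
  have t1 : a * c' <= k * n by apply: le_trans (_ : a * 1 <= _); [rewrite ler_wpM2l|rewrite mulr1; apply: le_trans A _; rewrite ler_wpM2l // ltW].
  have t2 : d * b <= 2 * (k * n).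
    by apply: ler_pM => //; apply: le_trans B _; rewrite ler_wpM2l // ltW.
  lra.
have P2 : `|E * s - y| <= 5 * k * n.
  have -> : E * s - y = (E - 1) * s + (s - y) by ring.
  apply: le_trans (ler_normD _ _) _; rewrite !normrM.
  have e1 : `|E - 1| <= 2 * k.
    have -> : E - 1 = (E - 1 - x) + x by ring.
    apply: le_trans (ler_normD _ _) _; apply: le_trans (lerD HE (lexx _)) _.
    have : k * `|x| <= 1 * `|x| by rewrite ler_wpM2r.
    lra.
  have e2 : `|s| <= 2 * n.
    have -> : s = (s - y) + y by ring.
    apply: le_trans (ler_normD _ _) _; apply: le_trans (lerD Hs (lexx _)) _.
    have : k * `|y| <= 1 * `|y| by rewrite ler_wpM2r.
    lra.
  have e3 : `|E - 1| * `|s| <= (2 * k) * (2 * n) by apply: ler_pM.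
  have e4 : `|s - y| <= k * n by apply: le_trans Hs _; rewrite ler_wpM2l // ltW.
  lra.
apply: le_trans (lerD P1 P2) _.
have : 8 * k * n <= e * n by rewrite ler_wpM2r.
lra.
Qed.

(** The addition formula transports the expansion at 0 to every point. *)
Lemma hol_cexp z : derivable (@cexp R) z (1 : C).
Proof.
apply/derivableE; exists (cexp z) => e e0.
have m0 : 0 < cmod (cexp z) by rewrite cmod_gt0 cexp_neq0.
have [r r0 H] := cexp_eps (divr_gt0 e0 m0).
exists r => // h hr; rewrite cexpD.
have -> : cexp z * cexp h - cexp z - cexp z * h = cexp z * (cexp h - 1 - h) by ring.
rewrite cmodM; apply: le_trans (ler_wpM2l (ltW m0) (H _ hr)) _.
by rewrite le_eqVlt; apply/orP; left; apply/eqP; field; rewrite gt_eqF.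
Qed.

End Exponential.

(** * Inequalities for t^p with exponent at most 1 *)

Section PowerFunction.
Variable R : realType.
Implicit Types (x y a b p : R).

Lemma powR_le a b p : 0 <= p -> 0 <= a -> a <= b -> a `^ p <= b `^ p.
Proof.
move=> p0 a0 ab; apply: ge0_ler_powR => //; rewrite nnegrE //.
exact: le_trans ab.
Qed.

(** For c = a or c = b, the ratio c/(a + b) lies in [0, 1] and is therefore at most its own p-th
    power; the two inequalities add up. *)
Lemma powR_subadd a b p : 0 < p -> p <= 1 -> 0 <= a -> 0 <= b ->
  (a + b) `^ p <= a `^ p + b `^ p.
Proof.
move=> p0 p1 a0 b0; have [/eqP|s0] := eqVneq (a + b) 0.
  rewrite paddr_eq0 // => /andP[/eqP -> /eqP ->].
  by rewrite addr0 powR0 ?gt_eqF // addr0.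
have sp : 0 < a + b by rewrite lt_def s0 addr_ge0.
have key c : 0 <= c -> c <= a + b -> (c / (a + b)) * (a + b) `^ p <= c `^ p.
  move=> c0 cs; have [->|c1] := eqVneq c 0.
    by rewrite !mul0r powR_ge0.
  have cp : 0 < c by rewrite lt_def c1.
  rewrite -[X in _ <= X `^ p](divfK s0) powRM ?divr_ge0 //; last exact: ltW.
    rewrite ler_wpM2r ?powR_ge0 //; apply: ger1_powR => //.
    by rewrite divr_gt0 //= ler_pdivrMr // mul1r.
  exact: ltW.
have := lerD (key a a0 _) (key b b0 _); rewrite lerDl lerDr b0 a0 => /(_ isT isT).
by rewrite -mulrDl -mulrDl divff // mul1r.
Qed.

Lemma powR_sum_subadd (I : Type) (r : seq I) (F : I -> R) p :
  0 < p -> p <= 1 -> (forall i, 0 <= F i) ->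
  (\sum_(i <- r) F i) `^ p <= \sum_(i <- r) F i `^ p.
Proof.
move=> p0 p1 F0; elim: r => [|i r IH]; first by rewrite !big_nil powR0 ?gt_eqF.
rewrite !big_cons; apply: le_trans (powR_subadd p0 p1 (F0 i) _) _.
  exact: sumr_ge0.
by rewrite lerD2l.
Qed.

(** Hölder continuity of t^p, which makes |g|^p continuous also at the zeros of g. *)
Lemma powR_dist a b p : 0 < p -> p <= 1 -> 0 <= a -> 0 <= b ->
  `|a `^ p - b `^ p| <= `|a - b| `^ p.
Proof.
move=> p0 p1; wlog ab : a b / a <= b.
  move=> H a0 b0; case: (leP a b) => [/H|/ltW /H]; first exact.
  by rewrite distrC [`|b - a|]distrC; apply.
move=> a0 b0; rewrite distrC ger0_norm; last by rewrite subr_ge0; exact: powR_le (ltW p0) a0 ab.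
rewrite distrC ger0_norm ?subr_ge0 // lerBlDr.
by apply: le_trans (powR_subadd p0 p1 _ a0); rewrite ?subrK // subr_ge0.
Qed.

Lemma powR_lt_eps p (e : R) : 0 < p -> 0 < e ->
  forall t, 0 <= t -> t < e `^ p^-1 -> t `^ p < e.
Proof.
move=> p0 e0 t t0 te; rewrite -[X in _ < X](powRr1 (ltW e0)).
rewrite -(mulVf (lt0r_neq0 p0)) powRrM.
by apply: gt0_ltr_powR => //; rewrite nnegrE // powR_ge0.
Qed.

End PowerFunction.

(** * Compact rectangles, uniform continuity, parameter integrals *)

Section Compactness.
Variable R : realType.
Local Notation C := (cplx R).
Implicit Types (a b c d : R) (v : C -> R).

Definition rect_set a b c d : set C :=
  [set z | a <= complex.Re z <= b /\ c <= complex.Im z <= d].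

Lemma compact_rect a b c d : compact (rect_set a b c d).
Proof.
have -> : rect_set a b c d = [set (Complex u.1 u.2 : C) | u in `[a, b] `*` `[c, d]].
  apply/seteqP; split => [[x y] /= [xab ycd]|_ [[x y] /= [xab ycd] <-]].
    by exists (x, y) => //=; split; rewrite /= in_itv.
  by move: xab ycd; rewrite /= !in_itv.
apply: continuous_compact; last by apply: compact_setX; exact: segment_compact.
apply: continuous_subspaceT => -[x y] A /nbhs_cmodP [e e0 H] /=.
exists (ball x (e / 2), ball y (e / 2)) => /=.
  by split; apply: nbhsx_ballx; rewrite divr_gt0.
move=> [x' y'] /= [xx yy]; apply: H.
apply: le_lt_trans (cmod_le_ReIm _) _ => /=.
by rewrite [e]splitr; apply: ltrD; rewrite distrC.
Qed.

(** Since continuity is meant in full neighbourhoods, the second point may leave [K]. This lets [K]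
    be a single horizontal segment when the height of a line is varied in [rint_param_cont]. *)
Lemma unif_cont (K : set C) v : compact K -> (forall z, K z -> {for z, continuous v}) ->
  forall e : R, 0 < e -> exists2 r : R, 0 < r &
    forall z w, K z -> cmod (w - z) < r -> `|v w - v z| < e.
Proof.
move=> /compact_near_coveringP cK cv e e0.
have H : \forall r \near 0^'+, K `<=` (fun z => forall w, cmod (w - z) < r -> `|v w - v z| < e).
  apply: cK => z /cv /crcontP /(_ _ (divr_gt0 e0 (ltr0n R 2))) [r r0 hr].
  exists ([set w | cmod (w - z) < r / 2], [set s | s < r / 2]) => /=.
    split; first by apply/nbhs_cmodP; exists (r / 2) => //; rewrite divr_gt0.
    by apply: nbhs_right_lt; rewrite divr_gt0.
  move=> [z' s] /= [zz sr] w wz.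
  rewrite -(subrK (v z) (v w)) -addrA; apply: le_lt_trans (ler_normD _ _) _.
  rewrite [e]splitr; apply: ltrD.
    apply: hr; rewrite -(subrK z' w) -addrA; apply: le_lt_trans (cmodD _ _) _.
    by rewrite [r]splitr; apply: ltrD => //; apply: lt_trans sr.
  by rewrite distrC; apply: hr; apply: lt_trans zz _; rewrite ltr_pdivrMr // ltr_pMr // ltr1n.
have [r [Hr r0]] : exists r : R, K `<=` (fun z => forall w, cmod (w - z) < r -> `|v w - v z| < e) /\ 0 < r.
  near (0 : R)^'+ => r; exists r; split; first by near: r.
  by near: r; exact: nbhs_right_gt.
by exists r => // z w Kz; apply: Hr.
Unshelve. all: by end_near. Qed.

Lemma max_rect a b c d v : a <= b -> c <= d ->
  (forall z, rect_set a b c d z -> {for z, continuous v}) ->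
  exists2 z, rect_set a b c d z & forall w, rect_set a b c d w -> v w <= v z.
Proof.
move=> ab cd cv.
have [||z zK zmax] := @compact_EVT_max _ R v _ _ (@compact_rect a b c d).
- by exists (Complex a c); rewrite /rect_set /= ab cd !lexx.
- by apply: continuous_in_subspaceT => z; rewrite inE; apply: cv.
exists z; first by rewrite inE in zK.
by move=> w Kw; apply: zmax; rewrite inE.
Qed.

Lemma rint_param_cont a b c d v : a <= b ->
  (forall x y, a <= x <= b -> c < y < d -> {for (Complex x y : C), continuous v}) ->
  forall y, c < y < d -> {for y, continuous (fun y => rint a b (fun x => v (Complex x y)))}.
Proof.
move=> ab cv y /andP[cy yd]; apply/(@cvgrPdist_lt _ R^o) => e e0.
have e1 : 0 < e / (b - a + 1) by rewrite divr_gt0 //; lra.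
have cvy z : rect_set a b y y z -> {for z, continuous v}.
  case: z => x y' /= [xab /andP[y1 y2]]; apply: cv => //.
  by have -> : y' = y; [apply/le_anti/andP|rewrite cy].
have [r r0 H] := unif_cont (@compact_rect a b y y) cvy e1.
have hc t : c < t < d -> cont_on a b (fun x => v (Complex x t)).
  move=> tcd x xab; have /crcontP K := cv x t xab tcd; apply/(@cvgrPdist_lt _ R^o) => e' /K [s s0 L].
  apply/nbhs_ballP; exists s => //= x'; rewrite /ball /= distrC => xx.
  rewrite distrC; apply: L; apply: le_lt_trans (cmod_le_ReIm _) _ => /=.
  by rewrite subrr normr0 addr0.
apply/nbhs_ballP; exists (Num.min r (Num.min (y - c) (d - y))) => /=.
  by rewrite !lt_min r0 !subr_gt0 cy yd.
move=> t; rewrite /ball /= !lt_min => /and3P[yt ycd ydt].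
have tcd : c < t < d.
  by move: ycd ydt; rewrite !ltr_norml => /andP[? ?] /andP[? ?]; apply/andP; split; lra.
have ycd' : c < y < d by rewrite cy.
rewrite -[X in `|_ + X|]mulN1r -rintZ; last exact: hc.
have hcN : cont_on a b (fun x => -1 * v (Complex x t)).
  by apply: cont_onM; [exact: cont_on_cst|exact: hc].
rewrite -rintD //; last exact: hc.
have hcD := cont_onD (hc y ycd') hcN.
apply: le_lt_trans (rint_abs hcD) _.
apply: (@le_lt_trans _ _ (e / (b - a + 1) * (b - a))).
  rewrite -rint_cst //; apply: rint_le; [exact: rint_cont_norm|exact: cont_on_cst|].
  move=> x xab; rewrite mulN1r distrC; apply/ltW/H.
    by rewrite /rect_set /= xab lexx.
  apply: le_lt_trans (cmod_le_ReIm _) _ => /=.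
  by rewrite subrr normr0 add0r distrC.
rewrite mulrAC ltr_pdivrMr; last by lra.
by rewrite ltr_pM2l //; lra.
Qed.

End Compactness.

(** * A sub-mean-value inequality for |g|^p over a square *)

Section SubMean.
Variable R : realType.
Local Notation C := (cplx R).
Implicit Types (a b c d x y p : R) (g : C -> C).

Lemma cont_powR_cmod g p z : 0 < p -> p <= 1 -> {for z, continuous g} ->
  {for z, continuous (fun w : C => cmod (g w) `^ p)}.
Proof.
move=> p0 p1 /ccontP H; apply/crcontP => e e0.
have [|r r0 K] := H (e `^ p^-1); first exact: powR_gt0.
exists r => // w /K wz.
apply: le_lt_trans (powR_dist p0 p1 (cmod_ge0 _) (cmod_ge0 _)) _.
apply: powR_lt_eps => //; apply: le_lt_trans wz; exact: cmod_dist.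
Qed.

Lemma cont_horizR a b y (v : C -> R) :
  (forall x, a <= x <= b -> {for (Complex x y : C), continuous v}) ->
  cont_on a b (fun t => v (Complex t y)).
Proof.
move=> H x xab; have /crcontP K := H x xab.
apply/(@cvgrPdist_lt _ R^o) => e /K [s s0 L].
apply/nbhs_ballP; exists s => //= x'; rewrite /ball /= distrC => xx.
rewrite distrC; apply: L; apply: le_lt_trans (cmod_le_ReIm _) _ => /=.
by rewrite subrr normr0 addr0.
Qed.

(** The minimum over a segment is at most the mean value. *)
Lemma low_height a b (J : R -> R) A : a < b -> cont_on a b J ->
  rint a b J <= A -> exists2 y, a <= y <= b & J y <= A / (b - a).
Proof.
move=> ab cJ HA.
have [y yab ymin] := EVT_min (ltW ab) (cont_on_within cJ).
exists y; first by rewrite in_itv in yab.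
rewrite ler_pdivlMr ?subr_gt0 //; apply: le_trans HA.
rewrite -(rint_cst (J y) (ltW ab)); apply: rint_le => //; first exact: cont_on_cst.
Qed.

Lemma rint_sub_le a b c d (J : R -> R) : a <= c -> c <= d -> d <= b ->
  cont_on a b J -> (forall x, a <= x <= b -> 0 <= J x) ->
  rint c d J <= rint a b J.
Proof.
move=> ac cd db cJ J0.
rewrite (@rint_split _ a c b) ?(@rint_split _ c d b) ?(le_trans cd) //; last first.
  exact: cont_on_sub cJ.
apply: ler_wpDl; last apply: ler_wpDr => //; apply: rint_ge0 => x hx; apply: J0.
  by clear -hx cd db; lra.
by clear -hx cd ac; lra.
Qed.

(* Cauchy's formula on a flat rectangle, with the factor [1 - (w / a)^2] making
   the contribution of the short vertical sides small. *)
Lemma flat_cauchy g x1 y1 a b l u (M : R) : 0 < b -> 2 * b <= a ->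
  y1 + b <= u <= y1 + 2 * b -> y1 - 2 * b <= l <= y1 - b ->
  hol_rect (x1 - a) (x1 + a) (y1 - 2 * b) (y1 + 2 * b) g ->
  (forall x y, in_rect (x1 - a) (x1 + a) (y1 - 2 * b) (y1 + 2 * b) x y ->
     cmod (g (Complex x y)) <= M) ->
  4 * cmod (g (Complex x1 y1)) <=
    6 / b * (rint (x1 - a) (x1 + a) (fun x => cmod (g (Complex x l)))
           + rint (x1 - a) (x1 + a) (fun x => cmod (g (Complex x u))))
    + 96 * (b / a) ^+ 2 * M.
Proof.
move=> b0 ba /andP[u1 u2] /andP[l1 l2] hg gM.
have a0 : 0 < a by lra.
have xx : x1 - a <= x1 + a by lra.
have lu : l <= u by lra.
set z1 : C := Complex x1 y1.
pose q (w : C) : C := 1 - ((w - z1) / a%:C) ^+ 2.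
pose phi w : C := g w * q w * (w - z1)^-1.
have M0 : 0 <= M.
  apply: le_trans (cmod_ge0 (g z1)) (gM _ _ _).
  by apply/andP; split; apply/andP; split; lra.
have ac0 : (a%:C : C) != 0 by rewrite -cmod_gt0 cmod_real normr_gt0 gt_eqF.
have hz w : derivable (fun w : C => w - z1) w (1 : C).
  by apply: holB; [exact: hol_id|exact: hol_cst].
have hq w : derivable q w (1 : C).
  apply: holB; first exact: hol_cst.
  by apply: (@holX _ (fun w => (w - z1) / a%:C)); apply: holM; [exact: hz|exact: hol_cst].
have hg' : hol_rect (x1 - a) (x1 + a) l u g.
  by apply: hol_rect_sub hg; rewrite ?lexx //; lra.
have gM' x y : in_rect (x1 - a) (x1 + a) l u x y -> cmod (g (Complex x y)) <= M.
  move=> /andP[? /andP[? ?]]; apply: gM; apply/andP; split => //.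
  by apply/andP; split; lra.
have hphi x y : in_rect (x1 - a) (x1 + a) l u x y -> (Complex x y : C) != z1 ->
    derivable phi (Complex x y : C) (1 : C).
  move=> xy xz; apply: holM; first by apply: holM; [exact: hg'|exact: hq].
  apply: (@holV _ (fun w => w - z1)); last exact: hz.
  by rewrite subr_eq0.
have bdz x y : boundary (x1 - a) (x1 + a) l u x y -> (Complex x y : C) != z1.
  move=> [_ _ h]; rewrite Complex_neq; apply/orP.
  by case: h => ->; [left|left|right|right]; apply/eqP; lra.
have cphi : cont_bd (x1 - a) (x1 + a) l u phi.
  move=> x y xy; apply/derivable_ccont/hphi; last exact: bdz.
  by case: xy => h1 h2 _; rewrite /in_rect h1 h2.
have E : rect_int (x1 - a) (x1 + a) l u phi = c0 R * g z1.
  have hx1 : x1 - a < x1 < x1 + a by clear -a0; lra.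
  have hy1 : l < y1 < u by clear -b0 u1 l2; lra.
  apply: (residue hx1 hy1 hphi).
  move=> e e0.
  have /derivable_ccont/ccontP : derivable (fun w : C => g w * q w) z1 (1 : C).
    apply: holM; last exact: hq.
    by apply: hg'; apply/andP; split; apply/andP; split; lra.
  move=> /(_ _ e0) [r r0 H]; exists r => // w w0 wr.
  rewrite -/z1 /phi addrK mulrC mulfVK //.
  have := H (w + z1); rewrite addrK => /(_ wr).
  have -> : q z1 = 1 by rewrite /q subrr mul0r expr0n subr0.
  by rewrite mulr1 => /ltW.
have sz x y : x1 - a <= x <= x1 + a -> y1 - 2 * b <= y <= y1 + 2 * b ->
    cmod (Complex x y - z1) ^+ 2 <= 2 * a ^+ 2.
  move=> /andP[h1 h2] /andP[h3 h4]; rewrite cmod_sqr /=.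
  by clear -h1 h2 h3 h4 b0 ba; nra.
have hor y : (y = l) \/ (y = u) ->
  cmod (cint (x1 - a) (x1 + a) (fun t => phi (Complex t y))) <=
    6 / b * rint (x1 - a) (x1 + a) (fun x => cmod (g (Complex x y))).
  move=> yy.
  have by1 : b <= `|y - y1|.
    by case: yy => ->; rewrite ler_normr; apply/orP; [right|left]; lra.
  have ylu : l <= y <= u by case: yy => ->; rewrite lexx ?andbT.
  have yb : y1 - 2 * b <= y <= y1 + 2 * b by case: yy => ->; apply/andP; split; lra.
  have cg : cont_on (x1 - a) (x1 + a) (fun t => g (Complex t y)).
    apply: cont_horiz => x xab; apply/derivable_ccont/hg'.
    by rewrite /in_rect xab.
  have cp : cont_on (x1 - a) (x1 + a) (fun t => phi (Complex t y)).
    apply: cont_horiz => x xab; apply: cphi; split => //.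
    by case: yy => ->; [apply: Or43|apply: Or44].
  apply: le_trans (cint_le_rint cp) _.
  have -> : 6 / b = 2 * (3 / b) by field; rewrite gt_eqF.
  rewrite -mulrA ler_pM2l // -rintZ; last exact: cont_on_cmod.
  apply: rint_le; [exact: cont_on_cmod| |].
    by apply: cont_onM; [exact: cont_on_cst|exact: cont_on_cmod].
  move=> x xab; rewrite /phi !cmodM cmodV.
  have h1 : cmod (q (Complex x y)) <= 3.
    apply: le_trans (cmodB _ _) _; rewrite cmod1 cmodX cmodM cmodV cmod_real gtr0_norm //.
    rewrite exprMn exprVn.
    have : cmod (Complex x y - z1) ^+ 2 / a ^+ 2 <= 2.
      by rewrite ler_pdivrMr ?exprn_gt0 // sz.
    by clear; lra.
  have h2 : (cmod (Complex x y - z1))^-1 <= b^-1.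
    have hb : b <= cmod (Complex x y - z1).
      by apply: le_trans by1 _; exact: (Im_le_cmod (Complex x y - z1)).
    by rewrite lef_pV2 // posrE // (lt_le_trans b0).
  rewrite -mulrA mulrC; apply: ler_wpM2r; first exact: cmod_ge0.
  apply: ler_pM h1 h2; first exact: cmod_ge0.
  by rewrite invr_ge0 cmod_ge0.
have ver x : (x = x1 - a) \/ (x = x1 + a) ->
  cmod (cint l u (fun t => phi (Complex x t))) <= 48 * (b / a) ^+ 2 * M.
  move=> hx.
  have xr : x1 - a <= x <= x1 + a by case: hx => ->; rewrite lexx ?andbT.
  have cp : cont_on l u (fun t => phi (Complex x t)).
    apply: cont_vert => y yab; apply: cphi; split => //.
    by case: hx => ->; [apply: Or41|apply: Or42].
  have ac : cmod (a%:C : C) = a by rewrite cmod_real gtr0_norm.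
  have bound y : l <= y <= u -> cmod (phi (Complex x y)) <= M * (6 * b / a) * a^-1.
    move=> /andP[y1' y2']; rewrite /phi !cmodM cmodV.
    set w := Complex x y - z1.
    have wa : a <= cmod w.
      apply: le_trans (Re_le_cmod _); rewrite /w /=.
      by case: hx => ->; rewrite ler_normr; apply/orP; [right|left]; lra.
    (* On a vertical side one of the factors a - w, a + w is purely imaginary of modulus at most
       [2 * b], and the other is at most [3 * a]. *)
    have hqw : cmod (q (Complex x y)) <= 6 * b / a.
      have -> : q (Complex x y) = (a%:C - w) * (a%:C + w) / (a%:C * a%:C).
        by rewrite /q -/w; field.
      rewrite !cmodM cmodV cmodM ac ler_pdivrMr ?mulr_gt0 //.
      have -> : 6 * b / a * (a * a) = (2 * b) * (3 * a) by field; rewrite gt_eqF.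
      have tb : `|y - y1| <= 2 * b by rewrite ler_norml; apply/andP; split; lra.
      have big (e : R) : `|e| <= 2 * a -> cmod (Complex e (y - y1)) <= 3 * a.
        by move=> he; apply: le_trans (cmod_le_ReIm _) _ => /=; clear -he tb ba; lra.
      have small : cmod (Complex 0 (y - y1)) <= 2 * b.
        by apply: le_trans (cmod_le_ReIm _) _; rewrite /= normr0 add0r.
      have big' (e : R) : `|e| <= 2 * a -> cmod (Complex e (- (y - y1))) <= 3 * a.
        move=> he; apply: le_trans (cmod_le_ReIm _) _ => /=; rewrite normrN.
        by clear -he tb ba; lra.
      have small' : cmod (Complex 0 (- (y - y1))) <= 2 * b.
        by apply: le_trans (cmod_le_ReIm _) _; rewrite /= normr0 add0r normrN.
      have n2 : `|2 * a| <= 2 * a by rewrite gtr0_norm // mulr_gt0.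
      case: hx => hx.
      - have -> : a%:C - w = Complex (2 * a) (- (y - y1)).
          by apply/eqP; rewrite eq_complex /= hx; apply/andP; split; apply/eqP; ring.
        have -> : a%:C + w = Complex 0 (y - y1).
          by apply/eqP; rewrite eq_complex /= hx; apply/andP; split; apply/eqP; ring.
        rewrite mulrC; apply: ler_pM; [exact: cmod_ge0|exact: cmod_ge0|exact: small|exact: big'].
      - have -> : a%:C - w = Complex 0 (- (y - y1)).
          by apply/eqP; rewrite eq_complex /= hx; apply/andP; split; apply/eqP; ring.
        have -> : a%:C + w = Complex (2 * a) (y - y1).
          by apply/eqP; rewrite eq_complex /= hx; apply/andP; split; apply/eqP; ring.
        apply: ler_pM; [exact: cmod_ge0|exact: cmod_ge0|exact: small'|exact: big].
    apply: ler_pM.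
    - by rewrite mulr_ge0 // cmod_ge0.
    - by rewrite invr_ge0 cmod_ge0.
    - apply: ler_pM; [exact: cmod_ge0|exact: cmod_ge0| |exact: hqw].
      by apply: gM'; rewrite /in_rect xr y1' y2'.
    - by rewrite lef_pV2 // posrE // (lt_le_trans a0).
  apply: le_trans (cint_le lu cp bound) _.
  (* The factor 2 of [cint_le], then [6 * b / a] from [q], [1 / a] from the pole, and a side of
     length at most [4 * b]. *)
  have -> : 48 * (b / a) ^+ 2 * M = 2 * (M * (6 * b / a) / a * (4 * b)).
    by field; rewrite gt_eqF.
  rewrite ler_pM2l //; apply: ler_wpM2l; last by clear -u2 l1; lra.
  apply: divr_ge0; last exact: ltW.
  by apply: mulr_ge0 => //; apply: divr_ge0; clear -b0 a0; lra.
have := ler_wpM2r (cmod_ge0 (g z1)) (c0_ge R).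
rewrite -cmodM -E; move=> H; apply: le_trans H _.
apply: le_trans (cmodD _ _) _; rewrite cmodM cmod_i mul1r.
have hl := hor l (or_introl erefl); have hu := hor u (or_intror erefl).
have v1 := ver _ (or_introl erefl); have v2 := ver _ (or_intror erefl).
apply: le_trans (lerD (cmodB _ _) (cmodB _ _)) _.
apply: le_trans (lerD (lerD hl hu) (lerD v2 v1)) _.
rewrite mulrDr lerD2l -mulrDl -mulrDl; apply: ler_wpM2r => //; apply: ler_wpM2r.
  exact: sqr_ge0.
by clear; lra.
Qed.

(** Let d be the sup-norm distance to the boundary of the square, and take a point z where |g|^p d^2
    is maximal. Near z, |g| is at most S |g(z)|, so |g| = |g|^{1-p} |g|^p converts the L^1 integrals
    of Cauchy's formula into L^p ones, at the price of a power of |g(z)| that is divided out at the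
    end. The horizontal sides run at heights where the L^p integral is at most its mean. *)
Theorem submean p : 0 < p -> p < 1 -> exists2 K : R, 0 < K &
  forall g, hol_rect (-2) 2 (-2) 2 g ->
    cmod (g 0) `^ p <= K * rint (-1) 1 (fun y =>
      rint (-1) 1 (fun x => cmod (g (Complex x y)) `^ p)).
Proof.
move=> p0 p1.
(* Where the distance [d] is at least half its value at the maximum point, |g|^p exceeds its value
   there by at most a factor 4, hence |g| by at most [S]. *)
pose S : R := 4 `^ p^-1.
have S1 : 1 <= S.
  have -> : 1 = 1 `^ p^-1 :> R by rewrite powR1.
  apply: powR_le => //; first by rewrite invr_ge0 ltW.
  by rewrite ler1n.
have S0 : 0 < S by apply: lt_le_trans S1.
exists (4 * (20 * S) ^+ 2 * S).
  by apply: mulr_gt0 => //; apply: mulr_gt0 => //; apply: exprn_gt0; apply: mulr_gt0.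
move=> g hg.
pose v (w : C) := cmod (g w) `^ p.
have cg x y : -2 <= x <= 2 -> -2 <= y <= 2 -> {for (Complex x y : C), continuous g}.
  by move=> hx hy; apply/derivable_ccont/hg; rewrite /in_rect hx hy.
have cv x y : -2 <= x <= 2 -> -2 <= y <= 2 -> {for (Complex x y : C), continuous v}.
  by move=> hx hy; apply: cont_powR_cmod => //; [exact: ltW|exact: cg].
pose J y := rint (-1) 1 (fun x => v (Complex x y)).
set A := rint (-1) 1 _.
have J0 y : 0 <= J y by apply: rint_ge0 => x _; exact: powR_ge0.
have A0 : 0 <= A by apply: rint_ge0 => y _; exact: J0.
have cJ : cont_on (-1) 1 J.
  move=> y y1.
  have m11 : (-1 : R) <= 1 by clear; lra.
  apply: (@rint_param_cont R (-1) 1 (-2) 2 v m11).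
    by move=> x t x1 t1; apply: cv; clear -x1 t1; lra.
  by clear -y1; lra.
pose d (w : C) : R := 1 - Num.max `|complex.Re w| `|complex.Im w|.
have dlip w w' (e : R) : `|complex.Re w - complex.Re w'| <= e ->
    `|complex.Im w - complex.Im w'| <= e -> d w' - e <= d w.
  move=> h1 h2; rewrite /d.
  have h3 := lerB_dist (complex.Re w) (complex.Re w').
  have h4 := lerB_dist (complex.Im w) (complex.Im w').
  have : Num.max `|complex.Re w| `|complex.Im w| <=
    Num.max `|complex.Re w'| `|complex.Im w'| + e.
    rewrite ge_max; apply/andP; split.
      apply: (@le_trans _ _ (`|complex.Re w'| + e)); first by clear -h1 h3; lra.
      by rewrite lerD2r le_max lexx.
    apply: (@le_trans _ _ (`|complex.Im w'| + e)); first by clear -h2 h4; lra.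
    by rewrite lerD2r le_max lexx orbT.
  by clear; lra.
have cd (w : C) : {for w, continuous d}.
  apply/crcontP => e e0; exists e => // w' ww.
  have r1 := Re_le_cmod (w' - w); have i1 := Im_le_cmod (w' - w).
  rewrite ReD ReN in r1; rewrite ImD ImN in i1.
  have H1 := dlip _ _ _ r1 i1; rewrite distrC in r1; rewrite distrC in i1.
  have H2 := dlip _ _ _ r1 i1.
  by rewrite ltr_norml; apply/andP; clear -H1 H2 ww; split; lra.
(* The square matches the final estimate, which has the form of an area mean: |g(z)|^p is at most a
   constant times [A / d1 ^+ 2]. *)
pose F w := v w * d w ^+ 2.
have [| | |z zQ zmax] := @max_rect R (-1) 1 (-1) 1 F.
- by clear; lra.
- by clear; lra.
- case=> x y; rewrite /rect_set /= => -[hx hy].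
  apply: continuousM; first by apply: cv; clear -hx hy; lra.
  by apply: (@continuousM _ _ d d); exact: cd.
have F0 : cmod (g 0) `^ p <= F z.
  apply: le_trans (zmax 0 _); last by rewrite /rect_set /=; clear; lra.
  by rewrite /F /v /d /= normr0 maxxx subr0 expr1n mulr1.
apply: le_trans F0 _.
have K0 : 0 <= 4 * (20 * S) ^+ 2 * S * A.
  apply: mulr_ge0 => //; apply: mulr_ge0; last exact: ltW.
  by apply: mulr_ge0 => //; apply: sqr_ge0.
have [Fz0|Fz0] := leP (F z) 0; first exact: le_trans K0.
case: z zQ zmax Fz0 => x1 y1; rewrite {1}/rect_set /= => -[hx1 hy1] zmax.
set z : C := Complex x1 y1 in zmax *.
set G := cmod (g z); set d1 := d z; rewrite /F -/d1 /v -/G => Fz0.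
have d10 : 0 < d1.
  have d1g : 0 <= d1.
    rewrite /d1 /d subr_ge0 ge_max !ler_norml /=.
    by clear -hx1 hy1; apply/andP.
  rewrite lt_def d1g andbT; apply: contraTneq Fz0 => ->.
  by rewrite expr0n mulr0 ltxx.
have G0 : 0 < G.
  rewrite lt_def cmod_ge0 andbT; apply: contraTneq Fz0 => ->.
  by rewrite powR0 ?gt_eqF // mul0r ltxx.
(* With [b / a = 1 / (10 * S)] the vertical sides contribute at most [96 / 100 * G / S <= G] in
   [flat_cauchy], which the left side [4 * G] absorbs. *)
pose a := d1 / 2; pose b := d1 / (20 * S).
have a0 : 0 < a by rewrite divr_gt0.
have b0 : 0 < b by rewrite divr_gt0 // mulr_gt0.
have bS : 10 * S * b = a by rewrite /a /b; field; rewrite gt_eqF.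
have ba : 2 * b <= a.
  by rewrite -bS; apply: ler_wpM2r; [exact: ltW|clear -S1; lra].
have hd w : `|complex.Re w - x1| <= a -> `|complex.Im w - y1| <= a -> d1 / 2 <= d w.
  by move=> h1 h2; apply: le_trans (dlip _ z _ h1 h2); rewrite -/d1 /a; lra.
have dQ (w : C) : 0 < d w -> [/\ -1 <= complex.Re w <= 1 & -1 <= complex.Im w <= 1].
  by rewrite /d subr_gt0 gt_max !ltr_norml => /andP[/andP[? ?] /andP[? ?]];
    split; apply/andP; split; apply: ltW.
have d20 : 0 < d1 / 2 by rewrite divr_gt0.
have gS x y : in_rect (x1 - a) (x1 + a) (y1 - 2 * b) (y1 + 2 * b) x y ->
    [/\ -1 <= x <= 1, -1 <= y <= 1 & cmod (g (Complex x y)) <= S * G].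
  move=> /andP[h1 h2].
  have hd2 : d1 / 2 <= d (Complex x y).
    by apply: hd => /=; rewrite ler_norml; clear -h1 h2 ba; lra.
  have dp := lt_le_trans d20 hd2.
  have [q1 q2] := dQ _ dp; split => //.
  have := zmax (Complex x y) (conj q1 q2); rewrite /F -/d1 => H.
  have H4 : v (Complex x y) <= 4 * v z.
    rewrite -(@ler_pM2r _ (d1 ^+ 2 / 4)); last by rewrite divr_gt0 // exprn_gt0.
    have -> : 4 * v z * (d1 ^+ 2 / 4) = v z * d1 ^+ 2 by field.
    apply: le_trans H; apply: ler_wpM2l; first exact: powR_ge0.
    have -> : d1 ^+ 2 / 4 = (d1 / 2) ^+ 2 by field.
    by apply: lerXn2r => //; rewrite nnegrE ltW.
  have pi0 : 0 <= p^-1 by rewrite invr_ge0 ltW.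
  have := powR_le pi0 (powR_ge0 _ _) H4.
  rewrite powRM ?powR_ge0 // /v -!powRrM mulfV ?gt_eqF // !powRr1 //; exact: cmod_ge0.
have hg' : hol_rect (x1 - a) (x1 + a) (y1 - 2 * b) (y1 + 2 * b) g.
  move=> x y /gS[q1 q2 _]; apply: hg; apply/andP; clear -q1 q2; lra.
have inx t : y1 - 2 * b <= t <= y1 + 2 * b ->
    in_rect (x1 - a) (x1 + a) (y1 - 2 * b) (y1 + 2 * b) x1 t.
  by move=> ht; rewrite /in_rect ht andbT; clear -a0; lra.
have iny t : x1 - a <= t <= x1 + a ->
    in_rect (x1 - a) (x1 + a) (y1 - 2 * b) (y1 + 2 * b) t y1.
  by move=> ht; rewrite /in_rect ht /=; clear -b0; lra.
have y_top : y1 + 2 * b <= 1.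
  have [|_ /andP[_ //] _] := gS x1 (y1 + 2 * b); apply: inx.
  by clear -b0; lra.
have y_bot : -1 <= y1 - 2 * b.
  have [|_ /andP[// _] _] := gS x1 (y1 - 2 * b); apply: inx.
  by clear -b0; lra.
have x_right : x1 + a <= 1.
  have [|/andP[_ //] _ _] := gS (x1 + a) y1; apply: iny.
  by clear -a0; lra.
have x_left : -1 <= x1 - a.
  have [|/andP[// _] _ _] := gS (x1 - a) y1; apply: iny.
  by clear -a0; lra.
have [u u12 Ju] : exists2 u, y1 + b <= u <= y1 + 2 * b & J u <= A / b.
  have e : y1 + 2 * b - (y1 + b) = b by ring.
  rewrite -[X in A / X]e; apply: low_height.
  - by clear -b0; lra.
  - by apply: cont_on_sub cJ; clear -b0 y_top y_bot; lra.
  - by apply: rint_sub_le => //; clear -b0 y_top y_bot; lra.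
have [l l12 Jl] : exists2 l, y1 - 2 * b <= l <= y1 - b & J l <= A / b.
  have e : y1 - b - (y1 - 2 * b) = b by ring.
  rewrite -[X in A / X]e; apply: low_height.
  - by clear -b0; lra.
  - by apply: cont_on_sub cJ; clear -b0 y_top y_bot; lra.
  - by apply: rint_sub_le => //; clear -b0 y_top y_bot; lra.
have gM x y : in_rect (x1 - a) (x1 + a) (y1 - 2 * b) (y1 + 2 * b) x y ->
    cmod (g (Complex x y)) <= S * G by move=> /gS[].
have := flat_cauchy b0 ba u12 l12 hg' gM; rewrite -/z -/G.
have SG : 0 < S * G by rewrite mulr_gt0.
(* Here |g| is split as |g|^{1-p} |g|^p and the first factor is bounded by its supremum on the small
   rectangle. *)
have line t : y1 - 2 * b <= t <= y1 + 2 * b -> J t <= A / b ->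
    rint (x1 - a) (x1 + a) (fun x => cmod (g (Complex x t))) <=
    (S * G) `^ (1 - p) * (A / b).
  move=> ht Jt.
  have t2 : -2 <= t <= 2 by clear -ht y_top y_bot b0; lra.
  have cgt : cont_on (x1 - a) (x1 + a) (fun x => cmod (g (Complex x t))).
    apply: (@cont_on_cmod _ _ _ (fun x => g (Complex x t))).
    apply: cont_horiz => x hx; apply: cg => //; clear -hx x_left x_right; lra.
  have cvt : cont_on (-1) 1 (fun x => v (Complex x t)).
    by apply: cont_horizR => x hx; apply: cv => //; clear -hx; lra.
  have cvt' : cont_on (x1 - a) (x1 + a) (fun x => v (Complex x t)).
    exact: cont_on_sub cvt.
  apply: (@le_trans _ _ ((S * G) `^ (1 - p) * J t)); last first.
    by apply: ler_wpM2l => //; exact: powR_ge0.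
  apply: (@le_trans _ _ ((S * G) `^ (1 - p) * rint (x1 - a) (x1 + a) (fun x => v (Complex x t)))); last first.
    apply: ler_wpM2l; first exact: powR_ge0.
    apply: rint_sub_le => //; first by clear -a0; lra.
    by move=> x _; exact: powR_ge0.
  rewrite -rintZ //; apply: rint_le => //.
    by apply: cont_onM => //; exact: cont_on_cst.
  move=> x hx; have gx := gM x t; rewrite /in_rect hx ht in gx; have {}gx := gx isT.
  rewrite -[X in X <= _](powRr1 (cmod_ge0 _)) -{1}(subrK p 1) powRD ?subrK ?oner_eq0 //.
  apply: ler_wpM2r; first exact: powR_ge0.
  by apply: powR_le => //; [rewrite subr_ge0 ltW|exact: cmod_ge0].
have Ll := line l _ Jl; have Lu := line u _ Ju.
have {}Ll := Ll ltac:(clear -l12 b0; lra); have {}Lu := Lu ltac:(clear -u12 b0; lra).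
set P := (S * G) `^ (1 - p) * (A / b) in Ll Lu.
move: (rint _ _ _) (rint _ _ _) Ll Lu => I1 I2 Ll Lu H.
have b6 : 0 <= 6 / b by rewrite divr_ge0 // ltW.
have H1 : 96 * (b / a) ^+ 2 * (S * G) <= G.
  rewrite -bS (_ : b / (10 * S * b) = (10 * S)^-1); last first.
    by field; rewrite !gt_eqF.
  have -> : 96 * (10 * S)^-1 ^+ 2 * (S * G) = (96 / 100) * G / S.
    by field; rewrite gt_eqF.
  rewrite ler_pdivrMr //; apply: (@le_trans _ _ G); first by clear -G0; lra.
  by rewrite ler_peMr // ltW.
have H2 : 4 * G <= 6 / b * (P + P) + G.
  by apply: le_trans H _; apply: lerD => //; apply: ler_wpM2l => //; exact: lerD.
have {H H1 H2}H3 : G <= 4 / b * P by clear -H2; lra.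
have SG1 : (S * G) `^ (1 - p) <= S * G `^ (1 - p).
  rewrite (powRM _ (ltW S0) (ltW G0)); apply: ler_wpM2r; first exact: powR_ge0.
  rewrite -[X in _ <= X](powRr1 (ltW S0)); apply: ler_powR => //.
  by clear -p0; lra.
have Gp : 0 < G `^ (1 - p) by exact: powR_gt0.
(* The positive factor G^{1-p} cancels, leaving G^p below a multiple of [A / b ^+ 2]; since [b] is
   proportional to [d1], this bounds the maximum [F z]. *)
have : G `^ (1 - p) * G `^ p <= G `^ (1 - p) * (4 * S * A / b ^+ 2).
  rewrite -powRD; last by rewrite subrK oner_eq0.
  rewrite subrK (powRr1 (ltW G0)); apply: le_trans H3 _.
  have -> : G `^ (1 - p) * (4 * S * A / b ^+ 2) = 4 / b * (S * G `^ (1 - p) * (A / b)).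
    by field; rewrite gt_eqF.
  apply: ler_wpM2l; first by rewrite divr_ge0 // ltW.
  by apply: ler_wpM2r SG1; rewrite divr_ge0 // ltW.
rewrite ler_pM2l // => H4.
have -> : 4 * (20 * S) ^+ 2 * S * A = 4 * S * A / b ^+ 2 * d1 ^+ 2.
  by rewrite /b; field; rewrite !gt_eqF.
by apply: ler_wpM2r H4; exact: sqr_ge0.
Qed.

End SubMean.

(** * A four-point mean inequality for |f|^p *)

Section FourPoints.
Variable R : realType.
Local Notation C := (cplx R).
Implicit Types (f : C -> C) (z w h : C) (p : R).

Local Notation I := (Complex 0 1 : C).

Lemma cmod2 : cmod (2 : C) = 2.
Proof. by rewrite -(rmorph_nat (real_complex R) 2) cmod_real normr_nat. Qed.

Lemma cube_le (t : R) : 0 <= t -> t <= 1 -> t ^+ 3 <= t.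
Proof. by move=> t0 t1; rewrite exprS ler_piMr // exprn_ile1. Qed.

(* The terms of order 1, 2 and 3 cancel in the product of the values of [f] at
   the four points [z + i^j t]. *)
Lemma four_product f z (r M : R) : 0 < r -> f z != 0 ->
  (forall w, cmod (w - z) <= 2 * r -> derivable f w (1 : C) /\ cmod (f w) <= M) ->
  exists2 K : R, 0 <= K & exists2 s : R, 0 < s & forall t : R, 0 < t < s ->
    cmod (f z) ^+ 4 * (1 - K * t ^+ 3) <=
    cmod (f (z + t%:C)) * cmod (f (z - t%:C)) *
    (cmod (f (z + I * t%:C)) * cmod (f (z - I * t%:C))).
Proof.
move=> r0 fz Hf; have [A1 [A2 [_ _ T]]] := taylor2 r0 Hf.
set f0 := f z in fz T *.
have M0 : 0 <= M.
  by apply: le_trans (cmod_ge0 (f z)) (Hf z _).2; rewrite subrr cmod0; lra.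
have n0 : 0 < cmod f0 by rewrite cmod_gt0.
pose al := A1 / f0; pose be := A2 / f0.
pose K0 := 8 * M / r ^+ 3 / cmod f0.
have K00 : 0 <= K0.
  by rewrite /K0 divr_ge0 // ?divr_ge0 ?mulr_ge0 ?exprn_ge0 // ltW.
pose Er h := f (z + h) / f0 - (1 + al * h + be * h ^+ 2).
have TE h : cmod h <= r / 2 -> cmod (Er h) <= K0 * cmod h ^+ 3.
  move=> hr; have -> : Er h = (f (z + h) - f0 - A1 * h - A2 * h ^+ 2) / f0.
    by rewrite /Er /al /be; field.
  rewrite cmodM cmodV ler_pdivrMr // /K0.
  have -> : 8 * M / r ^+ 3 / cmod f0 * cmod h ^+ 3 * cmod f0 = 8 * M * cmod h ^+ 3 / r ^+ 3.
    by field; rewrite !gt_eqF.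
  exact: T.
pose a := cmod al; pose b := cmod be.
have a0 : 0 <= a by exact: cmod_ge0.
have b0 : 0 <= b by exact: cmod_ge0.
pose Q := b ^+ 2 * 2 + b ^+ 4 + (2 * b + a ^+ 2) ^+ 2.
have Q0 : 0 <= Q.
  apply: addr_ge0; last exact: sqr_ge0.
  by apply: addr_ge0; [apply: mulr_ge0 => //; exact: sqr_ge0|exact: exprn_ge0].
exists (Q + 108 * K0).
  by apply: addr_ge0 => //; apply: mulr_ge0 => //; exact: ler0n.
exists (Num.min (Num.min 1 (r / 2)) (Num.min ((a + b + 1)^-1) ((K0 + 1)^-1))).
  by rewrite !lt_min ltr01 divr_gt0 //= !invr_gt0; apply/andP; split; lra.
move=> t /andP[t0]; rewrite !lt_min => /andP[/andP[t1 tr] /andP[tab tK]].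
have tp : 0 <= t by exact: ltW.
pose P h := 1 + al * h + be * h ^+ 2.
have I2 : I * I = -1.
  by apply/eqP; rewrite eq_complex /= !mul0r !mulr0 mulr1 sub0r addr0 oppr0 !eqxx.
have ct : cmod (t%:C : C) = t by rewrite cmod_real ger0_norm.
have fE h : f (z + h) = f0 * (P h + Er h) by rewrite /P /Er; field.
have hP h : cmod h = t -> cmod (P h) <= 2.
  move=> ch; apply: le_trans (cmodD _ _) _; apply: le_trans (lerD (cmodD _ _) (lexx _)) _.
  rewrite (cmodM al) (cmodM be) cmodX cmod1 ch -/a -/b.
  have tt : t ^+ 2 <= t by rewrite expr2 ler_piMl // ltW.
  have : (a + b + 1) * t <= 1 by rewrite mulrC -ler_pdivlMr ?mul1r ?ltW //; lra.
  have : b * t ^+ 2 <= b * t by rewrite ler_wpM2l.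
  by clear -t0; lra.
have t3 : 0 <= t ^+ 3 by rewrite exprn_ge0.
have hE h : cmod h = t -> cmod (Er h) <= K0 * t ^+ 3 /\ cmod (Er h) <= 1.
  move=> ch; have e1 : cmod (Er h) <= K0 * t ^+ 3 by rewrite -[in X in _ <= X]ch; apply: TE; rewrite ch ltW.
  split => //; apply: le_trans e1 _.
  have tt : t ^+ 3 <= t by apply: cube_le => //; exact: ltW.
  have : (K0 + 1) * t <= 1 by rewrite mulrC -ler_pdivlMr ?mul1r ?ltW //; lra.
  have : K0 * t ^+ 3 <= K0 * t by rewrite ler_wpM2l.
  by clear -t0; lra.
set h1 : C := t%:C; set h3 : C := I * t%:C.
have c1 : cmod h1 = t by [].
have c2 : cmod (- h1) = t by rewrite cmodN.
have c3 : cmod h3 = t by rewrite cmodM cmod_i mul1r.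
have c4 : cmod (- h3) = t by rewrite cmodN.
(* P(h) P(-h) = 1 + (2 be - al^2) h^2 + be^2 h^4, and replacing h by ih flips the sign of the middle
   term; in the product of the two nothing below h^4 survives. *)
have prodP : P h1 * P (- h1) * (P h3 * P (- h3)) =
    1 + (be ^+ 2 * 2 + be ^+ 4 * h1 ^+ 4 - (2 * be - al ^+ 2) ^+ 2) * h1 ^+ 4.
  have I4 : I * I * (I * I) = 1 by rewrite I2 mulrNN mulr1.
  have -> : P h3 * P (- h3) = 1 + (2 * be - al ^+ 2) * (I * I) * h1 ^+ 2 + be ^+ 2 * (I * I * (I * I)) * h1 ^+ 4.
    by rewrite /P /h3 -/h1; ring.
  by rewrite I4 I2 /P; ring.
have p4 : cmod (P h1 * P (- h1) * (P h3 * P (- h3)) - 1) <= Q * t ^+ 3.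
  rewrite prodP addrAC subrr add0r cmodM cmodX c1.
  apply: ler_pM; [exact: cmod_ge0|by rewrite exprn_ge0| |]; last first.
    by rewrite exprS ler_piMl // ltW.
  apply: le_trans (cmodB _ _) _; apply: lerD; last first.
    rewrite cmodX; apply: lerXn2r; rewrite ?nnegrE ?cmod_ge0 ?addr_ge0 ?mulr_ge0 ?sqr_ge0 //.
    apply: le_trans (cmodB _ _) _; rewrite cmodM cmodX -/a -/b lerD2r ler_wpM2r //.
    by rewrite cmod2.
  apply: le_trans (cmodD _ _) _; apply: lerD.
    rewrite cmodM cmodX -/b ler_wpM2l ?sqr_ge0 //.
    by rewrite cmod2.
  rewrite cmodM !cmodX -/b c1 ler_piMr ?exprn_ge0 //.
  by rewrite exprn_ile1 // ltW.
have step (x y e d : C) (kx k : R) : cmod x <= kx -> cmod y <= 2 -> cmod e <= k -> cmod d <= K0 * t ^+ 3 ->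
    cmod d <= 1 -> cmod ((x + e) * (y + d) - x * y) <= 3 * k + kx * (K0 * t ^+ 3).
  move=> hx hy he hd hd1.
  have -> : (x + e) * (y + d) - x * y = e * (y + d) + x * d by ring.
  apply: le_trans (cmodD _ _) _; rewrite !cmodM [3 * k]mulrC; apply: lerD.
    apply: ler_pM => //; try exact: cmod_ge0.
    by apply: le_trans (cmodD _ _) _; lra.
  by apply: ler_pM => //; exact: cmod_ge0.
have [e1 e1'] := hE _ c1; have [e2 e2'] := hE _ c2.
have [e3 e3'] := hE _ c3; have [e4 e4'] := hE _ c4.
pose X1 := P h1 + Er h1; pose X2 := P (- h1) + Er (- h1).
pose X3 := P h3 + Er h3; pose X4 := P (- h3) + Er (- h3).
have s1 := step _ _ _ _ _ _ (hP _ c1) (hP _ c2) e1 e2 e2'.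
have s2 := step _ _ _ _ _ _ (hP _ c3) (hP _ c4) e3 e4 e4'.
pose k := K0 * t ^+ 3.
have k0 : 0 <= k by rewrite mulr_ge0.
rewrite -/k -/X1 -/X2 -/X3 -/X4 in s1 s2.
have P34 : cmod (P h3 * P (- h3)) <= 4.
  rewrite cmodM; apply: le_trans (ler_pM (cmod_ge0 _) (cmod_ge0 _) (hP _ c3) (hP _ c4)) _.
  by clear; lra.
have X12 : cmod (X1 * X2) <= 9.
  have b1 : cmod X1 <= 3 by apply: le_trans (cmodD _ _) _; have := hP _ c1; clear -e1'; lra.
  have b2 : cmod X2 <= 3 by apply: le_trans (cmodD _ _) _; have := hP _ c2; clear -e2'; lra.
  rewrite cmodM; apply: le_trans (ler_pM (cmod_ge0 _) (cmod_ge0 _) b1 b2) _.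
  by clear; lra.
(* Each pair of factors is off by at most [5 * k], so the two replacements cost [9 * 5 * k] and
   [5 * k * 4]; 108 leaves room. *)
have tot : cmod (X1 * X2 * (X3 * X4) - 1) <= (Q + 108 * K0) * t ^+ 3.
  have -> : X1 * X2 * (X3 * X4) - 1 = X1 * X2 * (X3 * X4 - P h3 * P (- h3)) +
     (X1 * X2 - P h1 * P (- h1)) * (P h3 * P (- h3)) + (P h1 * P (- h1) * (P h3 * P (- h3)) - 1).
    by ring.
  apply: le_trans (cmodD _ _) _; apply: le_trans (lerD (cmodD _ _) p4) _.
  rewrite !cmodM -(cmodM X1) -(cmodM (P h3)).
  have u1 := ler_pM (cmod_ge0 _) (cmod_ge0 _) X12 s2.
  have u2 := ler_pM (cmod_ge0 _) (cmod_ge0 _) s1 P34.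
  have kE : K0 * t ^+ 3 = k by [].
  have -> : (Q + 108 * K0) * t ^+ 3 = Q * t ^+ 3 + 108 * k by rewrite /k; ring.
  by clear -u1 u2 k0; lra.
rewrite !fE !cmodM -/X1 -/X2 -/X3 -/X4.
have -> : cmod f0 * cmod X1 * (cmod f0 * cmod X2) * (cmod f0 * cmod X3 * (cmod f0 * cmod X4)) =
   cmod f0 ^+ 4 * cmod (X1 * X2 * (X3 * X4)) by rewrite !cmodM; ring.
apply: ler_wpM2l; first by rewrite exprn_ge0 // ltW.
have := cmod_distl 1 (1 - X1 * X2 * (X3 * X4)).
rewrite subKr cmod1 cmodBC; lra.
Qed.

Lemma agm4 (a b c d : R) : 0 <= a -> 0 <= b -> 0 <= c -> 0 <= d ->
  a * b * (c * d) <= ((a + b + c + d) / 4) ^+ 4.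
Proof.
move=> a0 b0 c0 d0.
have agm2 (x y : R) : x * y <= ((x + y) / 2) ^+ 2.
  have -> : ((x + y) / 2) ^+ 2 = x * y + ((x - y) / 2) ^+ 2 by field.
  by rewrite lerDl sqr_ge0.
have h1 := agm2 a b; have h2 := agm2 c d.
have h3 := ler_pM (mulr_ge0 a0 b0) (mulr_ge0 c0 d0) h1 h2.
apply: le_trans h3 _; rewrite -exprMn.
have h4 := agm2 ((a + b) / 2) ((c + d) / 2).
have -> : (a + b + c + d) / 4 = ((a + b) / 2 + (c + d) / 2) / 2 by field.
rewrite (exprM _ 2 2); apply: lerXn2r => //; rewrite nnegrE ?sqr_ge0 //.
by rewrite mulr_ge0 // divr_ge0 // addr_ge0.
Qed.

(** At a zero of [f] the left side is nonpositive for [K = 0]. Elsewhere [four_product] is raised to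
    the power p, and the arithmetic mean of the four values dominates their geometric mean. *)
Lemma four_point f z p : 0 < p -> p <= 1 ->
  (exists2 r : R, 0 < r & forall w, cmod (w - z) < r -> derivable f w (1 : C)) ->
  exists2 K : R, 0 <= K & exists2 s : R, 0 < s & forall t : R, 0 < t < s ->
    4 * (cmod (f z) `^ p - K * t ^+ 3) <=
    cmod (f (z + t%:C)) `^ p + cmod (f (z - t%:C)) `^ p +
    cmod (f (z + I * t%:C)) `^ p + cmod (f (z - I * t%:C)) `^ p.
Proof.
move=> p0 p1 [r r0 hf].
have [f0|f0] := eqVneq (f z) 0.
  exists 0 => //; exists 1 => // t t1.
  by rewrite f0 cmod0 powR0 ?gt_eqF // mul0r subr0 mulr0 !addr_ge0 ?powR_ge0.
have hz : derivable f z (1 : C) by apply: hf; rewrite subrr cmod0.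
have /ccontP/(_ 1 ltr01) [d d0 hd] := derivable_ccont hz.
pose r1 := Num.min r d / 3.
have r10 : 0 < r1 by rewrite divr_gt0 // lt_min r0.
have [|K K0 [s s0 H]] := @four_product f z r1 (cmod (f z) + 1) r10 f0.
  move=> w wz.
  have : cmod (w - z) < Num.min r d.
    by apply: le_lt_trans wz _; rewrite /r1; have : 0 < Num.min r d by [rewrite lt_min r0]; lra.
  rewrite lt_min => /andP[/hf h1 /hd h2]; split => //.
  by have := cmod_distl (f w) (f z); lra.
set v := cmod (f z) `^ p.
have v0 : 0 <= v by exact: powR_ge0.
exists (K * v); first exact: mulr_ge0.
exists (Num.min s ((K + 1)^-1)); first by rewrite lt_min s0 invr_gt0; lra.
move=> t /andP[t0]; rewrite lt_min => /andP[ts tK].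
have K1 : 0 < K + 1 by lra.
have t1 : t <= 1.
  by apply: le_trans (ltW tK) _; rewrite invf_le1 //; lra.
have tt : t ^+ 3 <= t by apply: cube_le => //; exact: ltW.
have t3 : 0 <= t ^+ 3 by rewrite exprn_ge0 // ltW.
have q1 : K * t ^+ 3 < 1.
  apply: (@le_lt_trans _ _ (K * t)); first exact: ler_wpM2l.
  have : (K + 1) * t < 1 by rewrite mulrC -ltr_pdivlMr ?mul1r.
  by clear -t0; lra.
have {H} := H t; rewrite t0 ts => /(_ isT).
set a1 := cmod (f (z + _)); set a2 := cmod (f (z - _)).
set a3 := cmod (f (z + _)); set a4 := cmod (f (z - _)) => H.
have [g1 g2 g3 g4] : [/\ 0 <= a1, 0 <= a2, 0 <= a3 & 0 <= a4].
  by split; exact: cmod_ge0.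
set u := 1 - K * t ^+ 3 in H.
have u0 : 0 < u by rewrite subr_gt0.
have u1 : u <= 1 by rewrite /u gerBl mulr_ge0.
have -> : 4 * (v - K * v * t ^+ 3) = 4 * (v * u) by rewrite /u; ring.
rewrite mulrC -ler_pdivlMr //.
set m := _ / 4.
have m0 : 0 <= m by rewrite divr_ge0 // !addr_ge0 // powR_ge0.
have vu0 : 0 <= v * u by apply: mulr_ge0 => //; exact: ltW.
rewrite -(@ler_pXn2r _ 4) // ?nnegrE //.
apply: le_trans (agm4 (powR_ge0 a1 p) (powR_ge0 a2 p) (powR_ge0 a3 p) (powR_ge0 a4 p)).
rewrite -!powRM ?mulr_ge0 //.
have c0 := cmod_ge0 (f z).
have h0 : 0 <= cmod (f z) ^+ 4 * u by rewrite mulr_ge0 ?exprn_ge0 // ltW.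
apply: le_trans (powR_le (ltW p0) h0 H).
rewrite powRM ?exprn_ge0 //; last exact: ltW.
have -> : (cmod (f z) ^+ 4) `^ p = v ^+ 4.
  by rewrite -(powR_mulrn 4 c0) -(powR_mulrn 4 v0) -!powRrM mulrC.
rewrite exprMn; apply: ler_wpM2l; first exact: exprn_ge0.
(* As u lies in (0, 1] and p <= 1, u^4 <= u <= u^p. *)
apply: (@le_trans _ _ u); last by apply: ger1_powR => //; rewrite u0.
by rewrite exprS ler_piMr ?exprn_ile1 // ltW.
Qed.

End FourPoints.

(** * Maximum principle for sums and integrals of |F|^p *)

Section MaximumPrinciple.
Variable R : realType.
Local Notation C := (cplx R).
Implicit Types (f : C -> C) (z w h : C) (p : R) (K : set C).

Definition interior_pt K w := exists2 r : R, 0 < r & forall w', cmod (w' - w) < r -> K w'.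

Lemma compact_cmod_bounded K : compact K -> exists M : R, forall w, K w -> cmod w <= M.
Proof.
move=> cK; have [[w0 Kw0]|K0] := pselect (K !=set0); last first.
  by exists 0 => w Kw; exfalso; apply: K0; exists w.
have [||w _ H] := @compact_EVT_max _ R (@cmod R) K _ cK.
- by exists w0.
- apply: continuous_subspaceT => z; apply/crcontP => e e0; exists e => // w.
  by apply: le_lt_trans; exact: cmod_dist.
by exists (cmod w) => w' Kw'; apply: H; rewrite inE.
Qed.

Lemma sum_four_points (I : Type) (r : seq I) (F : I -> C -> C) z p :
  0 < p -> p <= 1 -> (forall i w, derivable (F i) w (1 : C)) ->
  exists2 K : R, 0 <= K & exists2 s : R, 0 < s & forall t : R, 0 < t < s ->
    4 * (\sum_(i <- r) cmod (F i z) `^ p - K * t ^+ 3) <=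
    \sum_(i <- r) cmod (F i (z + t%:C)) `^ p +
    \sum_(i <- r) cmod (F i (z - t%:C)) `^ p +
    \sum_(i <- r) cmod (F i (z + Complex 0 1 * t%:C)) `^ p +
    \sum_(i <- r) cmod (F i (z - Complex 0 1 * t%:C)) `^ p.
Proof.
move=> p0 p1 hF; elim: r => [|i r [K K0 [s s0 IH]]].
  exists 0 => //; exists 1 => // t _.
  by rewrite !big_nil mul0r subr0 mulr0 !addr0.
have [|K' K'0 [s' s'0 H]] := @four_point R (F i) z p p0 p1.
  by exists 1 => // w _; exact: hF.
exists (K + K'); first exact: addr_ge0.
exists (Num.min s s'); first by rewrite lt_min s0.
move=> t /andP[t0]; rewrite lt_min => /andP[ts ts'].
have {IH} := IH t; rewrite t0 ts => /(_ isT).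
have {H} := H t; rewrite t0 ts' => /(_ isT).
rewrite !big_cons; move: (\sum_(j <- r) _) (\sum_(j <- r) _) (\sum_(j <- r) _)
  (\sum_(j <- r) _) (\sum_(j <- r) _) => A0 A1 A2 A3 A4.
move: (_ `^ p) (_ `^ p) (_ `^ p) (_ `^ p) (_ `^ p) => B0 B1 B2 B3 B4; lra.
Qed.

Lemma cont_sum_powR (I : Type) (r : seq I) (F : I -> C -> C) p z :
  0 < p -> p <= 1 -> (forall i w, derivable (F i) w (1 : C)) ->
  {for z, continuous (fun w : C => \sum_(i <- r) cmod (F i w) `^ p)}.
Proof.
move=> p0 p1 hF; elim: r => [|i r IH].
  have -> : (fun w : C => \sum_(i <- [::]) cmod (F i w) `^ p) = fun _ => 0.
    by apply/funext => w; rewrite big_nil.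
  exact: cst_continuous.
have -> : (fun w : C => \sum_(i <- i :: r) cmod (F i w) `^ p) =
    fun w => cmod (F i w) `^ p + \sum_(i <- r) cmod (F i w) `^ p.
  by apply/funext => w; rewrite big_cons.
apply: continuousD; last exact: IH.
by apply: cont_powR_cmod => //; exact: derivable_ccont.
Qed.

(** Perturb the sum by ep |w|^2 and take a maximum point. If it were interior, the mean over four
    points at distance t would gain ep t^2 from the quadratic term and lose at most k t^3, which is
    impossible for small t. So the maximum is at a non-interior point, and ep is small on the
    bounded set [K]. *)
Lemma max_principle_sum (I : Type) (r : seq I) (F : I -> C -> C) K p (B : R) :
  0 < p -> p <= 1 -> (forall i w, derivable (F i) w (1 : C)) -> compact K ->
  (forall w, K w -> ~ interior_pt K w -> \sum_(i <- r) cmod (F i w) `^ p <= B) ->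
  forall w, K w -> \sum_(i <- r) cmod (F i w) `^ p <= B.
Proof.
move=> p0 p1 hF cK hB w Kw.
pose psi w := \sum_(i <- r) cmod (F i w) `^ p.
have [M hM] := compact_cmod_bounded cK.
have cpsi z : {for z, continuous psi} by exact: cont_sum_powR.
apply/ler_addgt0Pr => e e0.
pose ep := e / (M ^+ 2 + 1).
have M1 : 0 < M ^+ 2 + 1 by rewrite ltr_wpDl ?sqr_ge0.
have ep0 : 0 < ep by rewrite divr_gt0.
pose Phi w := psi w + ep * cmod w ^+ 2.
have cPhi : {within K, continuous Phi}.
  apply: continuous_subspaceT => z; apply: continuousD; first exact: cpsi.
  apply: continuousM; first exact: cst_continuous.
  have cc : {for z, continuous (@cmod R)}.
    apply/crcontP => d d0; exists d => // w' wz.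
    by apply: le_lt_trans wz; exact: cmod_dist.
  exact: (continuousM cc cc).
have [|w0 Kw0 wmax] := compact_EVT_max _ cK cPhi; first by exists w.
rewrite inE in Kw0.
have Phi_le : psi w <= Phi w0.
  apply: le_trans (wmax w _); last by rewrite inE.
  by rewrite /Phi lerDl mulr_ge0 ?sqr_ge0 // ltW.
have small : ep * cmod w0 ^+ 2 <= e.
  rewrite /ep mulrAC ler_pdivrMr // ler_pM2l //.
  have : cmod w0 ^+ 2 <= M ^+ 2 by apply: lerXn2r (hM _ Kw0); rewrite nnegrE ?cmod_ge0 // (le_trans (cmod_ge0 w0) (hM _ Kw0)).
  by clear; lra.
have [[r0 r00 Hr]|/(hB _ Kw0) h] := pselect (interior_pt K w0).
  exfalso; have [k k0 [s s0 H]] := sum_four_points r w0 p0 p1 hF.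
  (* The last entry makes k t^3 < ep t^2. *)
  pose t := Num.min (Num.min r0 s) (ep / (k + 1)) / 2.
  have k1 : 0 < k + 1 by lra.
  have m0 : 0 < Num.min (Num.min r0 s) (ep / (k + 1)).
    by rewrite !lt_min r00 s0 divr_gt0.
  have t0 : 0 < t by rewrite divr_gt0.
  have : t < Num.min (Num.min r0 s) (ep / (k + 1)).
    by rewrite /t; clear -m0; lra.
  rewrite !lt_min => /andP[/andP[tr ts] tk].
  have {H} := H t; rewrite t0 ts => /(_ isT) H.
  have near h : cmod h = t -> Phi (w0 + h) <= Phi w0.
    move=> ht; apply: wmax; rewrite inE; apply: Hr.
    by rewrite addrC addKr ht.
  have ct : cmod (t%:C : C) = t by rewrite cmod_real gtr0_norm.
  have q1 := near t%:C ct.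
  have q2 := near (- t%:C); rewrite cmodN ct in q2; have {}q2 := q2 erefl.
  have cit : cmod (Complex 0 1 * t%:C : C) = t by rewrite cmodM cmod_i mul1r.
  have q3 := near _ cit.
  have q4 := near (- (Complex 0 1 * t%:C)); rewrite cmodN cit in q4; have {}q4 := q4 erefl.
  have par : cmod (w0 + t%:C) ^+ 2 + cmod (w0 - t%:C) ^+ 2 +
     cmod (w0 + Complex 0 1 * t%:C) ^+ 2 + cmod (w0 - Complex 0 1 * t%:C) ^+ 2 =
     4 * cmod w0 ^+ 2 + 4 * t ^+ 2.
    rewrite !cmod_sqr; case: (w0) => x y /=; ring.
  rewrite /Phi in q1 q2 q3 q4.
  have := lerD (lerD q1 q2) (lerD q3 q4).
  have e1 : ep * cmod (w0 + t%:C) ^+ 2 + ep * cmod (w0 - t%:C) ^+ 2 +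
     ep * cmod (w0 + Complex 0 1 * t%:C) ^+ 2 + ep * cmod (w0 - Complex 0 1 * t%:C) ^+ 2 =
     4 * (ep * cmod w0 ^+ 2) + 4 * (ep * t ^+ 2) by rewrite -!mulrDr par; ring.
  rewrite -/(psi w0) -/(psi (w0 + t%:C)) -/(psi (w0 - t%:C)) -/(psi (w0 + Complex 0 1 * t%:C)) -/(psi (w0 - Complex 0 1 * t%:C)) in H.
  move=> H2; have : ep * t ^+ 2 <= k * t ^+ 3.
    move: H H2 e1; move: (psi _) (psi _) (psi _) (psi _) (psi _); clear => *; lra.
  have -> : k * t ^+ 3 = k * t * t ^+ 2 by ring.
  rewrite ler_pM2r ?exprn_gt0 // leNgt => /negP; apply.
  apply: (@le_lt_trans _ _ ((k + 1) * t)); first by rewrite (ler_pM2r t0) lerDl.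
  by rewrite mulrC -ltr_pdivlMr.
apply: le_trans Phi_le _; rewrite /Phi; exact: lerD.
Qed.

Lemma riemann_sum (f : R -> R) (a h e : R) n : 0 <= h ->
  cont_on a (a + n%:R * h) f ->
  (forall k t, (k < n)%N -> a + k%:R * h <= t <= a + k.+1%:R * h ->
     `|f t - f (a + k%:R * h)| <= e) ->
  `|rint a (a + n%:R * h) f - \sum_(k < n) h * f (a + k%:R * h)| <= n%:R * (h * e).
Proof.
move=> h0; elim: n => [_ _|n IH cf H].
  by rewrite big_ord0 mul0r addr0 subr0 /rint set_itv1 Rintegral_set1 normr0 mul0r.
have nh : 0 <= n%:R * h by rewrite mulr_ge0.
have le1 : a <= a + n%:R * h by rewrite lerDl.
have le2 : a + n%:R * h <= a + n.+1%:R * h by rewrite lerD2l ler_wpM2r // ler_nat.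
have hd : a + n.+1%:R * h - (a + n%:R * h) = h by rewrite -natr1; ring.
rewrite (rint_split le1 le2 cf) big_ord_recr /=.
set I1 := rint _ _ _; set I2 := rint _ _ _; set S := \sum_(k < n) _.
have -> : I1 + I2 - (S + h * f (a + n%:R * h)) = (I1 - S) + (I2 - h * f (a + n%:R * h)) by ring.
have -> : n.+1%:R * (h * e) = n%:R * (h * e) + h * e by rewrite -natr1; ring.
apply: le_trans (ler_normD _ _) _; apply: lerD.
  apply: IH => [|k t kn]; first by apply: cont_on_sub cf.
  by apply: H; exact: ltnW.
have c2 : cont_on (a + n%:R * h) (a + n.+1%:R * h) f by apply: cont_on_sub cf.
have cN : cont_on (a + n%:R * h) (a + n.+1%:R * h) (fun _ : R => - f (a + n%:R * h)).
  exact: cont_on_cst.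
have -> : I2 - h * f (a + n%:R * h) = rint (a + n%:R * h) (a + n.+1%:R * h)
    (fun t => f t + - f (a + n%:R * h)).
  by rewrite rintD // rint_cst // hd mulNr mulrC.
have cD := cont_onD c2 cN.
apply: le_trans (rint_abs cD) _.
rewrite -[X in X * e]hd [_ * e]mulrC -rint_cst //.
apply: rint_le; [exact: rint_cont_norm|exact: cont_on_cst|].
by move=> t ht; exact: H.
Qed.

(** A bounded window keeps the integral finite and approximable by Riemann sums; [L] becomes
    infinite only in [plancherel_polya]. *)
Definition window_int p (L : R) (m : C -> C) z : R :=
  rint (- L) L (fun t => cmod (m (z + t%:C)) `^ p).

Lemma cont_window (m : C -> C) p z (a b : R) : 0 < p -> p <= 1 ->
  (forall w, derivable m w (1 : C)) ->
  cont_on a b (fun t => cmod (m (z + t%:C)) `^ p).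
Proof.
move=> p0 p1 hm t _.
have /crcontP K : {for (z + t%:C : C), continuous (fun w : C => cmod (m w) `^ p)}.
  by apply: cont_powR_cmod => //; exact: derivable_ccont.
apply/(@cvgrPdist_lt _ R^o) => e /K [s s0 H].
apply/nbhs_ballP; exists s => //= t'; rewrite /ball /= distrC => tt.
rewrite distrC; apply: H; rewrite opprD addrACA subrr add0r.
by rewrite -(rmorphB (real_complex R)) cmod_real.
Qed.

(** Uniform continuity on the rectangle widened by [L] on both sides provides one mesh for all
    centres [z]. *)
Lemma riemann_window (m : C -> C) p (L a b c d : R) : 0 < p -> p <= 1 -> 0 < L ->
  (forall w, derivable m w (1 : C)) ->
  forall e : R, 0 < e -> exists n, (0 < n)%N /\ forall z, rect_set a b c d z ->
    `|window_int p L m z - \sum_(k < n) (2 * L / n%:R) *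
       cmod (m (z + (- L + k%:R * (2 * L / n%:R))%:C)) `^ p| <= e.
Proof.
move=> p0 p1 L0 hm e e0.
pose v (w : C) := cmod (m w) `^ p.
have L2 : 0 < 2 * L by rewrite mulr_gt0.
have cv w : rect_set (a - L) (b + L) c d w -> {for w, continuous v}.
  by move=> _; apply: cont_powR_cmod => //; exact: derivable_ccont.
have [r r0 H] := unif_cont (@compact_rect R (a - L) (b + L) c d) cv (divr_gt0 e0 L2).
pose n := (Num.bound (2 * L / r)).+1.
have n0 : 0 < (n%:R : R) by rewrite ltr0n.
have hr : 2 * L / n%:R < r.
  have : 2 * L / r < n%:R.
    apply: (@lt_le_trans _ _ (Num.bound (2 * L / r))%:R); last by rewrite ler_nat.
    by apply: archi_boundP; rewrite divr_ge0 // ltW.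
  by rewrite ltr_pdivrMr // [n%:R * _]mulrC -ltr_pdivrMr.
exists n; split => // z [zx zy].
have h0 : 0 <= 2 * L / n%:R by rewrite divr_ge0 // ltW.
have nh : n%:R * (2 * L / n%:R) = 2 * L by rewrite mulrC divfK // gt_eqF.
have E : - L + n%:R * (2 * L / n%:R) = L by rewrite nh; ring.
have := @riemann_sum (fun t => v (z + t%:C)) (- L) (2 * L / n%:R) (e / (2 * L)) n h0.
rewrite E => K; apply: le_trans (K _ _) _.
- exact: cont_window.
- move=> k t kn /andP[t1 t2].
  have kh : 0 <= k%:R * (2 * L / n%:R) by rewrite mulr_ge0.
  have khL : - L + k%:R * (2 * L / n%:R) <= L.
    by rewrite -[X in _ <= X]E lerD2l ler_wpM2r // ler_nat ltnW.
  apply/ltW/H.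
    rewrite /rect_set /= !ReD !ImD /= addr0; split => //; move: zx => /andP[z1 z2].
    by apply/andP; split; lra.
  rewrite opprD addrACA subrr add0r -(rmorphB (real_complex R)) cmod_real.
  apply: le_lt_trans hr; rewrite ger0_norm; last by lra.
  by move: t2; rewrite -natr1 mulrDl mul1r; lra.
- by rewrite mulrA nh mulrC divfK // gt_eqF.
Qed.

(** Obtained from finite sums through uniform Riemann sums. [phi] allows a change of variable and
    [E] an auxiliary Phragmen-Lindelof factor. *)
Lemma max_principle_int (m phi E : C -> C) K p (L B : R) :
  0 < p -> p <= 1 -> 0 < L ->
  (forall w, derivable m w (1 : C)) -> (forall w, derivable phi w (1 : C)) ->
  (forall w, derivable E w (1 : C)) -> compact K ->
  (forall w, K w -> ~ interior_pt K w ->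
     cmod (E w) `^ p * window_int p L m (phi w) <= B) ->
  forall w, K w -> cmod (E w) `^ p * window_int p L m (phi w) <= B.
Proof.
move=> p0 p1 L0 hm hphi hE cK hB w Kw.
have [M hM] : exists M : R, forall w, K w -> cmod (phi w) <= M.
  have [||w1 _ H] := @compact_EVT_max _ R (fun w => cmod (phi w)) K _ cK.
  - by exists w.
  - apply: continuous_subspaceT => z; apply/crcontP => e e0.
    have /ccontP/(_ e e0)[r r0 H] := derivable_ccont (hphi z); exists r => // w' /H.
    by apply: le_lt_trans; exact: cmod_dist.
  by exists (cmod (phi w1)) => w' Kw'; apply: H; rewrite inE.
have [ME hME] : exists M : R, forall w, K w -> cmod (E w) `^ p <= M.
  have [||w1 _ H] := @compact_EVT_max _ R (fun w => cmod (E w) `^ p) K _ cK.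
  - by exists w.
  - apply: continuous_subspaceT => z; apply: cont_powR_cmod => //; exact: derivable_ccont.
  by exists (cmod (E w1) `^ p) => w' Kw'; apply: H; rewrite inE.
have ME0 : 0 <= ME by apply: le_trans (hME _ Kw); exact: powR_ge0.
apply/ler_addgt0Pr => e e0.
have e1 : 0 < e / (2 * (ME + 1)) by rewrite divr_gt0 //; lra.
have [n [n0 H]] := @riemann_window m p L (- M) M (- M) M p0 p1 L0 hm _ e1.
pose hn : R := 2 * L / n%:R.
have hn0 : 0 < hn by rewrite divr_gt0 ?mulr_gt0 // ltr0n.
rewrite -/hn in H; clearbody hn.
(* The mesh width enters as its power 1/p, so that each weighted term of the Riemann sum is the p-th
   power of the modulus of an entire function. *)
pose F (k : 'I_n) (w : C) : C := (hn `^ p^-1)%:C * (E w * m (phi w + (- L + k%:R * hn)%:C)).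
have FE k w' : cmod (F k w') `^ p =
    cmod (E w') `^ p * (hn * cmod (m (phi w' + (- L + k%:R * hn)%:C)) `^ p).
  rewrite !cmodM cmod_real ger0_norm ?powR_ge0 // !powRM ?mulr_ge0 ?cmod_ge0 ?powR_ge0 //.
  by rewrite -powRrM mulVf ?gt_eqF // powRr1 ?ltW // mulrCA.
have hF k w' : derivable (F k) w' (1 : C).
  apply: holZ; apply: holM; first exact: hE.
  apply: (@hol_comp _ m (fun w => phi w + (- L + k%:R * hn)%:C)); last exact: hm.
  by apply: holD; [exact: hphi|exact: hol_cst].
pose S w' := \sum_(k < n) hn * cmod (m (phi w' + (- L + k%:R * hn)%:C)) `^ p.
have sumE w' : \sum_(k < n) cmod (F k w') `^ p = cmod (E w') `^ p * S w'.
  by rewrite /S mulr_sumr; apply: eq_bigr => k _; exact: FE.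
have close w' : K w' -> `|cmod (E w') `^ p * window_int p L m (phi w') - cmod (E w') `^ p * S w'| <= e / 2.
  move=> Kw'; rewrite -mulrBr normrM ger0_norm ?powR_ge0 //.
  apply: (@le_trans _ _ (ME * (e / (2 * (ME + 1))))).
    apply: ler_pM => //; [exact: powR_ge0|exact: hME|apply: H].
    have := hM _ Kw'; have := Re_le_cmod (phi w'); have := Im_le_cmod (phi w').
    rewrite !ler_norml /rect_set /= => /andP[? ?] /andP[? ?] ?.
    by split; apply/andP; split; lra.
  rewrite mulrCA; apply: ler_wpM2l; first exact: ltW.
  by rewrite ler_pdivrMr; lra.
have := @max_principle_sum _ (index_enum 'I_n) F K p (B + e / 2) p0 p1 hF cK.
move=> /(_ _ w Kw) MP.
have {}MP : cmod (E w) `^ p * S w <= B + e / 2.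
  rewrite -sumE; apply: MP => w' Kw' iw'; rewrite sumE.
  have := close _ Kw'; have := hB _ Kw' iw'; rewrite ler_norml => ? /andP[? ?]; lra.
have := close _ Kw; rewrite ler_norml => /andP[? ?]; lra.
Qed.

End MaximumPrinciple.

(** * Phragmen-Lindelof in the upper half-plane *)

Section PhragmenLindelof.
Variable R : realType.
Local Notation C := (cplx R).
Implicit Types (f g m : C -> C) (z w h : C) (p : R).

(** The limit d -> 0, by which auxiliary exponential factors are removed. *)
Lemma le_exp_limit (a b x d0 : R) : 0 < d0 -> 0 <= b ->
  (forall d, 0 < d <= d0 -> a <= b * expR (d * x)) -> a <= b.
Proof.
move=> d00 b0 H; apply/ler_addgt0Pr => e e0.
have b1 : 0 < b + 1 by lra.
have [r r0 K] := is_derive_eps (is_derive_expR 0) (ltr01 : 0 < 1 :> R).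
have x1 : 0 < `|x| + 1 by rewrite ltr_wpDl.
pose s := Num.min r (e / (2 * (b + 1))) / 2.
have m0 : 0 < Num.min r (e / (2 * (b + 1))) by rewrite lt_min r0 divr_gt0 // mulr_gt0.
have s0 : 0 < s by rewrite divr_gt0.
have : s < Num.min r (e / (2 * (b + 1))) by rewrite /s; lra.
rewrite lt_min => /andP[sr se].
pose d := Num.min d0 (s / (`|x| + 1)).
have dd0 : 0 < d by rewrite lt_min d00 divr_gt0.
have dle : d <= d0 by rewrite ge_min lexx.
have dx : `|d * x| <= s.
  rewrite normrM (gtr0_norm dd0); apply: (@le_trans _ _ (d * (`|x| + 1))).
    by rewrite ler_pM2l // lerDl.
  by rewrite -ler_pdivlMr // ge_min lexx orbT.
apply: le_trans (H d _) _; first by rewrite dd0.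
have := K (d * x) (le_lt_trans dx sr).
rewrite add0r expR0 !mul1r ler_norml => /andP[_ K1].
have : d * x <= `|d * x| by exact: ler_norm.
move=> K2; have K3 : expR (d * x) - 1 <= 2 * s by lra.
have -> : b * expR (d * x) = b + b * (expR (d * x) - 1) by ring.
rewrite lerD2l; apply: (@le_trans _ _ ((b + 1) * (2 * s))).
  apply: (@le_trans _ _ (b * (2 * s))); first exact: ler_wpM2l.
  by apply: ler_wpM2r; lra.
move: se; rewrite ltr_pdivlMr ?mulr_gt0 //; lra.
Qed.

Lemma cubic_beats_square (al be ga d : R) : 0 <= al -> 0 < d ->
  exists2 r0 : R, 0 < r0 & forall r, r0 <= r -> al * r ^+ 2 + be - d * r ^+ 3 <= ga.
Proof.
move=> al0 d0; exists (1 + (al + `|be| + `|ga|) / d).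
  by rewrite ltr_wpDr // divr_ge0 ?addr_ge0 // ltW.
move=> r hr.
have q0 : 0 <= (al + `|be| + `|ga|) / d by rewrite divr_ge0 ?addr_ge0 // ltW.
have r1 : 1 <= r by lra.
have h1 : al + `|be| + `|ga| <= d * r.
  by rewrite mulrC -ler_pdivrMr //; lra.
have r2 : 1 <= r ^+ 2 by rewrite exprn_ege1.
have h2 : (al + `|be| + `|ga|) * r ^+ 2 <= d * r * r ^+ 2 by rewrite ler_wpM2r //; lra.
have h3 : `|be| <= `|be| * r ^+ 2 by rewrite ler_peMr.
have h4 : `|ga| <= `|ga| * r ^+ 2 by rewrite ler_peMr.
have h5 := ler_norm be; have h6 := ler_norm (- ga); rewrite normrN in h6.
have -> : d * r ^+ 3 = d * r * r ^+ 2 by ring.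
lra.
Qed.

Lemma window_int_le m p (L : R) z (B : R) : 0 < p -> p <= 1 -> 0 < L ->
  (forall w, derivable m w (1 : C)) ->
  (forall t, - L <= t <= L -> cmod (m (z + t%:C)) <= B) ->
  window_int p L m z <= 2 * L * B `^ p.
Proof.
move=> p0 p1 L0 hm H.
have LL : - L <= L by lra.
have -> : 2 * L * B `^ p = rint (- L) L (fun _ => B `^ p).
  by rewrite rint_cst //; ring.
apply: rint_le => //; [exact: cont_window|exact: cont_on_cst|].
move=> t tL; apply: powR_le; [exact: ltW|exact: cmod_ge0|exact: H].
Qed.

Lemma window_int_ge0 m p (L : R) z : 0 <= window_int p L m z.
Proof. by apply: rint_ge0 => t _; exact: powR_ge0. Qed.

Lemma powR_expR (x p : R) : expR x `^ p = expR (p * x).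
Proof. by rewrite /powR gt_eqF ?expR_gt0 // expRK. Qed.

(** The growth of e^{i tau z} f(z) for f of type [tau]: the vertical type has been cancelled, the
    horizontal one remains. *)
Definition half_growth (tau : R) g := forall e : R, 0 < e -> exists2 c : R, 0 < c &
  forall z, 0 <= complex.Im z ->
    cmod (g z) <= c * expR ((tau + e) * `|complex.Re z| + e * complex.Im z).

Lemma closed_ge0 (u : C -> R) : (forall z, {for z, continuous u}) ->
  closed [set w | 0 <= u w].
Proof.
move=> cu; have -> : [set w | 0 <= u w] = u @^-1` [set x | 0 <= x] by [].
by apply: closed_comp => [w _|]; [exact: cu|exact: closed_ge].
Qed.

Section Sector.
Variables (s : R) (s1 : s = 1 \/ s = -1).
Local Notation k := (Complex s 1 : C).

(** The map w -> (s + i) w^2 carries |arg w| <= pi/8 onto the first quadrant for s = 1 and onto the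
    second for s = -1; the condition on Re w selects one of the two square roots. In this sector
    |arg w^3| <= 3 pi/8, so e^{-d w^3} decays. *)
Definition sector (r : R) : set C := [set w | [/\ 0 <= complex.Re w,
  0 <= s * complex.Re (Complex s 1 * w ^+ 2), 0 <= complex.Im (Complex s 1 * w ^+ 2) & cmod w <= r]].

Lemma hol_sector_map w : derivable (fun w => k * w ^+ 2) w (1 : C).
Proof. by apply: holZ; apply: (@holX _ (fun w => w)); exact: hol_id. Qed.

Lemma cont_of_complex (u : C -> C) (q : C -> R) z :
  (forall w w', `|q w - q w'| <= cmod (w - w')) -> {for z, continuous u} ->
  {for z, continuous (fun w => q (u w))}.
Proof.
move=> hq /ccontP H; apply/crcontP => e /H [d d0 K]; exists d => // w /K.
exact: le_lt_trans.
Qed.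

Lemma Re_lip (w w' : C) : `|complex.Re w - complex.Re w'| <= cmod (w - w').
Proof. by rewrite -ReN -ReD; exact: Re_le_cmod. Qed.

Lemma Im_lip (w w' : C) : `|complex.Im w - complex.Im w'| <= cmod (w - w').
Proof. by rewrite -ImN -ImD; exact: Im_le_cmod. Qed.

Lemma compact_sector r : compact (sector r).
Proof.
apply: (@subclosed_compact _ _ (rect_set (- r) r (- r) r)); last 2 first.
- exact: compact_rect.
- move=> w [_ _ _ wr]; have := Re_le_cmod w; have := Im_le_cmod w.
  rewrite !ler_norml /rect_set /= => /andP[? ?] /andP[? ?].
  by split; apply/andP; split; lra.
have -> : sector r = [set w | 0 <= complex.Re w] `&`
   [set w : C | 0 <= s * complex.Re (k * w ^+ 2)] `&` [set w : C | 0 <= complex.Im (k * w ^+ 2)] `&`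
   [set w : C | 0 <= r - cmod w].
  apply/seteqP; split => w /=; first by move=> [? ? ? ?]; rewrite subr_ge0.
  by move=> [[[? ?] ?]]; rewrite subr_ge0.
have cid z : {for z, continuous (fun w : C => w)} by exact: cvg_id.
apply: closedI; [apply: closedI; [apply: closedI|]|]; apply: closed_ge0 => z.
- by apply: (cont_of_complex Re_lip); exact: cid.
- apply: continuousM; first exact: cst_continuous.
  by apply: (cont_of_complex Re_lip); exact: derivable_ccont (@hol_sector_map z).
- by apply: (cont_of_complex Im_lip); exact: derivable_ccont (@hol_sector_map z).
- apply: continuousB; first exact: cst_continuous.
  by apply: (cont_of_complex (@cmod_dist R)); exact: cid.
Qed.

Lemma sector_boundary r w : sector r w -> ~ interior_pt (sector r) w ->
  [\/ complex.Re (k * w ^+ 2) = 0, complex.Im (k * w ^+ 2) = 0 | cmod w = r].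
Proof.
move=> [a0 X0 Y0 wr] ni.
have s0 : s != 0 by case: s1 => ->; rewrite ?oppr_eq0 oner_eq0.
have [X|X] := eqVneq (complex.Re (k * w ^+ 2)) 0; first exact: Or31.
have [Y|Y] := eqVneq (complex.Im (k * w ^+ 2)) 0; first exact: Or32.
have [Z|Z] := eqVneq (cmod w) r; first exact: Or33.
have {}X0 : 0 < s * complex.Re (k * w ^+ 2) by rewrite lt_def X0 mulf_neq0.
have {}Y0 : 0 < complex.Im (k * w ^+ 2) by rewrite lt_def Y0 Y.
have {}wr : cmod w < r by rewrite lt_neqAle Z.
(* For w = ib the imaginary part of [k * w ^+ 2] is -b^2, which contradicts [Y0]; so the constraint
   on Re w creates no further edge. *)
have {}a0 : 0 < complex.Re w.
  rewrite lt_def a0 andbT; apply/eqP => a0'; move: Y0 X0.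
  case: (w) a0' => a b /= ->; case: s1 => ->; nra.
exfalso; apply: ni.
have m0 : 0 < Num.min (s * complex.Re (k * w ^+ 2)) (complex.Im (k * w ^+ 2)).
  by rewrite lt_min X0.
have /ccontP/(_ _ m0)[d d0 H] := derivable_ccont (@hol_sector_map w).
exists (Num.min d (Num.min (complex.Re w) (r - cmod w))).
  by rewrite !lt_min d0 a0 subr_gt0.
move=> w'; rewrite !lt_min => /and3P[/H]; rewrite lt_min => /andP[h1 h2] h3 h4.
have rw := Re_lip w' w; have rk := Re_lip (k * w' ^+ 2) (k * w ^+ 2).
have ik := Im_lip (k * w' ^+ 2) (k * w ^+ 2).
have nw := cmod_distl w' w.
rewrite ler_norml in rw; rewrite ler_norml in rk; rewrite ler_norml in ik.
case/andP: rw => ? ?; case/andP: rk => k1 k2; case/andP: ik => ? ?.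
split; [lra| |lra|lra].
move: h1 k1 k2; set D := cmod (_ - _); case: s1 => ->; rewrite ?mul1r ?mulN1r => *; lra.
Qed.

(** For w = a + ib the two quadrant conditions force 9 b^2 <= 2 a^2. Then |w| <= 2 a, and Re w^3 = a
    (a^2 - 3 b^2) >= a^3 / 3 = (2 a)^3 / 24. *)
Lemma sector_cube r w : sector r w ->
  cmod w ^+ 3 / 24 <= complex.Re (w ^+ 3) /\ 0 <= complex.Re w.
Proof.
move=> [a0 X0 Y0 _]; split => //.
move: X0 Y0; case: w a0 => a b /= a0 X0 Y0.
have [A B] : 0 <= a ^+ 2 - b ^+ 2 - 2 * a * b /\ 0 <= a ^+ 2 - b ^+ 2 + 2 * a * b.
  by move: X0 Y0; case: s1 => ->; split; nra.
have b2 : 9 * b ^+ 2 <= 2 * a ^+ 2.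
  have : 0 <= (a ^+ 2 - b ^+ 2 - 2 * a * b) * (a ^+ 2 - b ^+ 2 + 2 * a * b) by rewrite mulr_ge0.
  have ha := sqr_ge0 a; have hb := sqr_ge0 b; have hab : b ^+ 2 <= a ^+ 2 by lra.
  rewrite -subr_sqr; have -> : (2 * a * b) ^+ 2 = 4 * (a ^+ 2 * b ^+ 2) by ring.
  move: (a ^+ 2) (b ^+ 2) ha hb hab => u v hu hv hab; nra.
have n2 : cmod (Complex a b) <= 2 * a.
  rewrite -(@ler_pXn2r _ 2) ?nnegrE ?cmod_ge0 ?mulr_ge0 // cmod_sqr /=.
  by have := sqr_ge0 a; lra.
have n3 : cmod (Complex a b) ^+ 3 <= (2 * a) ^+ 3.
  by apply: lerXn2r n2; rewrite nnegrE ?cmod_ge0 ?mulr_ge0.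
have -> : a * (a * a - b * b) - b * (a * b + b * a) = a * (a ^+ 2 - 3 * b ^+ 2) by ring.
have : a * (a ^+ 2 / 3) <= a * (a ^+ 2 - 3 * b ^+ 2).
  by apply: ler_wpM2l => //; have := sqr_ge0 a; lra.
have -> : a * (a ^+ 2 / 3) = (2 * a) ^+ 3 / 24 by field.
lra.
Qed.

(** In the variable w the growth is of order 2, and e^{-d w^3} beats it: on an arc of large radius
    the product is at most 1, hence at most [B]. On the two straight edges (s + i) w^2 lies on a
    coordinate axis, where the bound is given. Then d tends to 0. *)
Lemma sector_bound m p (L c A B : R) : 0 < p -> p <= 1 -> 0 < L -> 0 < c -> 0 <= A ->
  (forall w, derivable m w (1 : C)) ->
  (forall z, 0 <= complex.Im z -> cmod (m z) <= c * expR (A * (`|complex.Re z| + complex.Im z))) ->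
  1 <= B -> (forall z, 0 <= complex.Im z -> (complex.Re z = 0 \/ complex.Im z = 0) -> window_int p L m z <= B) ->
  forall w, sector (cmod w) w -> window_int p L m (k * w ^+ 2) <= B.
Proof.
move=> p0 p1 L0 c0 A0 hm hg B1 hB w Sw.
have [_ a0] := sector_cube Sw.
have B0 : 0 <= B by lra.
apply: (@le_exp_limit _ _ (p * complex.Re (w ^+ 3)) 1) => // d /andP[d0 _].
pose E (w : C) : C := cexp ((- d)%:C * w ^+ 3).
have hE w' : derivable E w' (1 : C).
  apply: (@hol_comp _ (@cexp R) (fun w => (- d)%:C * w ^+ 3)); last exact: hol_cexp.
  by apply: holZ; apply: (@holX _ (fun w => w)); exact: hol_id.
have nE w' : cmod (E w') `^ p = expR (- (d * (p * complex.Re (w' ^+ 3)))).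
  rewrite cmod_cexp powR_expR; congr expR.
  by case: (w' ^+ 3) => x y /=; ring.
pose al := 4 * A * p; pose be := p * A * L + ln (2 * L * c `^ p).
have al0 : 0 <= al by rewrite !mulr_ge0 // ltW.
have pd0 : 0 < p * d / 24 by rewrite !divr_gt0 // mulr_gt0.
have [r0 r00 Hr] := @cubic_beats_square al be 0 (p * d / 24) al0 pd0.
pose r := Num.max r0 (cmod w).
have rw : cmod w <= r by rewrite le_max lexx orbT.
have rr : r0 <= r by rewrite le_max lexx.
have rp : 0 <= r by apply: le_trans rw; exact: cmod_ge0.
have Swr : sector r w by case: Sw => ? ? ? _; split.
have := @max_principle_int R m (fun w => k * w ^+ 2) E (sector r) p L B p0 p1 L0 hm hol_sector_map hE (@compact_sector r).
move=> /(_ _ w Swr); rewrite nE => MP.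
have {}MP : expR (- (d * (p * complex.Re (w ^+ 3)))) * window_int p L m (k * w ^+ 2) <= B.
  apply: MP => w' Sw' /(sector_boundary Sw') bd.
  have [cub a0'] := sector_cube Sw'.
  have Im0 : 0 <= complex.Im (k * w' ^+ 2) by case: Sw'.
  have small : expR (- (d * (p * complex.Re (w' ^+ 3)))) <= 1.
    rewrite -expR0 ler_expR oppr_le0 !mulr_ge0 ?(ltW d0) ?(ltW p0) //.
    by apply: le_trans cub; rewrite divr_ge0 // exprn_ge0 // cmod_ge0.
  rewrite nE; case: bd => bd.
  - apply: (@le_trans _ _ (1 * B)); last by rewrite mul1r.
    apply: ler_pM; [exact: expR_ge0|exact: window_int_ge0|exact: small|].
    by apply: (hB _ Im0); left.
  - apply: (@le_trans _ _ (1 * B)); last by rewrite mul1r.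
    apply: ler_pM; [exact: expR_ge0|exact: window_int_ge0|exact: small|].
    by apply: (hB _ Im0); right.
  apply: le_trans B1.
  have nk : cmod k <= 2.
    apply: le_trans (cmod_le_ReIm _) _; rewrite /= normr1.
    by case: s1 => ->; rewrite ?normrN normr1; lra.
  have nz : cmod (k * w' ^+ 2) <= 2 * r ^+ 2.
    rewrite cmodM cmodX bd ler_wpM2r ?sqr_ge0 //.
  have wb : window_int p L m (k * w' ^+ 2) <= 2 * L * (c * expR (A * (4 * r ^+ 2 + L))) `^ p.
    apply: window_int_le => // t tL.
    apply: le_trans (hg _ _) _; first by rewrite ImD /= addr0.
    rewrite ler_pM2l // ler_expR; apply: ler_wpM2l => //.
    rewrite ReD ImD /= addr0.
    have h1 := Re_le_cmod (k * w' ^+ 2); have h2 := Im_le_cmod (k * w' ^+ 2).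
    have h3 := ler_normD (complex.Re (k * w' ^+ 2)) t.
    have h4 : `|t| <= L by rewrite ler_norml.
    have h5 := ler_norm (complex.Im (k * w' ^+ 2)).
    by clear -h1 h2 h3 h4 h5 nz; lra.
  apply: le_trans (ler_wpM2l (expR_ge0 _) wb) _.
  have c2 : 0 < 2 * L * c `^ p by rewrite mulr_gt0 ?mulr_gt0 // powR_gt0.
  rewrite powRM ?expR_ge0 ?(ltW c0) // powR_expR.
  have -> : 2 * L * (c `^ p * expR (p * (A * (4 * r ^+ 2 + L)))) =
      expR (ln (2 * L * c `^ p)) * expR (p * (A * (4 * r ^+ 2 + L))).
    by rewrite lnK // mulrA.
  rewrite -!expRD -[X in _ <= X]expR0 ler_expR.
  apply: le_trans (Hr r rr); rewrite /al /be.
  have q1 : p * d / 24 * r ^+ 3 <= d * (p * complex.Re (w' ^+ 3)).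
    rewrite bd in cub.
    have -> : p * d / 24 * r ^+ 3 = d * (p * (r ^+ 3 / 24)) by ring.
    by apply: ler_wpM2l; [exact: ltW|apply: ler_wpM2l => //; exact: ltW].
  clear -q1; lra.
rewrite expRN in MP.
by rewrite -ler_pdivrMr ?expR_gt0 // mulrC.
Qed.

End Sector.

(** Each z is (s + i) w^2 with Re w >= 0, where [s] follows the sign of Re z; so both quadrants are
    covered by [sector_bound]. *)
Lemma quadrant_bound m p (L c A B : R) : 0 < p -> p <= 1 -> 0 < L -> 0 < c -> 0 <= A ->
  (forall w, derivable m w (1 : C)) ->
  (forall z, 0 <= complex.Im z -> cmod (m z) <= c * expR (A * (`|complex.Re z| + complex.Im z))) ->
  1 <= B -> (forall z, 0 <= complex.Im z -> (complex.Re z = 0 \/ complex.Im z = 0) -> window_int p L m z <= B) ->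
  forall z, 0 <= complex.Im z -> window_int p L m z <= B.
Proof.
move=> p0 p1 L0 c0 A0 hm hg B1 hB z z0.
have [s s1 sz] : exists2 s : R, s = 1 \/ s = -1 & 0 <= s * complex.Re z.
  case: (lerP 0 (complex.Re z)) => h; [exists 1; [by left|by rewrite mul1r]|].
  by exists (-1); [right|rewrite mulN1r oppr_ge0 ltW].
have k0 : (Complex s 1 : C) != 0 by apply: Complex_neq0; right; exact: oner_neq0.
have [w w0 wE] : exists2 w : C, 0 <= complex.Re w & Complex s 1 * w ^+ 2 = z.
  pose u : C := sqrtc (z / Complex s 1).
  have uE : Complex s 1 * u ^+ 2 = z by rewrite /u sqr_sqrtc mulrC divfK.
  case: (lerP 0 (complex.Re u)) => h; first by exists u.
  by exists (- u); [rewrite ReN oppr_ge0 ltW|rewrite sqrrN].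
have K := @sector_bound s s1 m p L c A B p0 p1 L0 c0 A0 hm hg B1 hB w.
rewrite -wE; apply: K.
by split; rewrite ?wE ?lexx.
Qed.

(** The factor e^{i e z} cancels the growth e^{e Im z} left on the imaginary axis, so the window
    integral is bounded on both axes. The price is a constant [B] that depends on [e]. *)
Lemma phragmen_lindelof_weak g p (L M0 tau : R) : 0 < p -> p <= 1 -> 0 < L -> 0 <= tau ->
  (forall w, derivable g w (1 : C)) -> half_growth tau g ->
  (forall x : R, window_int p L g x%:C <= M0) ->
  forall e : R, 0 < e -> exists2 B : R, 1 <= B &
    forall z, 0 <= complex.Im z -> window_int p L g z <= B * expR (p * e * complex.Im z).
Proof.
move=> p0 p1 L0 tau0 hg hgr hM e e0.
have [c c0 Hc] := hgr e e0.
pose m z := g z * cexp (Complex 0 e * z).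
have hm w : derivable m w (1 : C).
  apply: holM; first exact: hg.
  apply: (@hol_comp _ (@cexp R) (fun w => Complex 0 e * w)); last exact: hol_cexp.
  by apply: holZ; exact: hol_id.
have nm z : cmod (m z) = cmod (g z) * expR (- (e * complex.Im z)).
  by rewrite cmodM cmod_cexp; case: z => x y /=; rewrite mul0r sub0r.
have wm z : window_int p L m z = expR (- (p * e * complex.Im z)) * window_int p L g z.
  rewrite /window_int -rintZ; last exact: cont_window.
  apply: eq_rint => t _; rewrite nm ImD /= addr0 powRM ?cmod_ge0 ?expR_ge0 // powR_expR mulrC.
  by congr (expR _ * _); ring.
pose A := tau + e.
have A0 : 0 <= A by rewrite addr_ge0 // ltW.
pose B := 1 + `|M0| + 2 * L * (c * expR (A * L)) `^ p.
have B2 : 0 <= 2 * L * (c * expR (A * L)) `^ p.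
  by apply: mulr_ge0; [apply: mulr_ge0 => //; exact: ltW|exact: powR_ge0].
have M00 : 0 <= `|M0| by [].
have MM := ler_norm M0.
have B1 : 1 <= B by rewrite /B; lra.
exists B => // z z0.
rewrite -ler_pdivrMr ?expR_gt0 // -expRN mulrC -wm.
apply: (@quadrant_bound m p L c A B) => // {z z0} z z0.
  rewrite nm; apply: (@le_trans _ _ (cmod (g z))).
    rewrite ler_piMr ?cmod_ge0 // -expR0 ler_expR oppr_le0 mulr_ge0 //; exact: ltW.
  apply: le_trans (Hc z z0) _; rewrite ler_pM2l // ler_expR /A mulrDr lerD2l.
  by rewrite ler_wpM2r // lerDr.
case=> hz; last first.
  rewrite wm hz mulr0 oppr0 expR0 mul1r; apply: (@le_trans _ _ M0); last by rewrite /B; lra.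
  have -> : z = (complex.Re z)%:C by case: z hz {z0} => x y /= ->.
  exact: hM.
apply: (@le_trans _ _ (2 * L * (c * expR (A * L)) `^ p)); last by rewrite /B; lra.
apply: window_int_le => // t tL; rewrite nm ImD /= addr0.
apply: (@le_trans _ _ (c * expR ((tau + e) * `|t| + e * complex.Im z) * expR (- (e * complex.Im z)))).
  apply: ler_wpM2r; first exact: expR_ge0.
  have := Hc (z + t%:C); rewrite ImD ReD /= addr0 hz add0r; exact.
rewrite -mulrA -expRD ler_pM2l // ler_expR addrK; apply: ler_wpM2l => //.
by rewrite ler_norml.
Qed.

(** The uncontrolled constant of the weak form is removed by the factor e^{2 i e z - d z^2} on a
    rectangle above the real axis: the linear term makes the top side harmless, the quadratic one
    the vertical sides, and the bottom side carries [M0]. The parameters are fixed in the order nu,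
    e, H, d, X and released as d -> 0, e -> 0, nu -> 0. *)
Theorem phragmen_lindelof g p (L M0 tau : R) : 0 < p -> p <= 1 -> 0 < L -> 0 <= tau ->
  (forall w, derivable g w (1 : C)) -> half_growth tau g ->
  (forall x : R, window_int p L g x%:C <= M0) ->
  forall z, 0 <= complex.Im z -> window_int p L g z <= M0.
Proof.
move=> p0 p1 L0 tau0 hg hgr hM z z0.
have M00 : 0 <= M0 by apply: le_trans (hM 0); exact: window_int_ge0.
(* [M0] may be 0, and the logarithm of [ratio] needs a positive denominator. *)
apply/ler_addgt0Pr => nu nu0.
have Mn0 : 0 < M0 + nu by rewrite ltr_wpDl.
apply: (@le_exp_limit _ _ (2 * p * complex.Im z) 1) => //; first exact: ltW.
move=> e /andP[e0 _].
have [B B1 HB] := phragmen_lindelof_weak p0 p1 L0 tau0 hg hgr hM e0.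
have B0 : 0 < B by lra.
pose ratio := B / (M0 + nu).
have ratio0 : 0 < ratio by rewrite divr_gt0.
(* At height [H] the weak bound times the auxiliary factor is at most [B] times e^{-p e H / 2}, and
   this [H] brings it below [M0 + nu]. *)
pose H := Num.max (complex.Im z + 1) (2 * `|ln ratio| / (p * e)).
have Hz : complex.Im z + 1 <= H by rewrite le_max lexx.
have H0 : 0 < H by lra.
have pe0 : 0 < p * e by rewrite mulr_gt0.
have HB2 : `|ln ratio| <= p * e * H / 2.
  have : 2 * `|ln ratio| / (p * e) <= H by rewrite le_max lexx orbT.
  by rewrite ler_pdivrMr //; lra.
apply: (@le_exp_limit _ _ (p * (complex.Re z ^+ 2 - complex.Im z ^+ 2)) (e / (2 * H))) => //.
- by rewrite divr_gt0 // mulr_gt0.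
- by rewrite mulr_ge0 ?expR_ge0 // ltW.
(* The bound on [d] keeps [d * H ^+ 2] below [e * H / 2], so the vertical growth of e^{-d z^2} uses
   up only a part of the decay of e^{2 i e z}. *)
move=> d /andP[d0]; rewrite ler_pdivlMr ?mulr_gt0 // => dH.
pose E (w : C) : C := cexp (Complex 0 (2 * e) * w - d%:C * w ^+ 2).
have hE w : derivable E w (1 : C).
  apply: (@hol_comp _ (@cexp R) (fun w => Complex 0 (2 * e) * w - d%:C * w ^+ 2)); last exact: hol_cexp.
  apply: holB; apply: holZ; first exact: hol_id.
  by apply: (@holX _ (fun w => w)); exact: hol_id.
have nE w : cmod (E w) `^ p = expR (- (2 * p * complex.Im w * e) - d * (p * (complex.Re w ^+ 2 - complex.Im w ^+ 2))).
  rewrite cmod_cexp powR_expR; congr expR; case: w => x y /=; ring.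
(* The value that X^2 must reach for e^{-d z^2} to outweigh the weak bound on the vertical sides. *)
pose T := (ln ratio + p * e * H + p * d * H ^+ 2) / (p * d).
have pd0 : 0 < p * d by rewrite mulr_gt0.
pose X := 1 + `|complex.Re z| + `|T|.
have T0 : 0 <= `|T| by []. have z00 : 0 <= `|complex.Re z| by [].
have XT : T <= X ^+ 2.
  have h1 := ler_norm T.
  have X1 : 1 <= X by rewrite /X; lra.
  have : X <= X ^+ 2 by rewrite expr2 ler_peMr //; lra.
  by rewrite /X in X1 *; lra.
have Kz : rect_set (- X) X 0 H z.
  split; rewrite /X; last by apply/andP; split => //; lra.
  by have := ler_norm (complex.Re z); have := ler_norm (- complex.Re z); rewrite normrN => *; apply/andP; split; lra.
have MP := @max_principle_int R g (fun w => w) E _ p L (M0 + nu) p0 p1 L0 hg (@hol_id R) hE (@compact_rect R (- X) X 0 H).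
have {}MP : cmod (E z) `^ p * window_int p L g z <= M0 + nu.
  apply: MP => // w [/andP[x1 x2] /andP[y1 y2]] ni.
  have bigw := HB w y1.
  have step q : q + p * e * complex.Im w + ln ratio <= 0 ->
      expR q * window_int p L g w <= M0 + nu.
    move=> hq; apply: le_trans (ler_wpM2l (expR_ge0 _) bigw) _.
    have -> : M0 + nu = B * ratio^-1 by rewrite /ratio; field; rewrite !gt_eqF.
    rewrite mulrCA ler_pM2l // -expRD -(lnK ratio0) -expRN ler_expR.
    by clear -hq; lra.
  rewrite nE.
  have [y0|y0] := eqVneq (complex.Im w) 0.
    have -> : w = (complex.Re w)%:C by case: w y0 {x1 x2 y1 y2 ni bigw step} => x y /= ->.
    rewrite /= mulr0 mul0r oppr0 expr0n subr0 sub0r.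
    apply: (@le_trans _ _ (1 * M0)); last by rewrite mul1r; lra.
    apply: ler_pM; [exact: expR_ge0|exact: window_int_ge0| |exact: hM].
    rewrite -expR0 ler_expR oppr_le0; apply: mulr_ge0; first exact: ltW.
    by apply: mulr_ge0; [exact: ltW|exact: sqr_ge0].
  have [yH|yH] := eqVneq (complex.Im w) H.
    apply: step; rewrite yH.
    have q1 : d * (p * (complex.Re w ^+ 2 - H ^+ 2)) >= - (d * (p * H ^+ 2)).
      rewrite -mulrN -mulrN; apply: ler_wpM2l; first exact: ltW.
      by apply: ler_wpM2l; [exact: ltW|have := sqr_ge0 (complex.Re w); lra].
    have q2 : d * (p * H ^+ 2) <= e * p * H / 2.
      have -> : d * (p * H ^+ 2) = d * (2 * H) * (p * H / 2) by field.
      have -> : e * p * H / 2 = e * (p * H / 2) by ring.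
      by apply: ler_wpM2r => //; rewrite divr_ge0 // mulr_ge0 // ltW.
    have := ler_norm (ln ratio); clear -q1 q2 HB2; lra.
  have xX : complex.Re w ^+ 2 = X ^+ 2.
    have [->//|h1] := eqVneq (complex.Re w) X.
    have [->|h2] := eqVneq (complex.Re w) (- X); first by rewrite sqrrN.
    exfalso; apply: ni.
    pose rr := Num.min (Num.min (complex.Re w + X) (X - complex.Re w)) (Num.min (complex.Im w) (H - complex.Im w)).
    exists rr.
      have e1 : - X < complex.Re w by rewrite lt_neqAle x1 eq_sym h2.
      have e2 : complex.Re w < X by rewrite lt_neqAle x2 h1.
      have e3 : 0 < complex.Im w by rewrite lt_def y1 y0.
      have e4 : complex.Im w < H by rewrite lt_neqAle y2 yH.
      by rewrite !lt_min e3 /=; clear -e1 e2 e4; apply/andP; split; [apply/andP; split|]; lra.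
    move=> w'; rewrite !lt_min => /andP[/andP[k1 k2] /andP[k3 k4]].
    have := Re_lip w' w; have := Im_lip w' w.
    rewrite !ler_norml /rect_set /= => /andP[u1 u2] /andP[v1 v2].
    by clear -k1 k2 k3 k4 u1 u2 v1 v2; split; apply/andP; split; lra.
  apply: step; rewrite xX.
  have q3 : p * d * T = ln ratio + p * e * H + p * d * H ^+ 2.
    by rewrite /T; field; rewrite gt_eqF //= gt_eqF.
  have q4 : p * d * T <= p * d * X ^+ 2 by rewrite ler_wpM2l // ltW.
  have q5 : complex.Im w ^+ 2 <= H ^+ 2 by apply: lerXn2r => //; rewrite nnegrE // ltW.
  have q6 : p * d * complex.Im w ^+ 2 <= p * d * H ^+ 2 by rewrite ler_wpM2l // ltW.
  have q7 : 0 <= p * e * complex.Im w by rewrite mulr_ge0 // ltW.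
  have q8 : p * e * complex.Im w <= p * e * H by rewrite ler_wpM2l // ltW.
  clear -q3 q4 q6 q7 q8; lra.
rewrite nE in MP; rewrite -mulrA -expRD.
set q := - _ - _ in MP.
have -> : e * (2 * p * complex.Im z) + d * (p * (complex.Re z ^+ 2 - complex.Im z ^+ 2)) = - q.
  by rewrite /q; ring.
by rewrite expRN ler_pdivlMr ?expR_gt0 // mulrC.
Qed.

End PhragmenLindelof.

(** * Line integrals as limits over segments *)

Section LineIntegrals.
Variable R : realType.
Local Notation C := (cplx R).
Implicit Types (f g : C -> C) (z w h : C) (p y : R).

Definition hol_line y f := forall x, derivable f (Complex x y : C) (1 : C).

Lemma cont_line a b p y f : 0 < p -> p <= 1 -> hol_line y f ->
  cont_on a b (fun x => cmod (f (Complex x y)) `^ p).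
Proof.
move=> p0 p1 hf; apply: (@cont_horizR R a b y (fun w => cmod (f w) `^ p)) => x _.
by apply: cont_powR_cmod => //; exact/derivable_ccont/hf.
Qed.

Lemma measurable_line p y f : 0 < p -> p <= 1 -> hol_line y f ->
  measurable_fun setT (fun x : R => cmod (f (Complex x y)) `^ p : R).
Proof.
move=> p0 p1 hf; apply: continuous_measurable_fun => x.
by apply: (@cont_line x x p y f) => //; rewrite lexx.
Qed.

Lemma rint_EFin a b (F : R -> R) : cont_on a b F ->
  ((rint a b F)%:E = \int[lebesgue_measure]_(x in `[a, b]) (F x)%:E)%E.
Proof.
move=> cF; rewrite /rint /Rintegral fineK //.
by apply: integrable_fin_num => //; exact: cont_integrable.
Qed.

Lemma rint_le_line a b p y f : 0 < p -> p <= 1 -> hol_line y f ->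
  ((rint a b (fun x => cmod (f (Complex x y)) `^ p))%:E <= line_integral p y f)%E.
Proof.
move=> p0 p1 hf; rewrite rint_EFin; last exact: cont_line.
apply: ge0_subset_integral => //; first by apply/measurable_EFinP; exact: measurable_line.
by move=> x _; rewrite lee_fin powR_ge0.
Qed.

(** Monotone convergence along the segments [-n, n]. *)
Lemma line_le p y f (M : \bar R) : 0 < p -> p <= 1 -> hol_line y f ->
  (forall n : nat, ((rint (- n%:R) n%:R (fun x => cmod (f (Complex x y)) `^ p))%:E <= M)%E) ->
  (line_integral p y f <= M)%E.
Proof.
move=> p0 p1 hf H; rewrite /line_integral -(bigcup_itvT true false).
have mf := measurable_line p0 p1 hf.
pose F n := `[- n%:R : R, n%:R]%classic.
have nF : {homo F : n m / (n <= m)%N >-> (n <= m)%O}.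
  move=> n m nm; apply/subsetPset => x; rewrite /F /= !in_itv /= => /andP[x1 x2].
  have nmR : (n%:R : R) <= m%:R by rewrite ler_nat.
  by apply/andP; split; lra.
have mF i : measurable (F i) by exact: measurable_itv.
have mfF i : measurable_fun (F i) (fun x : R => (cmod (f (Complex x y)) `^ p)%:E).
  by apply/measurable_EFinP; apply: measurable_funS mf.
have f0 i x : F i x -> (0 <= (cmod (f (Complex x y)) `^ p)%:E)%E.
  by move=> _; rewrite lee_fin powR_ge0.
have K := ge0_nondecreasing_set_cvg_integral (mu := lebesgue_measure) nF mF mfF f0.
have cK := cvg_lim (@ereal_hausdorff R) K.
rewrite -cK; apply: lime_le; first by apply/cvg_ex; eexists; exact: K.
near=> n; rewrite -rint_EFin //; exact: cont_line.
Unshelve. all: by end_near. Qed.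

Lemma line_ge0 p y f : (0 <= line_integral p y f)%E.
Proof. by apply: integral_ge0 => x _; rewrite lee_fin powR_ge0. Qed.

End LineIntegrals.

(** * The Plancherel-Polya inequality *)

Section PlancherelPolya.
Variable R : realType.
Local Notation C := (cplx R).
Implicit Types (f g : C -> C) (z w h : C) (p y : R).

Lemma cmod_cexp_i (t : R) z : cmod (cexp (Complex 0 t * z)) = expR (- (t * complex.Im z)).
Proof. by rewrite cmod_cexp; case: z => x y /=; rewrite mul0r sub0r. Qed.

Lemma hol_cexp_i (t : R) z : derivable (fun w : C => cexp (Complex 0 t * w)) z (1 : C).
Proof.
apply: (@hol_comp _ (@cexp R) (fun w => Complex 0 t * w)); last exact: hol_cexp.
by apply: holZ; exact: hol_id.
Qed.

(** The first component of [jmap f] without the cut-off, hence still entire. *)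
Definition twist f : C -> C := fun z => cexp (Complex 0 pi * z) * f z.

Lemma hol_twist f z : derivable f z (1 : C) -> derivable (twist f) z (1 : C).
Proof. by move=> hf; apply: holM; [exact: hol_cexp_i|exact: hf]. Qed.

Lemma cmod_twist f z : cmod (twist f z) = expR (- (pi * complex.Im z)) * cmod (f z).
Proof. by rewrite cmodM cmod_cexp_i. Qed.

Lemma half_growth_twist f : exponential_type pi f -> half_growth pi (twist f).
Proof.
move=> H e e0; have [c c0 Hc] := H e e0; exists c => // z z0.
rewrite cmod_twist; apply: le_trans (ler_wpM2l (expR_ge0 _) (Hc z)) _.
rewrite mulrCA ler_pM2l // -expRD ler_expR.
have := cmod_le_ReIm z; rewrite [X in _ <= _ + X](ger0_norm z0) => h1.
have : (pi + e) * cmod z <= (pi + e) * (`|complex.Re z| + complex.Im z).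
  by apply: ler_wpM2l h1; have := pi_ge0 R; lra.
by clear; lra.
Qed.

(** On the real axis the twist has modulus 1, so every window integral there is at most the full
    integral of |f|^p. Phragmen-Lindelof carries this bound to the window of half-length n at height
    y, and n tends to infinity. *)
Theorem plancherel_polya p f y : 0 < p -> p <= 1 -> Ep p f -> 0 <= y ->
  (line_integral p y (twist f) <= line_integral p 0 f)%E.
Proof.
move=> p0 p1 [hf tf If] y0.
have hf1 z : derivable f z (1 : C) by exact: hf.
have ht z : derivable (twist f) z (1 : C) by exact: hol_twist.
have fin : line_integral p 0 f \is a fin_num by rewrite ge0_fin_numE // line_ge0.
have [M0 M0E] : exists M0, line_integral p 0 f = M0%:E.
  by exists (fine (line_integral p 0 f)); rewrite fineK.
rewrite M0E; apply: (line_le p0 p1 (fun x => ht _)) => n.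
rewrite lee_fin; have [->|n0] := eqVneq n 0%N.
  rewrite oppr0 /rint set_itv1 Rintegral_set1.
  by rewrite -lee_fin -M0E line_ge0.
have L0 : 0 < (n%:R : R) by rewrite ltr0n lt0n.
have hM (x : R) : window_int p n%:R (twist f) x%:C <= M0.
  rewrite -lee_fin -M0E.
  have LL : - (n%:R : R) <= n%:R by lra.
  apply: le_trans (rint_le_line (- n%:R + x) (n%:R + x) p0 p1 (_ : hol_line 0 f)) => //.
  rewrite lee_fin rint_shift //; last exact: cont_line.
  rewrite le_eqVlt; apply/orP; left; apply/eqP; apply: eq_rint => t _.
  rewrite cmod_twist ImD /= addr0 mulr0 oppr0 expR0 mul1r.
  congr (cmod (f _) `^ p).
  by apply/eqP; rewrite eq_complex /= addr0 addrC !eqxx.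
have := @phragmen_lindelof R (twist f) p n%:R M0 pi p0 p1 L0 (pi_ge0 R) ht (half_growth_twist tf) hM (Complex 0 y) y0.
apply: le_trans; rewrite le_eqVlt; apply/orP; left; apply/eqP; apply: eq_rint => t _.
congr (cmod (twist f _) `^ p).
by apply/eqP; rewrite eq_complex /= add0r addr0 !eqxx.
Qed.

End PlancherelPolya.

(** * Suprema over unit intervals controlled by line integrals *)

Section Amalgam.
Variable R : realType.
Local Notation C := (cplx R).
Implicit Types (f g : C -> C) (z w h : C) (p y : R).

Lemma rint_sum n (F : 'I_n -> R -> R) a b : (forall i, cont_on a b (F i)) ->
  cont_on a b (fun x => \sum_(i < n) F i x) /\
  rint a b (fun x => \sum_(i < n) F i x) = \sum_(i < n) rint a b (F i).
Proof.
elim: n F => [|n IH] F cF.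
  have -> : (fun x => \sum_(i < 0) F i x) = fun _ => 0 by apply/funext => x; rewrite big_ord0.
  split; first exact: cont_on_cst.
  by rewrite big_ord0 /rint Rintegral_cst // mul0r.
have -> : (fun x => \sum_(i < n.+1) F i x) = fun x => \sum_(i < n) F (widen_ord (leqnSn n) i) x + F ord_max x.
  by apply/funext => x; rewrite big_ord_recr.
have [c1 c2] := IH (fun i => F (widen_ord (leqnSn n) i)) (fun i => cF _).
split; first by apply: cont_onD.
by rewrite rintD // c2 big_ord_recr.
Qed.

Lemma rint_unit_sum (F : R -> R) a n : cont_on a (a + n%:R) F ->
  \sum_(i < n) rint (a + i%:R) (a + i%:R + 1) F = rint a (a + n%:R) F.
Proof.
elim: n => [|n IH] cF.
  by rewrite big_ord0 addr0 /rint set_itv1 Rintegral_set1.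
have e1 : a + n.+1%:R = a + n%:R + 1 by rewrite -natr1 addrA.
rewrite big_ord_recr /= IH; last by apply: cont_on_sub cF => //; rewrite e1 lerDl.
by rewrite e1 in cF *; rewrite (@rint_split R a (a + n%:R) (a + n%:R + 1)) ?lerDl.
Qed.

(** Apply [submean] at every sample point. The squares have half-side 1, so the i-th one lies over
    [a + i - 1, a + i + 2]; these segments overlap three times, and the heights fill an interval of
    length 2, whence the 6. *)
Theorem amalgam p : 0 < p -> p < 1 -> exists2 K : R, 0 < K &
  forall g y0 (M : R), (forall z, y0 - 2 <= complex.Im z <= y0 + 2 -> derivable g z (1 : C)) ->
    (forall y a b, y0 - 1 <= y <= y0 + 1 ->
       rint a b (fun x => cmod (g (Complex x y)) `^ p) <= M) ->
    forall a n (x : 'I_n -> R), (forall i : 'I_n, a + i%:R <= x i <= a + i%:R + 1) ->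
      \sum_(i < n) cmod (g (Complex (x i) y0)) `^ p <= K * M.
Proof.
move=> p0 p1; have [K K0 HK] := @submean R p p0 p1.
exists (6 * K); first by rewrite mulr_gt0.
move=> g y0 M hg HM a n x hx.
pose v (z : C) := cmod (g z) `^ p.
have hl y : y0 - 2 <= y <= y0 + 2 -> hol_line y g by move=> hy t; apply: hg.
have cv c d y : y0 - 2 <= y <= y0 + 2 -> cont_on c d (fun t => v (Complex t y)).
  by move=> hy; apply: cont_line => //; [exact: ltW|exact: hl].
have v0 z : 0 <= v z by exact: powR_ge0.
pose J (i : 'I_n) y := rint (a + i%:R - 1) (a + i%:R + 2) (fun t => v (Complex t y + Complex 0 y0)).
have shiftE (t s u : R) : (Complex t s : C) + Complex u y0 = Complex (t + u) (s + y0) by [].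
have cvs u t s : -2 <= s <= 2 -> {for (Complex t s : C), continuous (fun w : C => v (w + Complex u y0))}.
  move=> hs; have cg : {for (Complex t s : C), continuous (fun w : C => g (w + Complex u y0))}.
    by apply: derivable_ccont; apply: hol_shift; apply: hg => /=; clear -hs; lra.
  by apply: (@cont_powR_cmod _ (fun w => g (w + Complex u y0))) => //; exact: ltW.
have cpar u c d : c <= d -> cont_on (-1) 1 (fun y => rint c d (fun t => v (Complex t y + Complex u y0))).
  move=> cd y y1; apply: (@rint_param_cont R _ _ (-2) 2 (fun w => v (w + Complex u y0)) cd).
    by move=> t s _ s2; apply: cvs; clear -s2; lra.
  by clear -y1; lra.
have Jlen (i : 'I_n) : a + i%:R - 1 <= a + i%:R + 2 by clear; lra.
have cJ i : cont_on (-1) 1 (J i).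
  exact: cpar.
have JE (i : 'I_n) y : J i y = rint (a + i%:R - 1) (a + i%:R + 2) (fun t => v (Complex t (y + y0))).
  by apply: eq_rint => t _; rewrite shiftE addr0.
have ptw (i : 'I_n) : v (Complex (x i) y0) <= K * rint (-1) 1 (J i).
  have hr : hol_rect (-2) 2 (-2) 2 (fun w => g (w + Complex (x i) y0)).
    by move=> t s /andP[_ hs]; apply: hol_shift; apply: hg => /=; clear -hs; lra.
  have H1 := HK _ hr; rewrite add0r in H1.
  apply: (le_trans H1); apply: ler_wpM2l; first exact: ltW.
  have m11 : (-1 : R) <= 1 by clear; lra.
  apply: (rint_le (cpar (x i) (-1) 1 m11) (cJ i)).
  move=> y y1; have /andP[h1 h2] := hx i.
  have hy : y0 - 2 <= y + y0 <= y0 + 2 by clear -y1; lra.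
  have S1 := rint_shift (s := x i) m11 (cv _ _ _ hy).
  have S2 : rint (-1) 1 (fun t => v (Complex t y + Complex (x i) y0)) =
      rint (-1) 1 (fun t => v (Complex (t + x i) (y + y0))) by apply: eq_rint => t _.
  rewrite S2 -S1 JE.
  apply: rint_sub_le; [clear -h1; lra|clear; lra|clear -h2; lra|exact: cv|].
  by move=> t _; exact: v0.
have Jsum y : -1 <= y <= 1 -> \sum_(i < n) J i y <= 3 * M.
  move=> y1; have hy : y0 - 2 <= y + y0 <= y0 + 2 by clear -y1; lra.
  have hy1 : y0 - 1 <= y + y0 <= y0 + 1 by clear -y1; lra.
  pose F t := v (Complex t (y + y0)).
  have cF c d : cont_on c d F by exact: cv.
  have E (i : 'I_n) : J i y = rint (a - 1 + i%:R) (a - 1 + i%:R + 1) F +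
      (rint (a + i%:R) (a + i%:R + 1) F + rint (a + 1 + i%:R) (a + 1 + i%:R + 1) F).
    have e1 : a - 1 + i%:R + 1 = a + i%:R by ring.
    have e2 : a + 1 + i%:R = a + i%:R + 1 by ring.
    have e3 : a - 1 + i%:R = a + i%:R - 1 by ring.
    have e4 : a + 1 + i%:R + 1 = a + i%:R + 2 by ring.
    rewrite e4 e2 e1 e3 JE.
    rewrite (@rint_split R _ (a + i%:R)) //; [|clear; lra|clear; lra].
    by congr (_ + _); rewrite (@rint_split R _ (a + i%:R + 1)) //; clear; lra.
  under eq_bigr => i _ do rewrite E.
  rewrite !big_split /= !rint_unit_sum //.
  have b1 := HM _ (a - 1) (a - 1 + n%:R) hy1; have b2 := HM _ a (a + n%:R) hy1.
  have b3 := HM _ (a + 1) (a + 1 + n%:R) hy1.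
  by rewrite -/v -/F in b1 b2 b3 *; clear -b1 b2 b3; lra.
apply: (@le_trans _ _ (\sum_(i < n) K * rint (-1) 1 (J i))); first by apply: ler_sum => i _; exact: ptw.
rewrite -mulr_sumr [6 * K]mulrC -mulrA ler_pM2l //.
have [cS <-] := rint_sum cJ.
have -> : 6 * M = rint (-1 : R) 1 (fun _ => 3 * M).
  by rewrite rint_cst; [ring|clear; lra].
by apply: rint_le => //; exact: cont_on_cst.
Qed.

End Amalgam.

(** * The kernel and its decay *)

Section Kernel.
Variable R : realType.
Local Notation C := (cplx R).
Implicit Types (z w h : C).
Variable N : nat.
Hypothesis N0 : (0 < N)%N.

(** The step that gives the product of [N] sines total type pi. *)
Definition kstep : R := pi / N%:R.
Local Notation d := kstep.

Lemma kstep_gt0 : 0 < d.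
Proof. by rewrite divr_gt0 ?pi_gt0 // ltr0n. Qed.

(* [sin (d w) / (d w)], equal to the junk value [0] at [w = 0]. *)
Definition csinc w : C :=
  (cexp (Complex 0 d * w) - cexp (Complex 0 (- d) * w)) / (Complex 0 (2 * d) * w).

Definition kern w : C := csinc w ^+ N / w.

Lemma cmod_imag (t : R) : cmod (Complex 0 t : C) = `|t|.
Proof. by rewrite /cmod /= expr0n add0r sqrtr_sqr. Qed.

Lemma i2d_neq0 : (Complex 0 (2 * d) : C) != 0.
Proof. by rewrite -cmod_gt0 cmod_imag normr_gt0 mulf_neq0 // gt_eqF // kstep_gt0. Qed.

Lemma hol_csinc w : w != 0 -> derivable csinc w (1 : C).
Proof.
move=> w0; apply: holM.
  by apply: holB; exact: hol_cexp_i.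
apply: (@holV _ (fun w => Complex 0 (2 * d) * w)); first by rewrite mulf_neq0 // i2d_neq0.
by apply: holZ; exact: hol_id.
Qed.

Lemma hol_kern w : w != 0 -> derivable kern w (1 : C).
Proof.
move=> w0; apply: holM; first by apply: holX; exact: hol_csinc.
exact: hol_inv.
Qed.

Lemma csincN w : csinc (- w) = csinc w.
Proof.
have e1 : Complex 0 d * - w = Complex 0 (- d) * w.
  by case: w => a b; apply/eqP; rewrite eq_complex /=; apply/andP; split; apply/eqP; ring.
have e2 : Complex 0 (- d) * - w = Complex 0 d * w.
  by case: w {e1} => a b; apply/eqP; rewrite eq_complex /=; apply/andP; split; apply/eqP; ring.
by rewrite /csinc e1 e2 mulrN invrN mulrN -mulNr opprB.
Qed.

(** Lets the reflection u -> -u turn the lower contour of the residue argument into an upper one. *)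
Lemma kernN w : kern (- w) = - kern w.
Proof. by rewrite /kern csincN invrN mulrN. Qed.

Lemma csinc_lim (e : R) : 0 < e -> exists2 r : R, 0 < r &
  forall w, w != 0 -> cmod w < r -> cmod (csinc w - 1) <= e.
Proof.
move=> e0; have [r r0 H] := cexp_eps e0; have d0 := kstep_gt0.
exists (r / d); first by rewrite divr_gt0.
move=> w w0; rewrite ltr_pdivlMr // => wr.
have nw : 0 < cmod w by rewrite cmod_gt0.
pose h1 : C := Complex 0 d * w; pose h2 : C := Complex 0 (- d) * w.
have c1 : cmod h1 = cmod w * d by rewrite cmodM cmod_imag gtr0_norm // mulrC.
have c2 : cmod h2 = cmod w * d by rewrite cmodM cmod_imag normrN gtr0_norm // mulrC.
have H1 := H h1; rewrite c1 in H1; have {}H1 := H1 wr.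
have H2 := H h2; rewrite c2 in H2; have {}H2 := H2 wr.
have h12 : h1 - h2 = Complex 0 (2 * d) * w.
  by rewrite /h1 /h2; case: (w) => a b; apply/eqP; rewrite eq_complex /=; apply/andP; split; apply/eqP; ring.
have D0 : h1 - h2 != 0 by rewrite h12 mulf_neq0 // i2d_neq0.
have -> : csinc w - 1 = ((cexp h1 - 1 - h1) - (cexp h2 - 1 - h2)) / (h1 - h2).
  by rewrite /csinc -h12 -/h1 -/h2; field; rewrite subr_eq0 in D0 *.
rewrite cmodM cmodV ler_pdivrMr ?cmod_gt0 //; apply: le_trans (cmodB _ _) _.
have d20 : 0 < 2 * d by apply: mulr_gt0.
rewrite h12 cmodM cmod_imag (gtr0_norm d20).
by apply: le_trans (lerD H1 H2) _; rewrite le_eqVlt; apply/orP; left; apply/eqP; ring.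
Qed.

Lemma kern_residue (e : R) : 0 < e -> exists2 r : R, 0 < r &
  forall w, w != 0 -> cmod w < r -> cmod (w * kern w - 1) <= e.
Proof.
move=> e0.
have hX : derivable (fun w : C => w ^+ N) 1 (1 : C).
  by apply: (@holX _ (fun w => w)); exact: hol_id.
have /ccontP/(_ _ e0) [s s0 Hs] := derivable_ccont hX.
have s20 : 0 < s / 2 by rewrite divr_gt0.
have [r r0 Hr] := csinc_lim s20.
exists r => // w w0 wr; rewrite /kern mulrCA divff // mulr1.
have : cmod (csinc w - 1) < s by apply: le_lt_trans (Hr _ w0 wr) _; lra.
by move/Hs; rewrite expr1n; exact: ltW.
Qed.

(** Each sine quotient is at most e^{d |Im w|} / (d |w|), and N d = pi. *)
Lemma kern_le w : w != 0 ->
  cmod (kern w) <= (d ^+ N)^-1 * expR (pi * `|complex.Im w|) / cmod w ^+ N.+1.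
Proof.
move=> w0; have nw : 0 < cmod w by rewrite cmod_gt0.
have d0 := kstep_gt0.
have hs : cmod (csinc w) <= expR (d * `|complex.Im w|) / (d * cmod w).
  have d20 : 0 < 2 * d by apply: mulr_gt0.
  rewrite /csinc cmodM cmodV cmodM cmod_imag (gtr0_norm d20).
  rewrite ler_pdivrMr; last by apply: mulr_gt0.
  have -> : expR (d * `|complex.Im w|) / (d * cmod w) * (2 * d * cmod w) =
      expR (d * `|complex.Im w|) + expR (d * `|complex.Im w|).
    by field; rewrite !gt_eqF.
  apply: le_trans (cmodB _ _) _; rewrite !cmod_cexp_i; apply: lerD; rewrite ler_expR.
    rewrite -mulrN ler_pM2l // -normrN; exact: ler_norm.
  by rewrite mulNr opprK ler_pM2l // ler_norm.
rewrite /kern cmodM cmodV cmodX exprS invfM mulrA.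
have -> : (d ^+ N)^-1 * expR (pi * `|complex.Im w|) / cmod w / cmod w ^+ N =
    (expR (d * `|complex.Im w|) / (d * cmod w)) ^+ N / cmod w.
  have aux (q E c : R) : q != 0 -> c != 0 ->
      (q ^+ N)^-1 * E ^+ N / c / c ^+ N = (E / (q * c)) ^+ N / c.
    by move=> q0 c0; rewrite expr_div_n exprMn; field; rewrite !expf_neq0 ?c0.
  rewrite -aux ?gt_eqF // -expRM_natl mulrA.
  by rewrite (_ : N%:R * d = pi) // /d mulrC divfK // pnatr_eq0 -lt0n.
rewrite ler_pM2r ?invr_gt0 //; apply: lerXn2r hs; rewrite nnegrE ?cmod_ge0 //.
by rewrite divr_ge0 ?expR_ge0 // mulr_ge0 // ltW.
Qed.

End Kernel.

(** * Improper integrals along lines, with explicit rates *)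

Section ImproperIntegral.
Variable R : realType.
Local Notation C := (cplx R).
Implicit Types (F G : R -> C) (l : C).

(** A bounded increasing function in the role of the arctangent: its unit increments dominate 1/(1 +
    x^2) up to the factor 4, so sums of such terms telescope. *)
Definition theta (x : R) : R := x / (1 + `|x|).

Lemma theta_step x : (1 + x ^+ 2)^-1 <= 4 * (theta (x + 1) - theta x).
Proof.
have q0 : 0 < 1 + x ^+ 2 by have := sqr_ge0 x; lra.
have aux (u : R) : 0 < u -> u <= 4 * (1 + x ^+ 2) -> (1 + x ^+ 2)^-1 <= 4 / u.
  by move=> u0 hu; rewrite ler_pdivlMr // mulrC ler_pdivrMr.
rewrite /theta; case: (lerP 0 x) => x0.
  have x10 : 0 <= x + 1 by lra.
  rewrite (ger0_norm x0) (ger0_norm x10).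
  have n1 : 1 + x != 0 by rewrite gt_eqF //; lra.
  have n2 : 1 + (x + 1) != 0 by rewrite gt_eqF //; lra.
  have -> : 4 * ((x + 1) / (1 + (x + 1)) - x / (1 + x)) = 4 / ((1 + x) * (1 + (x + 1))).
    by field; rewrite n1 n2.
  by apply: aux; nra.
case: (lerP (x + 1) 0) => x1.
  rewrite (ltr0_norm x0) (ler0_norm x1).
  have n1 : 1 - x != 0 by rewrite gt_eqF //; lra.
  have n2 : 1 - (x + 1) != 0 by rewrite gt_eqF //; lra.
  have -> : 4 * ((x + 1) / (1 - (x + 1)) - x / (1 - x)) = 4 / ((1 - (x + 1)) * (1 - x)).
    by field; rewrite n1 n2.
  by apply: aux; nra.
rewrite (ltr0_norm x0) (gtr0_norm x1).
apply: (@le_trans _ _ 1); first by rewrite invf_le1 //; have := sqr_ge0 x; lra.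
have n1 : 1 - x != 0 by rewrite gt_eqF //; lra.
have n2 : 1 + (x + 1) != 0 by rewrite gt_eqF //; lra.
have -> : 4 * ((x + 1) / (1 + (x + 1)) - x / (1 - x)) =
    4 * ((x + 1) * (1 - x) - x * (1 + (x + 1))) / ((1 + (x + 1)) * (1 - x)).
  by field; rewrite n1 n2.
by rewrite ler_pdivlMr; nra.
Qed.

Lemma theta_le1 x : `|theta x| <= 1.
Proof.
have h : 0 < 1 + `|x| by rewrite ltr_wpDr.
by rewrite /theta normrM normfV (gtr0_norm h) ler_pdivrMr // mul1r lerDr.
Qed.

Lemma sum_theta (a : R) n :
  \sum_(i < n) (1 + (a + i%:R) ^+ 2)^-1 <= 4 * (theta (a + n%:R) - theta a).
Proof.
elim: n => [|n IH]; first by rewrite big_ord0 addr0 subrr mulr0.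
rewrite big_ord_recr /= (_ : a + n.+1%:R = a + n%:R + 1); last by rewrite -natr1 addrA.
have := theta_step (a + n%:R); lra.
Qed.

Lemma sum_inv_sq (a : R) n : \sum_(i < n) (1 + (a + i%:R) ^+ 2)^-1 <= 8.
Proof.
apply: le_trans (sum_theta a n) _.
have := theta_le1 (a + n%:R); have := theta_le1 a; rewrite !ler_norml => /andP[? ?] /andP[? ?].
lra.
Qed.

Lemma rint_window n a (F : R -> R) (s : 'I_n -> R) : cont_on a (a + n%:R) F ->
  (forall (i : 'I_n) t, a + i%:R <= t <= a + i%:R + 1 -> F t <= s i) ->
  rint a (a + n%:R) F <= \sum_(i < n) s i.
Proof.
move=> cF H; rewrite -rint_unit_sum //; apply: ler_sum => i _.
have hi : (i%:R + 1 : R) <= n%:R by rewrite natr1 ler_nat.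
have i0 : (0 : R) <= i%:R by rewrite ler0n.
have -> : s i = rint (a + i%:R) (a + i%:R + 1) (fun _ => s i).
  by rewrite rint_cst; [ring|lra].
apply: rint_le; [|exact: cont_on_cst|exact: H].
by apply: cont_on_sub cF; clear -hi i0; lra.
Qed.

Lemma cint_window n a F (s : 'I_n -> R) : cont_on a (a + n%:R) F ->
  (forall (i : 'I_n) t, a + i%:R <= t <= a + i%:R + 1 -> cmod (F t) <= s i) ->
  cmod (cint a (a + n%:R) F) <= 2 * \sum_(i < n) s i.
Proof.
move=> cF H; have H1 := cint_le_rint cF; apply: (le_trans H1); rewrite ler_pM2l //.
by apply: rint_window H; exact: cont_on_cmod.
Qed.

Lemma inv_sq_window (c a t : R) : a <= t <= a + 1 ->
  (1 + (t - c) ^+ 2)^-1 <= 3 * (1 + (a - c) ^+ 2)^-1.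
Proof.
move=> /andP[t1 t2]; have h1 := sqr_ge0 (t - c); have h2 := sqr_ge0 (a - c).
have q1 : 0 < 1 + (t - c) ^+ 2 by clear -h1; lra.
have q2 : 0 < 1 + (a - c) ^+ 2 by clear -h2; lra.
rewrite ler_pdivlMr // mulrC ler_pdivrMr //.
have h3 := sqr_ge0 (t - c + (t - a)).
have h4 : (t - a) ^+ 2 <= 1 by clear -t1 t2; nra.
have -> : (a - c) ^+ 2 = 2 * (t - c) ^+ 2 + 2 * (t - a) ^+ 2 - (t - c + (t - a)) ^+ 2 by ring.
clear -h1 h3 h4; lra.
Qed.

Lemma cont_inv_sq (c a b : R) : cont_on a b (fun t => (1 + (t - c) ^+ 2)^-1 : R).
Proof.
move=> x _; apply: cvgV.
  by rewrite gt_eqF //; have := sqr_ge0 (x - c); lra.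
apply: cvgD; first exact: cvg_cst.
by apply: cvgM; (apply: cvgB; [exact: cvg_id|exact: cvg_cst]).
Qed.

Lemma rint_inv_sq (a c : R) n :
  rint a (a + n%:R) (fun t => (1 + (t - c) ^+ 2)^-1) <= 24.
Proof.
have H := @rint_window n a (fun t => (1 + (t - c) ^+ 2)^-1)
  (fun i => 3 * (1 + (a - c + i%:R) ^+ 2)^-1) (@cont_inv_sq c _ _).
apply: (@le_trans _ _ (\sum_(i < n) 3 * (1 + (a - c + i%:R) ^+ 2)^-1)).
  apply: H => i t /inv_sq_window; rewrite addrAC; exact.
have h := sum_inv_sq (a - c) n; rewrite -mulr_sumr; clear -h; lra.
Qed.

(** The limit is the supremum of the lower ends u n - b n, which all lie below every u m + b m; the
    rate [b] passes to it directly. *)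
Lemma cauchy_limit (u : nat -> R) (b : nat -> R) :
  (forall n m, (n <= m)%N -> `|u n - u m| <= b n) ->
  exists l : R, forall n, `|u n - l| <= b n.
Proof.
move=> H.
have H' n m : u n - b n <= u m + b m.
  have := H _ _ (leq_maxl n m); have := H _ _ (leq_maxr n m).
  by rewrite !ler_norml => /andP[? ?] /andP[? ?]; lra.
pose S := [set u n - b n | n in [set: nat]].
have hS : has_sup S.
  split; first by exists (u 0%N - b 0%N), 0%N.
  by exists (u 0%N + b 0%N) => _ [n _ <-].
exists (sup S) => n.
have h1 : u n - b n <= sup S by apply: sup_upper_bound => //; exists n.
have h2 : sup S <= u n + b n by apply: ge_sup; [case: hS|move=> _ [m _ <-]].
by rewrite ler_norml; apply/andP; split; lra.
Qed.

Lemma ccauchy_limit (u : nat -> C) (b : nat -> R) :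
  (forall n m, (n <= m)%N -> cmod (u n - u m) <= b n) ->
  exists l : C, forall n, cmod (u n - l) <= 2 * b n.
Proof.
move=> H.
have [|x Hx] := @cauchy_limit (fun n => complex.Re (u n)) b.
  by move=> n m nm; apply: le_trans (H n m nm); rewrite -ReN -ReD Re_le_cmod.
have [|y Hy] := @cauchy_limit (fun n => complex.Im (u n)) b.
  by move=> n m nm; apply: le_trans (H n m nm); rewrite -ImN -ImD Im_le_cmod.
exists (Complex x y) => n; have h1 := Hx n; have h2 := Hy n.
have h3 := cmod_le_ReIm (u n - Complex x y).
rewrite ReD ImD ReN ImN /= in h3; clear -h1 h2 h3; lra.
Qed.

(** Symmetric cut-offs at integers only, which fit unit intervals; the integrands in use are
    dominated by A / (1 + t^2). *)
Definition is_imp F l := forall e : R, 0 < e -> exists n0 : nat, forall n : nat,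
  (n0 <= n)%N -> cmod (cint (- n%:R) n%:R F - l) <= e.

Lemma is_imp_unique F l l' : is_imp F l -> is_imp F l' -> l = l'.
Proof.
move=> H H'; apply/eqP; rewrite -subr_eq0 -cmod_eq0; apply/eqP/le_anti.
rewrite cmod_ge0 andbT; apply/ler_addgt0Pr => e e0; rewrite add0r.
have e20 : 0 < e / 2 by rewrite divr_gt0.
have [n0 h0] := H _ e20; have [n1 h1] := H' _ e20.
have := h0 _ (leq_maxl n0 n1); have := h1 _ (leq_maxr n0 n1).
set v := cint _ _ _ => h2 h3; have -> : l - l' = (v - l') - (v - l) by ring.
have := cmodB (v - l') (v - l); clear -h2 h3; lra.
Qed.

(** Equal to the default 0 when there is no limit, so that the operator is defined on all
    functions. *)
Definition cimp F : C := xget 0 (is_imp F).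

Lemma cimpE F l : is_imp F l -> cimp F = l.
Proof. move=> Hl; apply: is_imp_unique (Hl); exact: xgetPex (ex_intro _ l Hl). Qed.

Definition cont_all F := forall t, {for t, continuous F}.

Lemma cont_all_on F a b : cont_all F -> cont_on a b F.
Proof. by move=> cF t _; exact: cF. Qed.

Lemma is_impD F G l l' : cont_all F -> cont_all G -> is_imp F l -> is_imp G l' ->
  is_imp (fun t => F t + G t) (l + l').
Proof.
move=> cF cG H H' e e0; have e20 : 0 < e / 2 by rewrite divr_gt0.
have [n0 h0] := H _ e20; have [n1 h1] := H' _ e20; exists (maxn n0 n1) => n.
rewrite geq_max => /andP[/h0 k0 /h1 k1].
rewrite cintD; [|exact: cont_all_on..].
rewrite (_ : _ - _ = (cint (- n%:R) n%:R F - l) + (cint (- n%:R) n%:R G - l')); last by ring.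
have := cmodD (cint (- n%:R) n%:R F - l) (cint (- n%:R) n%:R G - l').
by clear -k0 k1; lra.
Qed.

Lemma is_impZ F l (k : C) : cont_all F -> is_imp F l -> is_imp (fun t => k * F t) (k * l).
Proof.
move=> cF H e e0; have k0 : 0 < 1 + cmod k by rewrite ltr_wpDr ?cmod_ge0.
have e20 : 0 < e / (1 + cmod k) by rewrite divr_gt0.
have [n0 h0] := H _ e20; exists n0 => n /h0 h.
rewrite cintZ; last exact: cont_all_on.
rewrite -mulrBr cmodM; move: h; rewrite ler_pdivlMr // => h; apply: le_trans h.
by rewrite mulrC ler_wpM2l ?cmod_ge0 // lerDr.
Qed.

(** The sum over unit intervals telescopes to theta(m) - theta(n), and 1 - theta(n) = 1/(n + 1). *)
Lemma tail_le F (A : R) n m : (n <= m)%N -> cont_all F ->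
  (forall t, cmod (F t) <= A / (1 + t ^+ 2)) ->
  cmod (cint n%:R m%:R F) <= 8 * A / n.+1%:R.
Proof.
move=> nm cF HF; have A0 : 0 <= A.
  by have := HF 0; rewrite expr0n /= addr0 divr1; apply: le_trans; exact: cmod_ge0.
have em : m%:R = n%:R + (m - n)%:R :> R by rewrite -natrD subnKC.
rewrite em.
have H := @cint_window (m - n) n%:R F (fun i => A * (1 + (n%:R + i%:R) ^+ 2)^-1)
  (cont_all_on cF).
apply: (le_trans (H _)).
  move=> i t /andP[t1 _]; apply: (le_trans (HF t)); apply: ler_wpM2l => //.
  have i0 : (0 : R) <= i%:R by rewrite ler0n.
  have n0 : (0 : R) <= n%:R by rewrite ler0n.
  have h2 := sqr_ge0 (n%:R + i%:R : R).
  rewrite lef_pV2 ?posrE; [|clear -h2; nra..].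
  by rewrite lerD2l lerXn2r // nnegrE; clear -i0 n0 t1; lra.
rewrite -mulr_sumr; have h := sum_theta n%:R (m - n).
have h1 := theta_le1 (n%:R + (m - n)%:R); rewrite ler_norml in h1.
have h2 : theta n%:R = 1 - n.+1%:R^-1 :> R.
  by rewrite /theta normr_nat nat1r -natr1; field; rewrite natr1 pnatr_eq0.
set S := \sum_(i < _) _ in h *; set q := n.+1%:R^-1 in h2 *.
have h3 : S <= 4 * q by case/andP: h1 => _ h1; rewrite h2 in h; clear -h h1; lra.
have h4 := ler_wpM2l A0 h3; clear -h4; lra.
Qed.

(** The explicit rate matters: the L^p estimate of the operator truncates the integral uniformly for
    x in a segment. *)
Lemma imp_exists F (A : R) : cont_all F -> (forall t, cmod (F t) <= A / (1 + t ^+ 2)) ->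
  exists2 l, is_imp F l & forall n : nat, cmod (cint (- n%:R) n%:R F - l) <= 32 * A / n.+1%:R.
Proof.
move=> cF HF; have A0 : 0 <= A.
  by have := HF 0; rewrite expr0n /= addr0 divr1; apply: le_trans; exact: cmod_ge0.
have cF' : cont_all (fun t => F (- t)).
  move=> t; apply/rcontP => e e0; have /rcontP/(_ e e0) [r r0 Hr] := cF (- t).
  by exists r => // y hy; apply: Hr; rewrite -opprD normrN.
have HF' t : cmod (F (- t)) <= A / (1 + t ^+ 2) by rewrite -[t in X in _ <= X]opprK sqrrN.
have Hnm n m : (n <= m)%N ->
    cmod (cint (- n%:R) n%:R F - cint (- m%:R) m%:R F) <= 16 * A / n.+1%:R.
  move=> nm; have nmR : (n%:R : R) <= m%:R by rewrite ler_nat.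
  have n0 : (0 : R) <= n%:R by rewrite ler0n.
  rewrite (@cint_split R (- m%:R) (- n%:R) m%:R F); [|clear -nmR n0; lra|clear -nmR n0; lra|exact: cont_all_on].
  rewrite (@cint_split R (- n%:R) n%:R m%:R F); [|clear -nmR n0; lra|exact: nmR|exact: cont_all_on].
  rewrite (@cint_opp R n%:R m%:R F nmR); last exact: cont_all_on.
  have h1 := tail_le nm cF HF; have h2 := tail_le nm cF' HF'.
  set u := cint _ _ _ in h2 *; set v := cint n%:R _ _ in h1 *.
  set w := cint _ _ _; have -> : w - (u + (w + v)) = - (u + v) by ring.
  rewrite cmodN; have h3 := cmodD u v; rewrite -[16 * A / _]mulrA; rewrite -mulrA in h1; rewrite -mulrA in h2.
  by move: (A / _) h1 h2 => q h1 h2; clear -h1 h2 h3; lra.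
have [l Hl] := ccauchy_limit Hnm.
have Hl' n : cmod (cint (- n%:R) n%:R F - l) <= 32 * A / n.+1%:R.
  by have := Hl n; rewrite !mulrA -[2 * 16]natrM.
exists l => // e e0; exists (Num.Def.truncn (32 * A / e)) => n hn; apply: (le_trans (Hl' n)).
rewrite ler_pdivrMr ?ltr0n // [e * _]mulrC -ler_pdivrMr //.
have h1 : 32 * A / e < (Num.Def.truncn (32 * A / e)).+1%:R by exact: truncnS_gt.
by apply: (le_trans (ltW h1)); rewrite ler_nat.
Qed.

(** The majorant may be centred anywhere and the constant does not see the centre; this gives bounds
    on the operator that are uniform in Re z. *)
Lemma imp_le F (A x : R) l : cont_all F -> (forall t, cmod (F t) <= A / (1 + (t - x) ^+ 2)) ->
  is_imp F l -> cmod l <= 48 * A.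
Proof.
move=> cF HF Hl; apply/ler_addgt0Pr => e e0; have [n Hn] := Hl e e0.
have {}Hn := Hn n (leqnn n).
have A0 : 0 <= A.
  by have := HF x; rewrite subrr expr0n /= addr0 divr1; apply: le_trans; exact: cmod_ge0.
have h1 : cmod (cint (- n%:R) n%:R F) <= 48 * A.
  have := cint_le_rint (cont_all_on (a := - n%:R) (b := n%:R) cF) => h; apply: (le_trans h).
  have en : n%:R = - n%:R + (n + n)%:R :> R by rewrite natrD addKr.
  have h2 := rint_inv_sq (- n%:R) x (n + n); rewrite -en in h2.
  have h3 : rint (- n%:R) n%:R (fun t => cmod (F t)) <=
      rint (- n%:R) n%:R (fun t => A * (1 + (t - x) ^+ 2)^-1).
    apply: rint_le; [exact/cont_on_cmod/cont_all_on| |by move=> t _; exact: HF].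
    by apply: cont_onM; [exact: cont_on_cst|exact: cont_inv_sq].
  have h4 := rintZ A (@cont_inv_sq x (- n%:R) n%:R).
  rewrite h4 in h3; have h5 := ler_wpM2l A0 h2; clear -h3 h5; lra.
have := cmod_distl l (cint (- n%:R) n%:R F); rewrite cmodBC.
have := Hn; clear -h1; lra.
Qed.

(* The vertical sides of [-n, n] x [c, d] contribute nothing in the limit. *)
Lemma imp_rect (Phi : C -> C) (c d A X0 : R) (r l l' : C) : c <= d ->
  (forall x y, X0 <= `|x| -> c <= y <= d -> {for (Complex x y : C), continuous Phi}) ->
  (forall x y, X0 <= `|x| -> c <= y <= d -> cmod (Phi (Complex x y)) <= A / (1 + x ^+ 2)) ->
  (forall n : nat, X0 <= n%:R -> rect_int (- n%:R) n%:R c d Phi = r) ->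
  is_imp (fun t => Phi (Complex t c)) l -> is_imp (fun t => Phi (Complex t d)) l' ->
  l - l' = r.
Proof.
move=> cd cP HP Hr Hl Hl'; apply/eqP; rewrite -subr_eq0 -cmod_eq0; apply/eqP/le_anti.
rewrite cmod_ge0 andbT; apply/ler_addgt0Pr => e e0; rewrite add0r.
have e30 : 0 < e / 3 by rewrite divr_gt0.
have [n0 h0] := Hl _ e30; have [n1 h1] := Hl' _ e30.
pose B := 4 * `|A| * (d - c).
have B0 : 0 <= B by rewrite mulr_ge0 ?mulr_ge0 // subr_ge0.
pose n2 := (Num.Def.truncn `|X0|).+1; pose n3 := (Num.Def.truncn (B / (e / 3))).+1.
pose n := maxn (maxn n0 n1) (maxn n2 n3).
have hn0 : (n0 <= n)%N by rewrite !leq_max leqnn.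
have hn1 : (n1 <= n)%N by rewrite !leq_max leqnn orbT.
have hn2 : X0 <= n%:R.
  apply: le_trans (ler_norm _) _; apply: (le_trans (ltW (truncnS_gt _))).
  by rewrite ler_nat -/n2 !leq_max leqnn !orbT.
have hn3 : B / (e / 3) <= n%:R.
  apply: (le_trans (ltW (truncnS_gt _))).
  by rewrite ler_nat -/n3 !leq_max leqnn !orbT.
have npos : 0 < n%:R :> R by rewrite ltr0n !leq_max !orbT.
have k0 := h0 _ hn0; have k1 := h1 _ hn1; have kr := Hr _ hn2.
have hs (x : R) : `|x| = n%:R -> cmod (cint c d (fun t => Phi (Complex x t))) <= B / (2 * n%:R).
  move=> hx; have hX : X0 <= `|x| by rewrite hx.
  have x2 : x ^+ 2 = n%:R ^+ 2 by rewrite -hx real_normK ?num_real.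
  have H := @cint_le R c d (`|A| / n%:R) (fun t => Phi (Complex x t)) cd.
  apply: (le_trans (H _ _)).
  - by apply: (@cont_vert R c d x Phi) => y hy; exact: cP.
  - move=> y hy; apply: (le_trans (HP _ _ hX hy)).
    apply: (@le_trans _ _ (`|A| / (1 + x ^+ 2))).
      by apply: ler_wpM2r (ler_norm _); rewrite invr_ge0 addr_ge0 ?sqr_ge0.
    apply: ler_wpM2l => //; have p1 := sqr_ge0 (n%:R - 1 : R).
    rewrite lef_pV2 ?posrE ?x2; clear -p1 npos; nra.
  - by rewrite /B le_eqVlt; apply/orP; left; apply/eqP; field; rewrite gt_eqF.
have hR := hs n%:R (normr_nat _ _); have hL := hs (- n%:R) (etrans (normrN _) (normr_nat _ _)).
move: kr; rewrite /rect_int.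
set u := cint (- _) _ _ in k0 *; set v := cint (- _) _ _ in k1 *.
set s1 := cint c d _ in hR *; set s2 := cint c d _ in hL * => <-.
have -> : l - l' - (u - v + Complex 0 1 * (s1 - s2)) =
  - (u - l) + (v - l') - Complex 0 1 * (s1 - s2) by ring.
have i1 := cmodB (- (u - l) + (v - l')) (Complex 0 1 * (s1 - s2)).
have i2 := cmodD (- (u - l)) (v - l'); have i3 := cmodB s1 s2.
rewrite cmodN in i2; rewrite cmodM cmod_i mul1r in i1.
have i4 : B / (2 * n%:R) + B / (2 * n%:R) <= e / 3.
  have -> : B / (2 * n%:R) + B / (2 * n%:R) = B / n%:R by field; rewrite gt_eqF.
  by rewrite ler_pdivrMr // mulrC -ler_pdivrMr.
clear -i1 i2 i3 i4 hR hL k0 k1; lra.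
Qed.

(** A Cauchy criterion for difference quotients: the derivative arises as the limit along h = r / (n
    + 2) and need not be named beforehand. *)
Lemma derivable_of_quotients (f : C -> C) z (r B : R) : 0 < r ->
  (forall h h', h != 0 -> h' != 0 -> cmod h < r -> cmod h' < r ->
     cmod ((f (z + h) - f z) / h - (f (z + h') - f z) / h') <= B * (cmod h + cmod h')) ->
  derivable f z (1 : C).
Proof.
move=> r0 H; pose Q h := (f (z + h) - f z) / h.
pose hn (n : nat) : C := (r / n.+2%:R)%:C.
have hn_c n : cmod (hn n) = r / n.+2%:R by rewrite cmod_real gtr0_norm // divr_gt0.
have hn0 n : hn n != 0 by rewrite -cmod_gt0 hn_c divr_gt0.
have hnr n : cmod (hn n) < r.
  by rewrite hn_c ltr_pdivrMr // ltr_pMr // ltr1n.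
have B0 : 0 <= B.
  have := H _ _ (hn0 0%N) (hn0 0%N) (hnr 0%N) (hnr 0%N).
  rewrite subrr cmod0 pmulr_lge0 // addr_gt0 // cmod_gt0 //.
have hmn n m : (n <= m)%N -> cmod (hn m) <= cmod (hn n).
  by move=> nm; rewrite !hn_c ler_pM2l // lef_pV2 ?posrE // ler_nat.
have [|l Hl] := @ccauchy_limit (fun n => Q (hn n)) (fun n => 2 * B * cmod (hn n)).
  move=> n m nm; apply: (le_trans (H _ _ (hn0 n) (hn0 m) (hnr n) (hnr m))).
  have k := ler_wpM2l B0 (hmn n m nm); clear -k; lra.
have HQ h : h != 0 -> cmod h < r -> cmod (Q h - l) <= 6 * B * cmod h.
  move=> h0 hr; have ch : 0 < cmod h by rewrite cmod_gt0.
  pose n := Num.Def.truncn (r / cmod h).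
  have k : cmod (hn n) <= cmod h.
    rewrite hn_c ler_pdivrMr // mulrC -ler_pdivrMr //; apply: (le_trans (ltW (truncnS_gt _))).
    by rewrite ler_nat.
  have k1 := H _ _ h0 (hn0 n) hr (hnr n); have k2 := Hl n.
  have k3 := ler_wpM2l B0 k.
  rewrite -/(Q h) -/(Q (hn n)) in k1.
  have -> : Q h - l = (Q h - Q (hn n)) + (Q (hn n) - l) by ring.
  have := cmodD (Q h - Q (hn n)) (Q (hn n) - l); clear -k1 k2 k3; lra.
apply/derivableE; exists l => e e0.
have B1 : 0 < 6 * B + 1 by clear -B0; lra.
exists (Num.min r (e / (6 * B + 1))); first by rewrite lt_min r0 divr_gt0.
move=> h; rewrite lt_min => /andP[hr he].
have [->|h0] := eqVneq h 0; first by rewrite addr0 subrr mulr0 subr0 cmod0 mulr0.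
have -> : f (z + h) - f z - l * h = (Q h - l) * h by rewrite /Q; field.
rewrite cmodM ler_wpM2r ?cmod_ge0 //; apply: (le_trans (HQ h h0 hr)).
move: he; rewrite ltr_pdivlMr // => he; have := cmod_ge0 h; clear -he B0; nra.
Qed.

End ImproperIntegral.

(** * Auxiliary estimates for the operator *)

Section Preliminaries.
Variable R : realType.
Local Notation C := (cplx R).

Lemma inv_sq_recenter (x t : R) :
  (1 + (t - x) ^+ 2)^-1 <= 2 * (1 + x ^+ 2) * (1 + t ^+ 2)^-1.
Proof.
have h1 := sqr_ge0 (t - x); have h2 := sqr_ge0 t; have h3 := sqr_ge0 x.
rewrite ler_pdivlMr; last by clear -h2; lra.
rewrite mulrC ler_pdivrMr; last by clear -h1; lra.
have h4 := sqr_ge0 (t - 2 * x); have h5 := mulr_ge0 h3 h1.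
by clear -h1 h2 h3 h4 h5; nra.
Qed.


Lemma c0_cancel (v : C) (A : R) : cmod (- c0 R * v) <= A -> cmod v <= A / 4.
Proof.
rewrite cmodM cmodN ler_pdivlMr // mulrC => H; apply: le_trans H.
by apply: ler_wpM2l; [exact: cmod_ge0|exact: c0_ge].
Qed.


Lemma inv_sq_near (a b : R) : - 2 <= b - a -> b - a <= 2 ->
  (1 + b ^+ 2)^-1 <= 9 * (1 + a ^+ 2)^-1.
Proof.
move=> r1 r2; have s1 := sqr_ge0 b; have s2 := sqr_ge0 a.
rewrite ler_pdivlMr; last by clear -s2; lra.
rewrite mulrC ler_pdivrMr; last by clear -s1; lra.
have := sqr_ge0 (b + (b - a)); have : (b - a) ^+ 2 <= 4 by clear -r1 r2; nra.
have -> : a ^+ 2 = 2 * b ^+ 2 + 2 * (b - a) ^+ 2 - (b + (b - a)) ^+ 2 by ring.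
by move: (_ ^+ 2) (_ ^+ 2) => q q'; clear -s1; lra.
Qed.

Lemma Im_lt_max (z : C) : 3 <= 3 + Num.max 0 (complex.Im z) /\
  complex.Im z + 1 <= 3 + Num.max 0 (complex.Im z).
Proof.
split; first by rewrite lerDl le_max lexx.
have : complex.Im z <= Num.max 0 (complex.Im z) by rewrite le_max lexx orbT.
lra.
Qed.

Lemma cont_allZ (F : R -> C) (a : C) : cont_all F -> cont_all (fun t => a * F t).
Proof.
move=> cF t; have tt : t <= t <= t by rewrite lexx.
exact: (@cont_onMC R t t (fun _ => a) F (@cont_on_cst R _ t t a) (cont_all_on cF) t tt).
Qed.

Lemma is_imp_opp (F : R -> C) l : cont_all F -> is_imp F l -> is_imp (fun t => F (- t)) l.
Proof.
move=> cF H e e0; have [n0 Hn] := H e e0; exists n0 => n /Hn.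
have n1 : - n%:R <= n%:R :> R by have : (0 : R) <= n%:R by []; lra.
have := @cint_opp R (- n%:R) n%:R F n1; rewrite opprK => ->; first exact.
exact: cont_all_on.
Qed.

Lemma rint_empty (a b : R) (F : R -> R) : b < a -> rint a b F = 0.
Proof. by move=> ba; rewrite /rint set_itv_ge ?Rintegral_set0 // bnd_simp -ltNge. Qed.

Lemma hol_opp (f : C -> C) z : (forall w, derivable f w (1 : C)) ->
  derivable (fun w => f (- w)) z (1 : C).
Proof.
move=> hf; apply: (@hol_comp R f (fun w => - w)); last exact: hf.
by apply: holN; exact: hol_id.
Qed.

Lemma bound_aux (a b c d e : R) : a <= b + c -> 4 * d <= a -> 0 <= d -> b <= e -> d <= c + e.
Proof. lra. Qed.

Lemma cancel_factor (c a b d : C) : c != 0 -> c * a - - c * b = c * d -> b + a = d.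
Proof. by move=> c_neq0 e; apply: (mulfI c_neq0); rewrite -e; ring. Qed.

End Preliminaries.

(** * The operator T: holomorphy, growth, L^p bound, reproduction *)

Section Operator.
Variable R : realType.
Local Notation C := (cplx R).
Implicit Types (f g : C -> C) (z w h u : C) (M y : R).
Variables (p K : R) (N : nat).
Hypotheses (p0 : 0 < p) (p1 : p < 1) (N0 : (0 < N)%N) (hN : 2 <= N.+1%:R * p).
Hypothesis K0 : 0 < K.
Hypothesis HK : forall g y0 M, (forall z, y0 - 2 <= complex.Im z <= y0 + 2 -> derivable g z (1 : C)) ->
  (forall y a b, y0 - 1 <= y <= y0 + 1 ->
     rint a b (fun x => cmod (g (Complex x y)) `^ p) <= M) ->
  forall a n (x : 'I_n -> R), (forall i : 'I_n, a + i%:R <= x i <= a + i%:R + 1) ->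
    \sum_(i < n) cmod (g (Complex (x i) y0)) `^ p <= K * M.

Local Notation k := (kern N).
Let dK : R := (kstep R N ^+ N)^-1.

Lemma dK_gt0 : 0 < dK.
Proof. by rewrite invr_gt0 exprn_gt0 // kstep_gt0. Qed.

(** This is where (N + 1) p >= 2 enters: |w|^{N+1} dominates (1 + x^2)^{1/p}, with x = Re w, so the
    p-th power of the kernel is summable over unit intervals. *)
Lemma kern_pow w : 1 <= complex.Im w -> cmod (k w) <=
  dK * expR (pi * complex.Im w) * ((1 + complex.Re w ^+ 2)^-1) `^ p^-1.
Proof.
move=> w1; have nI := ger0_norm (le_trans ler01 w1).
have cw : 1 <= cmod w by have := Im_le_cmod w; rewrite nI; apply: le_trans.
have w0 : w != 0 by rewrite -cmod_gt0; apply: lt_le_trans cw.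
have := kern_le N0 w0; rewrite nI -/dK => H; apply: (le_trans H).
apply: ler_wpM2l; first by apply: mulr_ge0; [exact: ltW dK_gt0|exact: expR_ge0].
set q := 1 + _; have q0 : 0 < q by rewrite ltr_wpDr ?sqr_ge0.
have qw : q <= cmod w ^+ 2.
  rewrite cmod_sqr /q addrC lerD2l -[X in X <= _](expr1n _ 2); apply: (lerXn2r 2 _ _ w1); rewrite nnegrE //.
  exact: le_trans ler01 w1.
have qs : q^-1 `^ p^-1 = (q `^ p^-1)^-1.
  have qp : 0 < q `^ p^-1 by rewrite powR_gt0.
  apply: (mulIf (lt0r_neq0 qp)); rewrite mulVf ?lt0r_neq0 // -powRM ?invr_ge0 ?ltW //.
  by rewrite mulVf ?lt0r_neq0 // powR1.
rewrite qs lef_pV2 ?posrE ?powR_gt0 ?exprn_gt0 ?cmod_gt0 //.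
have ip : 0 <= p^-1 by rewrite invr_ge0 ltW.
apply: (le_trans (powR_le ip (ltW q0) qw)).
rewrite -!powR_mulrn ?cmod_ge0 // -powRrM; apply: ler_powR => //.
by rewrite ler_pdivrMr.
Qed.

Lemma kern_sq w : 1 <= complex.Im w -> cmod (k w) <=
  dK * expR (pi * complex.Im w) / (1 + complex.Re w ^+ 2).
Proof.
move=> w1; apply: (le_trans (kern_pow w1)).
apply: ler_wpM2l; first by apply: mulr_ge0; [exact: ltW dK_gt0|exact: expR_ge0].
set q := 1 + _; have q1 : 1 <= q by rewrite lerDl sqr_ge0.
have q0 : 0 < q by exact: lt_le_trans q1.
have ip : 1 <= p^-1 by rewrite invf_ge1 // ltW.
have iq : 0 <= q^-1 by rewrite invr_ge0 ltW.
by apply: ge1r_powR => //; rewrite invr_gt0 q0 invf_le1.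
Qed.

Definition Phi g z u : C := cexp (Complex 0 (- pi) * u) * g u * k (u - z).

(** Membership in the Hardy space of the upper half-plane, with p-th power of the norm at most [M],
    phrased by truncated real integrals. *)
Definition hcls M g := (forall z, 0 < complex.Im z -> derivable g z (1 : C)) /\
  (forall a b y, 0 < y -> rint a b (fun x => cmod (g (Complex x y)) `^ p) <= M).

(** The line depends on z. It runs at height at least 3, so that the strips in [HK] stay in the
    half-plane, and at least 3 above z; following z upwards is what yields type pi in
    [cauchyT_growth]. *)
Definition cauchyT g z : C :=
  - (c0 R)^-1 * cimp (fun t => Phi g z (Complex t (3 + Num.max 0 (complex.Im z)))).

Lemma hol_Phi g z u : derivable g u (1 : C) -> u != z -> derivable (Phi g z) u (1 : C).
Proof.
move=> hg uz; apply: holM; first by apply: holM; [exact: hol_cexp_i|exact: hg].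
apply: (@hol_shift R k (- z)); by apply: (hol_kern N0); rewrite subr_eq0.
Qed.

(** The sampling inequality [HK] with a single sample point. *)
Lemma hcls_bound M g z : hcls M g -> 3 <= complex.Im z ->
  cmod (g z) <= (K * M) `^ p^-1.
Proof.
move=> [hg HM] z3.
have H := HK (y0 := complex.Im z) (M := M) (g := g) _ _ (a := complex.Re z) (n := 1) (x := fun _ => complex.Re z).
have {}H : \sum_(i < 1) cmod (g (Complex (complex.Re z) (complex.Im z))) `^ p <= K * M.
  apply: H => [u /andP[u1 _]|y a b /andP[y1 _]|i].
  - by apply: hg; lra.
  - by apply: HM; lra.
  - by rewrite (ord1 i) addr0 lexx lerDl ler01.
move: H; rewrite big_ord1 Complex_Re_Im => H.
have ip : 0 <= p^-1 by rewrite invr_ge0 ltW.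
have H1 := powR_le ip (powR_ge0 _ _) H.
by rewrite -powRrM mulfV ?lt0r_neq0 // powRr1 ?cmod_ge0 in H1.
Qed.

Lemma cmod_Phi g z u : cmod (Phi g z u) =
  expR (pi * complex.Im u) * cmod (g u) * cmod (k (u - z)).
Proof. by rewrite /Phi !cmodM cmod_cexp_i mulNr opprK. Qed.

(** The product of the bounds for the exponential, for [g] and for the kernel on the line of height
    [eta]. *)
Definition Phi_cst (eta M : R) z : R :=
  expR (pi * eta) * (K * M) `^ p^-1 * (dK * expR (pi * (eta - complex.Im z))).

Lemma Phi_cst_ge0 eta M z : 0 <= Phi_cst eta M z.
Proof.
apply: mulr_ge0; first by apply: mulr_ge0; [exact: expR_ge0|exact: powR_ge0].
by apply: mulr_ge0; [exact: ltW dK_gt0|exact: expR_ge0].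
Qed.

Lemma Phi_le g M z t eta : hcls M g -> 3 <= eta -> complex.Im z + 1 <= eta ->
  cmod (Phi g z (Complex t eta)) <= Phi_cst eta M z / (1 + (t - complex.Re z) ^+ 2).
Proof.
move=> hg e3 ez; rewrite cmod_Phi /Phi_cst /= -!mulrA.
rewrite ler_pM2l ?expR_gt0 //; apply: ler_pM; rewrite ?cmod_ge0 //.
  exact: hcls_bound hg _.
have e1 : complex.Re (Complex t eta - z) = t - complex.Re z by rewrite ReD ReN.
have e2 : complex.Im (Complex t eta - z) = eta - complex.Im z by rewrite ImD ImN.
have := @kern_sq (Complex t eta - z); rewrite e1 e2 -mulrA; apply.
by lra.
Qed.

Lemma Phi_le0 g M z t eta : hcls M g -> 3 <= eta -> complex.Im z + 1 <= eta ->
  cmod (Phi g z (Complex t eta)) <=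
  Phi_cst eta M z * (2 * (1 + complex.Re z ^+ 2)) / (1 + t ^+ 2).
Proof.
move=> hg e3 ez; apply: (le_trans (Phi_le t hg e3 ez)); rewrite -mulrA.
apply: ler_wpM2l; [exact: Phi_cst_ge0|exact: inv_sq_recenter].
Qed.

Lemma cont_Phi g M z eta : hcls M g -> 3 <= eta -> complex.Im z + 1 <= eta ->
  cont_all (fun t => Phi g z (Complex t eta)).
Proof.
move=> [hg _] e3 ez t; apply: (@cont_horiz R t t eta (Phi g z)); last by rewrite lexx.
move=> x _; apply: derivable_ccont; apply: hol_Phi.
  by apply: hg => /=; lra.
by apply/eqP => e; move: ez; rewrite -e /=; lra.
Qed.

(** Any admissible line computes [cauchyT]: between two such lines the integrand is holomorphic,
    Goursat gives 0 on [-n, n], and the vertical sides vanish in the limit. The second half records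
    the truncation rate. *)
Lemma cauchyT_imp g M z eta : hcls M g -> 3 <= eta -> complex.Im z + 1 <= eta ->
  is_imp (fun t => Phi g z (Complex t eta)) (- c0 R * cauchyT g z) /\
  forall n : nat, cmod (cint (- n%:R) n%:R (fun t => Phi g z (Complex t eta)) + c0 R * cauchyT g z)
    <= 32 * (Phi_cst eta M z * (2 * (1 + complex.Re z ^+ 2))) / n.+1%:R.
Proof.
move=> hg e3 ez; set e0 := 3 + Num.max 0 (complex.Im z).
have [e03 e0z] := Im_lt_max z; rewrite -/e0 in e03 e0z.
have [l Hl Hln] := imp_exists (cont_Phi hg e3 ez) (fun t => Phi_le0 t hg e3 ez).
have [l' Hl' _] := imp_exists (cont_Phi hg e03 e0z) (fun t => Phi_le0 t hg e03 e0z).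
suff e : l = l'.
  have -> : c0 R * cauchyT g z = - l.
    by rewrite /cauchyT -/e0 (cimpE Hl') e mulrA mulrN mulfV ?c0_neq0 // mulN1r.
  have -> : - c0 R * cauchyT g z = l.
    by rewrite /cauchyT -/e0 (cimpE Hl') e mulrA mulrNN mulfV ?c0_neq0 // mul1r.
  by split.
suff main (c d l1 l2 : R) (L1 L2 : C) : c <= d -> 3 <= c -> complex.Im z + 1 <= c ->
    is_imp (fun t => Phi g z (Complex t c)) L1 -> is_imp (fun t => Phi g z (Complex t d)) L2 ->
    L1 = L2.
  case: (leP eta e0) => h; first exact: main Hl Hl'.
  by apply/esym; exact: main (ltW h) _ _ Hl' Hl.
move=> cd c3 cz HL1 HL2; apply/eqP; rewrite -subr_eq0; apply/eqP.
have hol x y : c <= y -> derivable (Phi g z) (Complex x y : C) (1 : C).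
  move=> cy; case: hg => hg _; apply: hol_Phi; first by apply: hg => /=; lra.
  by apply/eqP => ee; move: cz; rewrite -ee /=; lra.
(* [Phi_cst] grows with the height, so its value at the upper line [d] serves the whole strip. *)
apply: (@imp_rect R (Phi g z) c d (Phi_cst d M z * (2 * (1 + complex.Re z ^+ 2))) 0) HL1 HL2 => //.
- by move=> x y _ /andP[cy _]; apply: derivable_ccont; exact: hol.
- move=> x y _ /andP[cy yd].
  have y3 : 3 <= y by lra.
  have yz : complex.Im z + 1 <= y by lra.
  apply: (le_trans (Phi_le0 x hg y3 yz)).
  apply: ler_wpM2r; first by rewrite invr_ge0; have := sqr_ge0 x; lra.
  apply: ler_wpM2r; first by have := sqr_ge0 (complex.Re z); lra.
  rewrite /Phi_cst; apply: ler_pM.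
  + by apply: mulr_ge0; [exact: expR_ge0|exact: powR_ge0].
  + by apply: mulr_ge0; [exact: ltW dK_gt0|exact: expR_ge0].
  + by apply: ler_wpM2r; [exact: powR_ge0|rewrite ler_expR ler_pM2l ?pi_gt0].
  + apply: ler_wpM2l; first exact: ltW dK_gt0.
    by rewrite ler_expR ler_pM2l ?pi_gt0 // lerD2r.
- move=> n _; apply: goursat => //; first by have : (0 : R) <= n%:R by []; lra.
  by move=> x y /andP[_ /andP[cy _]]; exact: hol.
Qed.

Lemma cauchyT_linear g g' M M' (a : C) z : hcls M g -> hcls M' g' ->
  cauchyT (fun w => a * g w + g' w) z = a * cauchyT g z + cauchyT g' z.
Proof.
move=> hg hg'; set e0 := 3 + Num.max 0 (complex.Im z).
have [e03 e0z] := Im_lt_max z; rewrite -/e0 in e03 e0z.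
have [H _] := cauchyT_imp hg e03 e0z; have [H' _] := cauchyT_imp hg' e03 e0z.
have cg := cont_Phi hg e03 e0z; have cg' := cont_Phi hg' e03 e0z.
have caz := @cont_allZ R _ a cg.
have L := is_impD caz cg' (is_impZ a cg H) H'.
rewrite {1}/cauchyT -/e0.
have -> : (fun t => Phi (fun w => a * g w + g' w) z (Complex t e0)) =
  (fun t => a * Phi g z (Complex t e0) + Phi g' z (Complex t e0)).
  by apply/funext => t; rewrite /Phi; ring.
by rewrite (cimpE L); field; exact: c0_neq0.
Qed.

Lemma cauchyT_eq g g' z : (forall w, 0 < complex.Im w -> g w = g' w) ->
  cauchyT g z = cauchyT g' z.
Proof.
move=> H; rewrite /cauchyT; congr (_ * cimp _); apply/funext => t.
rewrite /Phi H //= ltr_pwDl // le_max lexx //.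
Qed.

(** At the height e0 = 3 + max(0, Im z) one has e0 + (e0 - Im z) = 6 + |Im z|. The 12 is the 48 of
    [imp_le] divided by 4, the lower bound for |c0|. *)
Lemma cauchyT_growth g M : hcls M g -> exists2 A, 0 < A &
  forall z, cmod (cauchyT g z) <= A * expR (pi * `|complex.Im z|).
Proof.
move=> hg; exists (12 * Phi_cst 3 M 0 + 1).
  by have := Phi_cst_ge0 3 M 0; lra.
move=> z; set e0 := 3 + Num.max 0 (complex.Im z).
have [e03 e0z] := Im_lt_max z; rewrite -/e0 in e03 e0z.
have [H _] := cauchyT_imp hg e03 e0z.
have H1 := c0_cancel (imp_le (cont_Phi hg e03 e0z) (fun t => Phi_le t hg e03 e0z) H).
apply: (le_trans H1).
have -> : Phi_cst e0 M z = Phi_cst 3 M 0 * expR (pi * `|complex.Im z|).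
  rewrite /Phi_cst /= subr0.
  have : expR (pi * e0) * expR (pi * (e0 - complex.Im z)) =
    expR (pi * 3) * expR (pi * 3) * expR (pi * `|complex.Im z|).
    rewrite -!expRD; congr expR; rewrite -!mulrDr; congr (_ * _); rewrite /e0.
    by case: (lerP 0 (complex.Im z)) => h; [rewrite (ger0_norm h)|rewrite (ltr0_norm h)]; ring.
  move=> e; have -> : forall a b c d : R, a * b * (c * d) = b * c * (a * d) by move=> *; ring.
  by rewrite e; ring.
have h1 := Phi_cst_ge0 3 M 0; have h2 := expR_ge0 (pi * `|complex.Im z|).
have h3 := mulr_ge0 h1 h2; lra.
Qed.

(** By [taylor2] both quotients lie within 8 m |h| and 8 m |h'| of [- A1], where m bounds the kernel
    on a disc of radius 2 and inherits its decay; 72 is 8 times the 9 of [inv_sq_near]. *)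
Lemma kern_quotient w h h' : 5 <= complex.Im w -> h != 0 -> h' != 0 ->
  cmod h <= 1 / 2 -> cmod h' <= 1 / 2 ->
  cmod ((k (w - h) - k w) / h - (k (w - h') - k w) / h') <=
  72 * (dK * expR (pi * (complex.Im w + 2))) * (cmod h + cmod h') / (1 + complex.Re w ^+ 2).
Proof.
move=> w5 h0 h0' hh hh'.
pose q := (1 + complex.Re w ^+ 2)^-1.
have q0 : 0 <= q by rewrite invr_ge0 addr_ge0 ?sqr_ge0.
pose m := 9 * (dK * expR (pi * (complex.Im w + 2))) * q.
have d0 := dK_gt0.
have m0 : 0 <= m by rewrite /m mulr_ge0 // mulr_ge0 // mulr_ge0 ?expR_ge0 // ltW.
have [|A1 [A2 [_ HA2 HT]]] := @taylor2 R k w 1 m ltr01.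
  move=> v; rewrite mulr1 => hv.
  have hI := le_trans (Im_le_cmod (v - w)) hv; have hR := le_trans (Re_le_cmod (v - w)) hv.
  rewrite ImD ImN ler_norml in hI; rewrite ReD ReN ler_norml in hR.
  case/andP: hI => i1 i2; case/andP: hR => r1 r2.
  have v1 : 1 <= complex.Im v by lra.
  split.
    apply: (hol_kern N0); rewrite -cmod_gt0; have := Im_le_cmod v; have := ler_norm (complex.Im v).
    by lra.
  apply: (le_trans (kern_sq v1)).
  have e1 : expR (pi * complex.Im v) <= expR (pi * (complex.Im w + 2)).
    by rewrite ler_expR ler_pM2l ?pi_gt0 //; lra.
  have e2 : (1 + complex.Re v ^+ 2)^-1 <= 9 * q by exact: inv_sq_near r1 r2.
  rewrite (_ : m = dK * expR (pi * (complex.Im w + 2)) * (9 * q)); last by rewrite /m; ring.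
  apply: ler_pM e2.
  + by apply: mulr_ge0; [exact: ltW|exact: expR_ge0].
  + by rewrite invr_ge0 addr_ge0 ?sqr_ge0.
  + by apply: ler_wpM2l; [exact: ltW|].
have HQ v : v != 0 -> cmod v <= 1 / 2 -> cmod ((k (w - v) - k w) / v + A1) <= 8 * m * cmod v.
  move=> v0 hv; have := HT (- v); rewrite cmodN => /(_ hv).
  rewrite expr1n divr1 => {}HT; rewrite expr1n divr1 in HA2.
  have cv : 0 < cmod v by rewrite cmod_gt0.
  have -> : (k (w - v) - k w) / v + A1 =
    (k (w - v) - k w - A1 * - v - A2 * (- v) ^+ 2) / v + A2 * v by field.
  apply: (le_trans (cmodD _ _)).
  have t1 : cmod ((k (w - v) - k w - A1 * - v - A2 * (- v) ^+ 2) / v) <= 8 * m * cmod v ^+ 2.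
    rewrite cmodM cmodV ler_pdivrMr //; apply: (le_trans HT).
    by rewrite le_eqVlt; apply/orP; left; apply/eqP; ring.
  have t2 : cmod (A2 * v) <= 4 * m * cmod v by rewrite cmodM ler_wpM2r ?cmod_ge0.
  have t3 : m * cmod v ^+ 2 <= m * cmod v / 2.
    rewrite -mulrA; apply: ler_wpM2l => //; rewrite expr2; apply: ler_wpM2l; first exact: ltW.
    by rewrite -div1r.
  by lra.
have B1 := HQ _ h0 hh; have B2 := HQ _ h0' hh'.
have -> : (k (w - h) - k w) / h - (k (w - h') - k w) / h' =
  ((k (w - h) - k w) / h + A1) - ((k (w - h') - k w) / h' + A1) by ring.
apply: (le_trans (cmodB _ _)); apply: (le_trans (lerD B1 B2)).
by rewrite /m -/q le_eqVlt; apply/orP; left; apply/eqP; ring.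
Qed.

(** Differentiation under the integral: on one line shared by z, z + h and z + h', the kernel
    estimate integrates to a Cauchy criterion for the difference quotients. *)
Lemma hol_cauchyT g M z : hcls M g -> derivable (cauchyT g) z (1 : C).
Proof.
(* Higher than the line in the definition, since [kern_quotient] asks for distance at least 5
   between the line and z. *)
move=> hg; pose eta := 6 + Num.max 0 (complex.Im z).
have m0 : 0 <= Num.max 0 (complex.Im z) by rewrite le_max lexx.
have mz : complex.Im z <= Num.max 0 (complex.Im z) by rewrite le_max lexx orbT.
have e3 : 3 <= eta by rewrite /eta; lra.
have ez h : cmod h <= 1 / 2 -> complex.Im (z + h) + 1 <= eta.
  by move=> hh; have := Im_le_cmod h; have := ler_norm (complex.Im h); rewrite ImD /eta; lra.
have ez0 : complex.Im z + 1 <= eta by rewrite /eta; lra.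
pose A := expR (pi * eta) * (K * M) `^ p^-1 *
  (72 * (dK * expR (pi * (eta - complex.Im z + 2)))).
have [L0 _] := cauchyT_imp hg e3 ez0; have c0' := cont_Phi hg e3 ez0.
have r0 : (0 : R) < 1 / 2 by lra.
apply: (@derivable_of_quotients R _ z (1 / 2) (12 * A) r0) => h h' n0 n0' /ltW hh /ltW hh'.
have [L1 _] := cauchyT_imp hg e3 (ez h hh); have c1 := cont_Phi hg e3 (ez h hh).
have [L2 _] := cauchyT_imp hg e3 (ez h' hh'); have c2 := cont_Phi hg e3 (ez h' hh').
have d1 := is_impD (@cont_allZ R _ h^-1 c1) (@cont_allZ R _ (- h^-1) c0') (is_impZ h^-1 c1 L1) (is_impZ (- h^-1) c0' L0).
have d2 := is_impD (@cont_allZ R _ h'^-1 c2) (@cont_allZ R _ (- h'^-1) c0') (is_impZ h'^-1 c2 L2) (is_impZ (- h'^-1) c0' L0).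
have cD (F G : R -> C) : cont_all F -> cont_all G -> cont_all (fun t => F t + G t).
  move=> cF cG t; have tt : t <= t <= t by rewrite lexx.
  exact: (@cont_onDC R t t F G (cont_all_on cF) (cont_all_on cG) t tt).
have cc1 := cD _ _ (@cont_allZ R _ h^-1 c1) (@cont_allZ R _ (- h^-1) c0').
have cc2 := cD _ _ (@cont_allZ R _ h'^-1 c2) (@cont_allZ R _ (- h'^-1) c0').
have cc3 := cD _ _ cc1 (@cont_allZ R _ (-1) cc2).
have L := is_impD cc1 (@cont_allZ R _ (-1) cc2) d1 (is_impZ (-1) cc2 d2).
have e : h^-1 * (- c0 R * cauchyT g (z + h)) + - h^-1 * (- c0 R * cauchyT g z) +
    -1 * (h'^-1 * (- c0 R * cauchyT g (z + h')) + - h'^-1 * (- c0 R * cauchyT g z)) =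
    - c0 R * ((cauchyT g (z + h) - cauchyT g z) / h - (cauchyT g (z + h') - cauchyT g z) / h').
  have aux (a b c x y v : C) : a * (- c * x) + - a * (- c * y) +
    -1 * (b * (- c * v) + - b * (- c * y)) = - c * ((x - y) * a - (v - y) * b) by ring.
  exact: aux.
rewrite e in L.
have Lb := @imp_le R _ (A * (cmod h + cmod h')) (complex.Re z) _ cc3 _ L.
apply: (le_trans (c0_cancel (Lb _))); last by rewrite le_eqVlt; apply/orP; left; apply/eqP; field.
move=> t; have w5 : 5 <= complex.Im (Complex t eta - z) by rewrite ImD ImN /= /eta; lra.
have Q := kern_quotient w5 n0 n0' hh hh'.
set u : C := Complex t eta in w5 Q *.
have -> : h^-1 * Phi g (z + h) u + - h^-1 * Phi g z u +
    -1 * (h'^-1 * Phi g (z + h') u + - h'^-1 * Phi g z u) =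
   cexp (Complex 0 (- pi) * u) * g u *
   ((k (u - z - h) - k (u - z)) / h - (k (u - z - h') - k (u - z)) / h').
  by rewrite /Phi !opprD !addrA; ring.
rewrite !cmodM cmod_cexp_i mulNr opprK.
have e1 : complex.Re (u - z) = t - complex.Re z by rewrite ReD ReN.
have e2 : complex.Im (u - z) = eta - complex.Im z by rewrite ImD ImN.
rewrite e1 e2 in Q.
have -> : A * (cmod h + cmod h') / (1 + (t - complex.Re z) ^+ 2) =
  expR (pi * eta) * (K * M) `^ p^-1 *
  (72 * (dK * expR (pi * (eta - complex.Im z + 2))) * (cmod h + cmod h') / (1 + (t - complex.Re z) ^+ 2)).
  by rewrite /A !mulrA.
apply: ler_pM Q; [|exact: cmod_ge0|].
  by apply: mulr_ge0; [exact: expR_ge0|exact: cmod_ge0].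
by apply: ler_wpM2l; [exact: expR_ge0|exact: hcls_bound hg _].
Qed.

(** On the line of height 4 replace |g| by its maximum s_i on each unit interval. Subadditivity of
    t^p bounds |T g(x)|^p by a sum of terms s_i^p / (1 + (x - c_i)^2); integrating in x gives a
    multiple of the sum of s_i^p, which [HK] controls. *)
Lemma cauchyT_Lp : exists2 A, 0 < A & forall g M (m : nat), hcls M g ->
  rint (- m%:R) m%:R (fun x => cmod (cauchyT g (Complex x 0)) `^ p) <= A * M.
Proof.
pose E := expR (pi * 4) * (dK * expR (pi * 4)).
have E0 : 0 < E by rewrite mulr_gt0 ?expR_gt0 // mulr_gt0 ?expR_gt0 // dK_gt0.
have Ep0 : 0 <= E `^ p by exact: powR_ge0.
exists (144 * E `^ p * K); first by rewrite mulr_gt0 // mulr_gt0 // powR_gt0.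
move=> g M m hg.
have ip : 0 <= p^-1 by rewrite invr_ge0 ltW.
(* The maximum over a unit interval is attained, and its location is a legitimate sample point for
   [HK]. *)
have hX (c : R) : exists x : R, c <= x <= c + 1 /\ forall t, c <= t <= c + 1 ->
    cmod (g (Complex t 4)) <= cmod (g (Complex x 4)).
  have cc : c <= c + 1 by rewrite lerDl.
  have [|[x y] [/= h1 h2] h3] := @max_rect R c (c + 1) 4 4 (fun w => cmod (g w)) cc (lexx _).
    move=> [x y] [/= _ hy]; apply/crcontP => e e0.
    have dg : derivable g (Complex x y : C) (1 : C).
      by case: hg => hg _; apply: hg => /=; case/andP: hy; lra.
    have /ccontP/(_ e e0) [d d0 Hd] := derivable_ccont dg.
    by exists d => // w /Hd; apply: le_lt_trans (cmod_dist _ _).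
  have ey : y = 4 by apply/le_anti; rewrite andbC.
  exists x; split; first exact: h1.
  by move=> t ht; rewrite -{2}ey; apply: h3; split => //=; rewrite lexx.
have [X HX] := choice hX.
apply/ler_addgt0Pr => e e0.
have m1 : 0 < 2 * m%:R + 1 :> R by have : (0 : R) <= m%:R by []; lra.
pose dl := e / (2 * m%:R + 1); have dl0 : 0 < dl by rewrite divr_gt0.
have dlp : 0 < dl `^ p^-1 by rewrite powR_gt0.
(* The truncation rate of [cauchyT_imp], made uniform for |x| <= m. With [n] below, the p-th power
   of the tail stays under [dl], and integrating [dl] over [-m, m] costs less than [e]. *)
pose W := 32 * (Phi_cst 4 M 0 * (2 * (1 + m%:R ^+ 2))).
pose n := Num.Def.truncn (W / dl `^ p^-1).
have W0 : 0 <= W.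
  rewrite /W mulr_ge0 // mulr_ge0 ?Phi_cst_ge0 // mulr_ge0 // addr_ge0 //.
have hn : (W / n.+1%:R) `^ p < dl.
  apply: powR_lt_eps => //; first exact: divr_ge0.
  by rewrite ltr_pdivrMr // mulrC -ltr_pdivrMr //; exact: truncnS_gt.
pose c (i : 'I_(n + n)) : R := - n%:R + i%:R.
pose s i := cmod (g (Complex (X (c i)) 4)).
have en : n%:R = - n%:R + (n + n)%:R :> R by rewrite natrD addKr.
have sumS : \sum_i s i `^ p <= K * M.
  case: hg => hg HM; apply: (HK (y0 := 4) (M := M) (g := g) _ _ (a := - n%:R)) => [u /andP[u1 _]|y a b /andP[y1 _]|i].
  - by apply: hg; lra.
  - by apply: HM; lra.
  - by have [] := HX (c i).
pose q (i : 'I_(n + n)) x : R := (1 + (x - c i) ^+ 2)^-1.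
have q0 i x : 0 <= q i x by rewrite invr_ge0 addr_ge0 ?sqr_ge0.
(* The 6 is the 2 of [cint_window], whose p-th power is at most 2, times the 3 of [inv_sq_window],
   whose exponents 1/p and p cancel. *)
pose v i x := 6 * E `^ p * s i `^ p * q i x.
have cv i a b : cont_on a b (v i).
  by apply: cont_onM; [exact: cont_on_cst|exact: cont_inv_sq].
have e34 : (3 : R) <= 4 by lra.
have ex4 x : complex.Im (Complex x 0 : C) + 1 <= 4 by rewrite /=; lra.
have pw x : - m%:R <= x <= m%:R -> cmod (cauchyT g (Complex x 0)) `^ p <= \sum_i v i x + dl.
  move=> hx; have [_ /(_ n) Hn] := cauchyT_imp hg e34 (ex4 x).
  pose Tn := cint (- n%:R) n%:R (fun t => Phi g (Complex x 0) (Complex t 4)).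
  have hT : cmod Tn <= 2 * \sum_i E * s i * (3 * q i x) `^ p^-1.
    have H := @cint_window R (n + n) (- n%:R) (fun t => Phi g (Complex x 0) (Complex t 4))
      (fun i => E * s i * (3 * q i x) `^ p^-1).
    rewrite -en in H; apply: H; first exact: cont_all_on (cont_Phi hg e34 (ex4 x)).
    move=> i t ht; rewrite cmod_Phi.
    have u1 : 1 <= complex.Im (Complex t 4 - Complex x 0 : C) by rewrite /=; lra.
    have := kern_pow u1; rewrite /= subr0 => hk.
    have hs : cmod (g (Complex t 4)) <= s i by have [_] := HX (c i); exact.
    have hq : (1 + (t - x) ^+ 2)^-1 <= 3 * q i x.
      rewrite /q -[(x - c i) ^+ 2]sqrrN opprB; exact: inv_sq_window.
    have hqp : (1 + (t - x) ^+ 2)^-1 `^ p^-1 <= (3 * q i x) `^ p^-1.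
      by apply: powR_le => //; rewrite invr_ge0 addr_ge0 ?sqr_ge0.
    rewrite (_ : E * s i * _ = expR (pi * 4) * s i * (dK * expR (pi * 4) * (3 * q i x) `^ p^-1)); last by rewrite /E; ring.
    apply: ler_pM.
    - by apply: mulr_ge0; [exact: expR_ge0|exact: cmod_ge0].
    - exact: cmod_ge0.
    - by apply: ler_wpM2l; [exact: expR_ge0|].
    - apply: (le_trans hk); apply: ler_wpM2l => //.
      by apply: mulr_ge0; [exact: ltW dK_gt0|exact: expR_ge0].
  have hTp : cmod Tn `^ p <= \sum_i v i x.
    apply: (le_trans (powR_le (ltW p0) (cmod_ge0 _) hT)).
    have S0 i : 0 <= E * s i * (3 * q i x) `^ p^-1.
      by rewrite mulr_ge0 ?powR_ge0 // mulr_ge0 ?cmod_ge0 // ltW.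
    rewrite powRM //; last by apply: sumr_ge0 => i _; exact: S0.
    have hsub := powR_sum_subadd (index_enum _) p0 (ltW p1) S0.
    have h2 : (2 : R) `^ p <= 2 by apply: ler1_powR; [lra|exact: ltW].
    apply: (@le_trans _ _ (2 * \sum_i (E * s i * (3 * q i x) `^ p^-1) `^ p)).
      by apply: ler_pM; rewrite ?powR_ge0.
    rewrite mulr_sumr; apply: ler_sum => i _.
    have Es : 0 <= E * s i by rewrite mulr_ge0 ?cmod_ge0 // ltW.
    rewrite powRM ?powR_ge0 // powRM ?cmod_ge0 ?(ltW E0) // -powRrM mulVf ?lt0r_neq0 // powRr1; last by rewrite mulr_ge0.
    by rewrite /v le_eqVlt; apply/orP; left; apply/eqP; ring.
  have tail : 32 * (Phi_cst 4 M (Complex x 0) * (2 * (1 + complex.Re (Complex x 0 : C) ^+ 2))) / n.+1%:R <= W / n.+1%:R.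
    apply: ler_wpM2r; first by rewrite invr_ge0.
    apply: ler_wpM2l; first by lra.
    apply: ler_wpM2l; first exact: Phi_cst_ge0.
    apply: ler_wpM2l; first by lra.
    rewrite lerD2l /= -(real_normK (num_real x)); apply: (lerXn2r 2); rewrite ?nnegrE //.
    by rewrite ler_norml.
  have {}Hn := le_trans Hn tail.
  have hc : cmod (cauchyT g (Complex x 0)) <= cmod Tn + W / n.+1%:R.
    have h1 := cmodB (Tn + c0 R * cauchyT g (Complex x 0)) Tn.
    rewrite (_ : Tn + c0 R * cauchyT g (Complex x 0) - Tn = c0 R * cauchyT g (Complex x 0)) in h1; last by rewrite addrAC subrr add0r.
    rewrite cmodM in h1; have h2 := ler_wpM2r (cmod_ge0 (cauchyT g (Complex x 0))) (c0_ge R).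
    have h3 := cmod_ge0 (cauchyT g (Complex x 0)).
    exact: bound_aux h1 h2 h3 Hn.
  apply: (le_trans (powR_le (ltW p0) (cmod_ge0 _) hc)).
  have dW : 0 <= W / n.+1%:R by rewrite divr_ge0.
  apply: (le_trans (powR_subadd p0 (ltW p1) (cmod_ge0 _) dW)).
  by apply: lerD => //; exact: ltW.
have [cS rS] := rint_sum (fun i => cv i (- m%:R) m%:R).
have cT : cont_on (- m%:R) m%:R (fun x => cmod (cauchyT g (Complex x 0)) `^ p).
  by apply: cont_line => //; [exact: ltW|move=> x; exact: hol_cauchyT hg].
apply: (le_trans (rint_le cT (cont_onD cS (@cont_on_cst R _ _ _ dl)) pw)).
rewrite rintD //; last exact: cont_on_cst.
have mm : - m%:R <= m%:R :> R by have : (0 : R) <= m%:R by []; lra.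
rewrite rint_cst // rS; apply: lerD.
  (* 144 is 6 times the bound 24 of [rint_inv_sq]. *)
  apply: (@le_trans _ _ (\sum_i 144 * E `^ p * s i `^ p)).
    apply: ler_sum => i _; rewrite /v rintZ; last exact: cont_inv_sq.
    have em : m%:R = - m%:R + (m + m)%:R :> R by rewrite natrD addKr.
    have h2 := rint_inv_sq (- m%:R) (c i) (m + m); rewrite -em in h2.
    have k0 : 0 <= 6 * E `^ p * s i `^ p by rewrite mulr_ge0 ?powR_ge0 // mulr_ge0.
    have := ler_wpM2l k0 h2; rewrite /q => h3; apply: (le_trans h3).
    by rewrite le_eqVlt; apply/orP; left; apply/eqP; ring.
  rewrite -mulr_sumr; have k0 : 0 <= 144 * E `^ p by exact: mulr_ge0.
  have k1 := ler_wpM2l k0 sumS; apply: (le_trans k1); by rewrite mulrA.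
rewrite /dl -mulrA -[X in _ <= X]mulr1; apply: ler_wpM2l; first exact: ltW.
by rewrite mulrC ler_pdivrMr //; lra.
Qed.

(** The twist distorts |f| only by a bounded factor in a strip, so line integrals of |f|^p are
    bounded there: from [twist f] above the axis, from its reflection below. One sample point in
    [HK] then bounds f itself. This makes the vertical sides negligible in [cauchyT_reproduces]. *)
Lemma strip_bound f M (H : R) : 0 <= H -> (forall w, derivable f w (1 : C)) ->
  (forall a b y, 0 <= y -> rint a b (fun x => cmod (twist f (Complex x y)) `^ p) <= M) ->
  (forall a b y, 0 <= y ->
     rint a b (fun x => cmod (twist (fun w => f (- w)) (Complex x y)) `^ p) <= M) ->
  exists2 B : R, 0 <= B & forall z, `|complex.Im z| <= H -> cmod (f z) <= B.
Proof.
(* One unit above [H], because [HK] uses the lines within distance 1 of the given height. *)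
move=> H0 hf HM HM'; pose e := expR (pi * (H + 1)) `^ p.
have e0 : 0 <= e by exact: powR_ge0.
have M0 : 0 <= M by apply: le_trans (HM 0 0 0 (lexx _)); apply: rint_ge0 => x _; exact: powR_ge0.
have half f1 (a b y : R) : (forall w, derivable f1 w (1 : C)) ->
    (forall a b y, 0 <= y -> rint a b (fun x => cmod (twist f1 (Complex x y)) `^ p) <= M) ->
    0 <= y -> y <= H + 1 -> rint a b (fun x => cmod (f1 (Complex x y)) `^ p) <= e * M.
  move=> hf1 HM1 y0 y1.
  have c1 : cont_on a b (fun x => cmod (f1 (Complex x y)) `^ p).
    by apply: cont_line => //; exact: ltW.
  have c2 : cont_on a b (fun x => cmod (twist f1 (Complex x y)) `^ p).
    by apply: cont_line => //; [exact: ltW|move=> x; exact: hol_twist].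
  have := ler_wpM2l e0 (HM1 a b y y0); rewrite -rintZ //; apply: le_trans.
  apply: rint_le => //; first by apply: cont_onM => //; exact: cont_on_cst.
  move=> x _; rewrite /e -powRM ?expR_ge0 ?cmod_ge0 //; apply: powR_le; rewrite ?(ltW p0) ?cmod_ge0 //.
  rewrite cmod_twist mulrA -expRD /= -[X in X <= _]mul1r; apply: ler_wpM2r; first exact: cmod_ge0.
  rewrite -[X in X <= _]expR0 ler_expR -mulrN -mulrDr; apply: mulr_ge0; first exact: pi_ge0.
  by lra.
have HQ y a b : - (H + 1) <= y -> y <= H + 1 ->
    rint a b (fun x => cmod (f (Complex x y)) `^ p) <= e * M.
  move=> y1 y2; case: (lerP 0 y) => y0; first exact: half.
  case: (lerP a b) => ab; last by rewrite rint_empty //; exact: mulr_ge0.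
  have ab' : - b <= - a by rewrite lerN2.
  have E := @rint_opp R (- b) (- a) (fun x => cmod (f (Complex x y)) `^ p) ab'.
  rewrite !opprK in E; rewrite E; last by apply: (cont_line p0 (ltW p1)) => x; exact: hf.
  have e1 x : Complex (- x) y = - Complex x (- y) :> C.
    by apply/eqP; rewrite eq_complex /= opprK !eqxx.
  under [X in rint _ _ X]eq_fun do rewrite e1.
  have y0' : 0 <= - y by rewrite oppr_ge0 ltW.
  have y1' : - y <= H + 1 by rewrite lerNl.
  have hf' w := @hol_opp R f w hf.
  have Z := @half (fun w => f (- w)) (- b) (- a) (- y) hf' HM' y0' y1'.
  exact: Z.
exists ((K * (e * M)) `^ p^-1); first exact: powR_ge0.
move=> z; rewrite ler_norml => /andP[z1 z2].
have := HK (y0 := complex.Im z) (M := e * M) (g := f) _ _ (a := complex.Re z) (n := 1) (x := fun _ => complex.Re z).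
move=> HH; have {}HH : \sum_(i < 1) cmod (f (Complex (complex.Re z) (complex.Im z))) `^ p <= K * (e * M).
  apply: HH => [u _|y a b /andP[y1 y2]|i]; first exact: hf.
  - by apply: HQ; lra.
  - by rewrite (ord1 i) addr0 lexx lerDl ler01.
move: HH; rewrite big_ord1 Complex_Re_Im => HH.
have ip : 0 <= p^-1 by rewrite invr_ge0 ltW.
have := powR_le ip (powR_ge0 _ _) HH.
by rewrite -powRrM mulfV ?lt0r_neq0 // powRr1 ?cmod_ge0.
Qed.

(** The twist cancels the exponential in [Phi], leaving f(u) k(u - z) on the upper line. By oddness
    of the kernel, u -> -u turns the integral for the reflected function into the same integrand on
    the lower line. The residue at u = z is f(z). *)
Lemma cauchyT_reproduces f M z : (forall w, derivable f w (1 : C)) ->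
  (forall a b y, 0 <= y -> rint a b (fun x => cmod (twist f (Complex x y)) `^ p) <= M) ->
  (forall a b y, 0 <= y ->
     rint a b (fun x => cmod (twist (fun w => f (- w)) (Complex x y)) `^ p) <= M) ->
  cauchyT (twist f) z + cauchyT (twist (fun w => f (- w))) (- z) = f z.
Proof.
move=> hf HM HM'; have hf' w := @hol_opp R f w hf.
have h1 : hcls M (twist f).
  by split=> [w _|a b y /ltW y0]; [exact: hol_twist|exact: HM].
have h2 : hcls M (twist (fun w => f (- w))).
  by split=> [w _|a b y /ltW y0]; [exact: hol_twist|exact: HM'].
pose eta := 3 + `|complex.Im z|.
have nz := normr_ge0 (complex.Im z).
have lz : - `|complex.Im z| <= complex.Im z <= `|complex.Im z| by rewrite -ler_norml.
case/andP: lz => lz1 lz2.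
have e3 : 3 <= eta by rewrite lerDl.
have ez : complex.Im z + 1 <= eta by rewrite /eta; lra.
have ez' : complex.Im (- z) + 1 <= eta by rewrite ImN /eta; lra.
have [L1 _] := cauchyT_imp h1 e3 ez; have [L2 _] := cauchyT_imp h2 e3 ez'.
have c2 := cont_Phi h2 e3 ez'.
have L3 := is_imp_opp (@cont_allZ R _ (-1) c2) (is_impZ (-1) c2 L2).
pose Psi u : C := f u * k (u - z).
have cx u : cexp (Complex 0 (- pi) * u) * cexp (Complex 0 pi * u) = 1 :> C.
  rewrite -cexpD -mulrDl (_ : Complex 0 (- pi) + Complex 0 pi = 0 :> C) ?mul0r ?cexp0 //.
  by apply/eqP; rewrite eq_complex /= addr0 addNr !eqxx.
have E1 : (fun t => Phi (twist f) z (Complex t eta)) = (fun t => Psi (Complex t eta)).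
  by apply/funext => t; rewrite /Phi /twist mulrA cx mul1r.
have E3 : (fun t => -1 * Phi (twist (fun w => f (- w))) (- z) (Complex (- t) eta)) =
    (fun t => Psi (Complex t (- eta))).
  apply/funext => t; rewrite /Phi /twist mulrA cx mul1r.
  have -> : - Complex (- t) eta = Complex t (- eta) :> C.
    by apply/eqP; rewrite eq_complex /= opprK !eqxx.
  have -> : Complex (- t) eta - - z = - (Complex t (- eta) - z) :> C.
    rewrite opprB opprK addrC; congr (_ + _).
    by apply/eqP; rewrite eq_complex /= opprK !eqxx.
  by rewrite kernN /Psi; ring.
rewrite E1 in L1; rewrite E3 in L3.
have eta0 : 0 <= eta by lra.
have [B B0 HB] := strip_bound eta0 hf HM HM'.
have ee : - eta <= eta by lra.
pose A := B * (dK * expR (pi * (2 * eta))) * 4.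
have dB : 0 <= B * (dK * expR (pi * (2 * eta))).
  by rewrite mulr_ge0 // mulr_ge0 ?expR_ge0 // ltW // dK_gt0.
(* Far from z one has |x - Re z| >= |x|/2 + 1, which recentres the decay of the kernel at 0 as
   [imp_rect] expects. *)
have big x : 2 * `|complex.Re z| + 2 <= `|x| -> 1 <= `|x - complex.Re z| /\
    (1 + x ^+ 2) / 4 <= `|x - complex.Re z| ^+ 2.
  move=> hx; have n0 := normr_ge0 (complex.Re z).
  have := lerB_normD x (- complex.Re z); rewrite normrN => ht.
  split; first by lra.
  rewrite -(real_normK (num_real x)); move: (`|x - complex.Re z|) (`|x|) (`|complex.Re z|) ht hx n0 => a b c ht hx n0.
  have : b / 2 + 1 <= a by lra.
  move=> h; have b0 : 0 <= b / 2 + 1 by lra.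
  have := lerXn2r 2 (_ : b / 2 + 1 \is Num.nneg) (_ : a \is Num.nneg) h.
  rewrite !nnegrE => /(_ b0 (le_trans b0 h)); apply: le_trans.
  by rewrite sqrrD expr1n mulr1 exprMn; nra.
have neqz x y : 1 <= `|x - complex.Re z| -> (Complex x y : C) != z.
  move=> hx; apply/eqP => e; move: hx; rewrite -e /= subrr normr0; lra.
(* Lower line minus upper line equals [c0] times the residue. *)
have HR : c0 R * cauchyT (twist (fun w => f (- w))) (- z) - (- c0 R * cauchyT (twist f) z) = c0 R * f z.
  apply: (@imp_rect R Psi (- eta) eta A (2 * `|complex.Re z| + 2) (c0 R * f z) _ _ ee _ _ _ _ L1).
  - move=> x y hx hy; apply: derivable_ccont; apply: holM; first exact: hf.
    by apply: (@hol_shift R k (- z)); apply: (hol_kern N0); rewrite subr_eq0; apply: neqz; case: (big x hx).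
  - move=> x y hx /andP[y1 y2]; rewrite cmodM.
    have [b1 b2] := big x hx.
    have yz : `|y| <= eta by rewrite ler_norml y1 y2.
    have hB := HB (Complex x y) yz.
    have wz : Complex x y - z != 0 :> C by rewrite subr_eq0; exact: neqz.
    have := kern_le N0 wz; rewrite -/dK.
    have i1 : complex.Re (Complex x y - z) = x - complex.Re z by rewrite ReD ReN.
    have i2 : complex.Im (Complex x y - z) = y - complex.Im z by rewrite ImD ImN.
    rewrite i2 => hk.
    have cw : `|x - complex.Re z| <= cmod (Complex x y - z) by rewrite -i1 Re_le_cmod.
    have cw1 := le_trans b1 cw.
    have ge : (1 + x ^+ 2) / 4 <= cmod (Complex x y - z) ^+ N.+1.
      apply: (le_trans b2); apply: (@le_trans _ _ (cmod (Complex x y - z) ^+ 2)).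
        by apply: (lerXn2r 2); rewrite ?nnegrE ?cmod_ge0.
      by apply: ler_weXn2l => //; rewrite ltnS.
    have q0 : 0 < (1 + x ^+ 2) / 4 by rewrite divr_gt0 // ltr_wpDr ?sqr_ge0.
    rewrite /A -mulrA -mulrA; apply: ler_pM => //; rewrite ?cmod_ge0 //.
    apply: (le_trans hk); apply: ler_pM.
    + by rewrite mulr_ge0 ?expR_ge0 // ltW // dK_gt0.
    + by rewrite invr_ge0 exprn_ge0 ?cmod_ge0.
    + apply: ler_wpM2l; first exact: ltW dK_gt0.
      rewrite ler_expR; apply: ler_wpM2l; first exact: pi_ge0.
      by rewrite ler_norml /eta in y1 y2 *; apply/andP; split; lra.
    + have -> : 4 / (1 + x ^+ 2) = ((1 + x ^+ 2) / 4)^-1 by rewrite invfM invrK mulrC.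
      by rewrite lef_pV2 ?posrE // exprn_gt0 // (lt_le_trans ltr01).
  - move=> n hn; have n0 := normr_ge0 (complex.Re z).
    have lR : - `|complex.Re z| <= complex.Re z <= `|complex.Re z| by rewrite -ler_norml.
    case/andP: lR => lR1 lR2.
    apply: (@residue R (- n%:R) n%:R (- eta) eta (complex.Re z) (complex.Im z)).
    + by apply/andP; split; lra.
    + by rewrite /eta; apply/andP; split; lra.
    + move=> x y _; rewrite Complex_Re_Im => hxy; apply: holM; first exact: hf.
      by apply: (@hol_shift R k (- z)); apply: (hol_kern N0); rewrite subr_eq0.
    + rewrite Complex_Re_Im => e e0.
      have b1 : 0 < cmod (f z) + 2 by have := cmod_ge0 (f z); lra.
      (* The error splits into three terms of size at most [dl], [dl] and [dl * cmod (f z)]. *)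
      pose dl := Num.min 1 (e / (cmod (f z) + 2)).
      have dl0 : 0 < dl by rewrite lt_min ltr01 divr_gt0.
      have [r r0 Hr] := kern_residue N0 dl0.
      have /ccontP/(_ dl dl0) [r' r'0 Hr'] := derivable_ccont (hf z).
      exists (Num.min r r'); first by rewrite lt_min r0.
      move=> w w0; rewrite lt_min => /andP[wr wr'].
      have k1 := Hr w w0 wr; have k2 : cmod (f (w + z) - f z) < dl by apply: Hr'; rewrite addrK.
      rewrite /Psi addrK.
      have -> : w * (f (w + z) * k w) - f z =
        (w * k w - 1) * (f (w + z) - f z) + (f (w + z) - f z) + (w * k w - 1) * f z by ring.
      apply: (le_trans (cmodD _ _)); have := cmodD ((w * k w - 1) * (f (w + z) - f z)) (f (w + z) - f z).
      rewrite !cmodM; have d1 : dl <= 1 by rewrite ge_min lexx.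
      have d2 : dl * (cmod (f z) + 2) <= e by rewrite -ler_pdivlMr // ge_min lexx orbT.
      have g1 := cmod_ge0 (f z).
      move: (cmod (f z)) (cmod (w * _ - 1)) (cmod (f _ - _)) (cmod_ge0 (w * k w - 1)) (cmod_ge0 (f (w + z) - f z)) k1 k2 d1 d2 g1 (cmod _).
      move=> a b c b0 c0' k1 k2 d1 d2 g1 q hq.
      have t1 : b * a <= dl * a by exact: ler_wpM2r.
      have t2 : b * c <= 1 * dl by apply: ler_pM => //; [exact: le_trans k1 d1|exact: ltW].
      by lra.
  - move: L3; rewrite (_ : -1 * (- c0 R * _) = c0 R * cauchyT (twist (fun w => f (- w))) (- z)) //.
    by rewrite mulN1r mulNr opprK.
exact: cancel_factor (c0_neq0 R) HR.
Qed.

End Operator.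

(** * Hardy quasi-norms and the map j *)

Section HardySpaces.
Variable R : realType.
Local Notation C := (cplx R).
Implicit Types (f g : C -> C) (z w : C) (y M : R) (Y : set R).
Variable p : R.
Hypotheses (p0 : 0 < p) (p1 : p < 1).

Lemma line_opp f y : hol_line (- y) f ->
  (line_integral p y (fun w => f (- w)%R) <= line_integral p (- y) f)%E.
Proof.
move=> hf.
have e1 x : - Complex x y = Complex (- x) (- y) :> C by [].
have hf' : hol_line y (fun w => f (- w)).
  move=> x; apply: (@hol_comp R f (fun w => - w)); last by rewrite e1.
  by apply: holN; exact: hol_id.
apply: (line_le p0 (ltW p1) hf') => n.
have n1 : - n%:R <= n%:R :> R by have : (0 : R) <= n%:R by []; lra.
have E := @rint_opp R (- n%:R) n%:R (fun x => cmod (f (Complex x (- y))) `^ p) n1.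
rewrite opprK in E.
have -> : rint (- n%:R) n%:R (fun x => cmod (f (- Complex x y)) `^ p) =
    rint (- n%:R) n%:R (fun x => cmod (f (Complex x (- y))) `^ p).
  by rewrite E; [apply: eq_rint => x _; rewrite e1|exact: (cont_line p0 (ltW p1) hf)].
exact: (rint_le_line _ _ p0 (ltW p1) hf).
Qed.

Lemma line_eq f g y : (forall x, f (Complex x y) = g (Complex x y)) ->
  line_integral p y f = line_integral p y g.
Proof. by move=> H; apply: eq_integral => x _; rewrite H. Qed.

Lemma eq_derivable f g z (s : R) : 0 < s -> (forall w, cmod (w - z) < s -> f w = g w) ->
  derivable f z (1 : C) -> derivable g z (1 : C).
Proof.
move=> s0 H /derivableE [D HD]; apply/derivableE; exists D => e e0.
have [d d0 Hd] := HD e e0; exists (Num.min d s); first by rewrite lt_min d0.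
move=> h; rewrite lt_min => /andP[hd hs].
rewrite -(H z) ?subrr ?cmod0 // -(H (z + h)); first exact: Hd.
by rewrite addrC addKr.
Qed.

(** The point [y1] makes the supremum nonnegative; over an empty set it would be the infinite
    negative value. *)
Lemma qnorm_le Y f M (y1 : R) : Y y1 -> (forall y, Y y -> (line_integral p y f <= M%:E)%E) ->
  (hardy_qnorm Y p f <= (M `^ p^-1)%:E)%E.
Proof.
move=> Yy H; rewrite /hardy_qnorm -poweR_EFin.
have ip : 0 <= p^-1 by rewrite invr_ge0 ltW.
have h1 : (ereal_sup [set line_integral p y f | y in Y] <= M%:E)%E.
  by apply: ge_ereal_sup => _ [y hy <-]; exact: H.
have h0 : (0 <= ereal_sup [set line_integral p y f | y in Y])%E.
  by apply: le_trans (line_ge0 p y1 f) _; apply: ereal_sup_ubound; exists y1.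
apply: (gt0_ler_poweR ip) => //; rewrite in_itv /= leey andbT //.
exact: le_trans h0 h1.
Qed.

(** Replaces the extended-real supremum by a real [M], the quantity in which [hcls] and all bounds
    of the operator are expressed. *)
Lemma qnorm_real Y f (y1 : R) : Y y1 -> (hardy_qnorm Y p f < +oo)%E ->
  exists M, [/\ 0 <= M, hardy_qnorm Y p f = (M `^ p^-1)%:E &
    forall y, Y y -> (line_integral p y f <= M%:E)%E].
Proof.
move=> Yy; rewrite /hardy_qnorm.
have ip : p^-1 != 0 by rewrite invr_neq0 ?lt0r_neq0.
move/(lty_poweRy ip).
have h0 : (0 <= ereal_sup [set line_integral p y f | y in Y])%E.
  by apply: le_trans (line_ge0 p y1 f) _; apply: ereal_sup_ubound; exists y1.
have hs y : Y y -> (line_integral p y f <= ereal_sup [set line_integral p y f | y in Y])%E.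
  by move=> hy; apply: ereal_sup_ubound; exists y.
case: (ereal_sup _) h0 hs => [M|//|//] h0 hs _.
by exists M; split; [rewrite -lee_fin|rewrite poweR_EFin|exact: hs].
Qed.

Lemma hardy_upper g : hardy upper p g -> exists M, [/\ 0 <= M, hcls p M g &
  hardy_qnorm upper p g = (M `^ p^-1)%:E].
Proof.
move=> [hol _ fin]; have u1 : upper (1 : R) by exact: ltr01.
have [M [M0 e H]] := qnorm_real u1 fin.
exists M; split => //; split; first by move=> z hz; exact: hol.
move=> a b y y0; rewrite -lee_fin; apply: le_trans (H y y0).
by apply: rint_le_line => //; [exact: ltW|move=> x; exact: hol].
Qed.

(** Reflection through the origin moves the lower half-plane to the upper one, so a single operator
    serves both summands. *)
Lemma hardy_lower h : hardy lower p h -> exists M, [/\ 0 <= M,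
  hcls p M (fun w => h (- w)) & hardy_qnorm lower p h = (M `^ p^-1)%:E].
Proof.
move=> [hol _ fin]; have u1 : lower (-1 : R) by rewrite /lower /= ltrN10.
have [M [M0 e H]] := qnorm_real u1 fin.
have hd (w : C) : 0 < complex.Im w -> derivable (fun w => h (- w)) w (1 : C).
  move=> w0; apply: (@hol_comp R h (fun w => - w)).
    by apply: holN; exact: hol_id.
  by apply: hol; rewrite /half_plane /lower /= ImN oppr_lt0.
exists M; split; [exact: M0| |exact: e].
split; first exact: hd.
move=> a b y y0; rewrite -lee_fin.
have yl : lower (- y) by rewrite /lower /= oppr_lt0.
apply: le_trans (H _ yl).
apply: le_trans (line_opp _); last by move=> x; exact: hol.
by apply: rint_le_line => //; [exact: ltW|move=> x; exact: hd].
Qed.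

Lemma Ep_opp f : Ep p f -> Ep p (fun w => f (- w)) /\
  (line_integral p 0 (fun w => f (- w)%R) <= line_integral p 0 f)%E.
Proof.
move=> [ent typ fin]; have hf w : derivable f w (1 : C) by exact: ent.
have L : (line_integral p 0 (fun w => f (- w)%R) <= line_integral p 0 f)%E.
  by rewrite -[X in (_ <= line_integral _ X _)%E]oppr0; apply: line_opp => x; exact: hf.
split; last exact: L.
split; last exact: le_lt_trans fin.
  by move=> z _; exact: hol_opp.
move=> e e0; have [c c0' H] := typ e e0; exists c; first exact: c0'.
by move=> z; have := H (- z); rewrite cmodN.
Qed.

Lemma Ep_twist f : Ep p f -> exists2 M, line_integral p 0 f = M%:E &
  (0 <= M /\ (forall a b y, 0 <= y -> rint a b (fun x => cmod (twist f (Complex x y)) `^ p) <= M)).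
Proof.
move=> hf; have [ent typ] := hf; have h0 := line_ge0 p 0 f.
have PP y := @plancherel_polya R p f y p0 (ltW p1) hf.
case: (line_integral p 0 f) h0 PP => [M|//|//] h0 PP _; exists M; first by [].
split; first by rewrite -lee_fin.
move=> a b y y0; rewrite -lee_fin; apply: le_trans (PP y y0).
by apply: rint_le_line => //; [exact: ltW|move=> x; apply: hol_twist; exact: ent].
Qed.

Lemma jmap2E f z : complex.Im z < 0 -> (jmap f).2 z = twist (fun w => f (- w)) (- z).
Proof. by move=> z0; rewrite /jmap /= z0 /twist opprK mulrN. Qed.

(** Plancherel-Polya bounds every horizontal line, for the lower half-plane after reflection.
    Holomorphy survives the cut-off because near a point of the open half-plane the component
    coincides with an entire function. *)
Lemma jmap_hardy f M : Ep p f -> line_integral p 0 f = M%:E ->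
  [/\ hardy_sum p (jmap f), (hardy_qnorm upper p (jmap f).1 <= (M `^ p^-1)%:E)%E &
      (hardy_qnorm lower p (jmap f).2 <= (M `^ p^-1)%:E)%E].
Proof.
move=> hf eM; have [hf' L] := Ep_opp hf.
have ent w : derivable f w (1 : C) by case: hf => H _ _; exact: H.
have ent' w : derivable (fun w => f (- w)) w (1 : C) by exact: hol_opp.
have n1 : (hardy_qnorm upper p (jmap f).1 <= (M `^ p^-1)%:E)%E.
  apply: (@qnorm_le upper _ M 1 ltr01) => y y0.
  have -> : line_integral p y (jmap f).1 = line_integral p y (twist f).
    by apply: line_eq => x; rewrite /jmap /= y0.
  by rewrite -eM; apply: plancherel_polya => //; exact: ltW.
have n2 : (hardy_qnorm lower p (jmap f).2 <= (M `^ p^-1)%:E)%E.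
  apply: (@qnorm_le lower _ M (-1) (ltrN10 R)) => y y0.
  have -> : line_integral p y (jmap f).2 = line_integral p y (fun w => twist (fun w => f (- w)) (- w)).
    by apply: line_eq => x; apply: jmap2E.
  apply: (@le_trans _ _ (line_integral p (- y) (twist (fun w => f (- w))))).
    by apply: line_opp => x; exact: hol_twist.
  rewrite -eM; apply: le_trans L; apply: plancherel_polya; [exact: p0|exact: ltW|exact: hf'|].
  by rewrite oppr_ge0 ltW.
split; [|exact: n1|exact: n2]; split; split.
- move=> z z0; apply: (@eq_derivable (twist f) _ z _ z0); last exact: hol_twist.
  move=> w hw; rewrite /jmap /= ifT //.
  have := le_lt_trans (Im_le_cmod (w - z)) hw; rewrite ImD ImN ltr_norml => /andP[].
  by lra.
- by move=> z; rewrite /half_plane /upper /= => /negP/negbTE ->.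
- exact: le_lt_trans n1 (ltry _).
- move=> z z0; have z0' : 0 < - complex.Im z by rewrite oppr_gt0.
  apply: (@eq_derivable (fun w => twist (fun w => f (- w)) (- w)) _ z _ z0').
    move=> w hw; rewrite jmap2E //.
    have := le_lt_trans (Im_le_cmod (w - z)) hw; rewrite ImD ImN ltr_norml => /andP[].
    by lra.
  by apply: (@hol_opp R (twist (fun w => f (- w)))) => w; exact: hol_twist.
- by move=> z; rewrite /half_plane /lower /= => /negP/negbTE ->.
- exact: le_lt_trans n2 (ltry _).
Qed.

(** * The projection built from an abstract operator with the properties of T *)

Section Projection.
Variables (T : (C -> C) -> C -> C) (A : R).
Hypotheses (A0 : 0 < A)
  (T_hol : forall g M z, hcls p M g -> derivable (T g) z (1 : C))
  (T_growth : forall g M, hcls p M g -> exists2 B : R, 0 < B &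
     forall z, cmod (T g z) <= B * expR (pi * `|complex.Im z|))
  (T_Lp : forall g M (m : nat), hcls p M g ->
     rint (- m%:R) m%:R (fun x => cmod (T g (Complex x 0)) `^ p) <= A * M)
  (T_linear : forall g g' M M' (a : C) z, hcls p M g -> hcls p M' g' ->
     T (fun w => a * g w + g' w) z = a * T g z + T g' z)
  (T_eq : forall g g' z, (forall w, 0 < complex.Im w -> g w = g' w) -> T g z = T g' z)
  (T_reproduces : forall f M z, (forall w, derivable f w (1 : C)) ->
     (forall a b y, 0 <= y -> rint a b (fun x => cmod (twist f (Complex x y)) `^ p) <= M) ->
     (forall a b y, 0 <= y ->
        rint a b (fun x => cmod (twist (fun w => f (- w)) (Complex x y)) `^ p) <= M) ->
     T (twist f) z + T (twist (fun w => f (- w))) (- z) = f z).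

(** The left inverse of [jmap]: [T] on the upper component plus its mirror image on the lower
    one. *)
Definition glue (u : (C -> C) * (C -> C)) : C -> C :=
  fun z => T u.1 z + T (fun w => u.2 (- w)) (- z).

(** The integral bound comes from subadditivity of t^p and a reflection of the second summand; the
    type from e^{pi |Im z|} <= e^{(pi + e) |z|}. *)
Lemma glue_Ep u : hardy_sum p u -> exists M1 M2, [/\ 0 <= M1 /\ 0 <= M2,
  hardy_qnorm upper p u.1 = (M1 `^ p^-1)%:E, hardy_qnorm lower p u.2 = (M2 `^ p^-1)%:E,
  Ep p (glue u) & (line_integral p 0 (glue u) <= (A * (M1 + M2))%:E)%E].
Proof.
move=> [/hardy_upper [M1 [M10 h1 e1]] /hardy_lower [M2 [M20 h2 e2]]].
exists M1, M2.
have d1 z : derivable (T u.1) z (1 : C) by exact: T_hol h1.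
have d2 z : derivable (fun z => T (fun w => u.2 (- w)) (- z)) z (1 : C).
  by apply: (@hol_opp R (T (fun w => u.2 (- w)))) => w; exact: T_hol h2.
have dF z : derivable (glue u) z (1 : C) by apply: holD.
have L : (line_integral p 0 (glue u) <= (A * (M1 + M2))%:E)%E.
  apply: line_le => //; first exact: ltW.
  move=> n; rewrite lee_fin.
  have n1 : - n%:R <= n%:R :> R by have : (0 : R) <= n%:R by []; lra.
  have b1 := T_Lp n h1; have b2 := T_Lp n h2.
  pose G2 x := cmod (T (fun w => u.2 (- w)) (Complex x 0)) `^ p.
  have cG a b : cont_on a b G2.
    by apply: cont_line => //; [exact: ltW|move=> x; exact: T_hol h2].
  have E := @rint_opp R (- n%:R) n%:R G2 n1 (cG _ _); rewrite opprK in E.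
  rewrite -/G2 E in b2.
  have c1 : cont_on (- n%:R) n%:R (fun x => cmod (T u.1 (Complex x 0)) `^ p).
    exact: (cont_line p0 (ltW p1) (fun x => d1 _)).
  have e3 x : - Complex x 0 = Complex (- x) 0 :> C.
    by apply/eqP; rewrite eq_complex /= oppr0 !eqxx.
  have c2 : cont_on (- n%:R) n%:R (fun x => G2 (- x)).
    have -> : (fun x => G2 (- x)) = (fun x => cmod (T (fun w => u.2 (- w)) (- Complex x 0)) `^ p).
      by apply/funext => x; rewrite e3.
    exact: (@cont_line R _ _ p 0 (fun z => T (fun w => u.2 (- w)) (- z)) p0 (ltW p1) (fun x => d2 _)).
  have b12 := lerD b1 b2; rewrite -(rintD c1 c2) -mulrDr in b12; apply: le_trans b12.
  apply: rint_le; [exact: (cont_line p0 (ltW p1) (fun x => dF _))|exact: cont_onD c1 c2|].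
  move=> x _; rewrite /G2 -e3.
  apply: le_trans (powR_subadd p0 (ltW p1) (cmod_ge0 _) (cmod_ge0 _)).
  by apply: powR_le; [exact: ltW|exact: cmod_ge0|exact: cmodD].
split => //; split; [by move=> z _| |exact: le_lt_trans L (ltry _)].
have [B1 B10 H1] := T_growth h1; have [B2 B20 H2] := T_growth h2.
move=> e e0; exists (B1 + B2); first exact: addr_gt0.
move=> z; apply: (le_trans (cmodD _ _)).
apply: (@le_trans _ _ ((B1 + B2) * expR (pi * `|complex.Im z|))).
  have k := H2 (- z); rewrite ImN normrN in k; rewrite mulrDl; exact: lerD (H1 z) k.
apply: ler_wpM2l; first by rewrite ltW // addr_gt0.
rewrite ler_expR; apply: ler_pM; [exact: pi_ge0|exact: normr_ge0| |exact: Im_le_cmod].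
by rewrite lerDl ltW.
Qed.

Lemma glue_linear (a : C) u v z : hardy_sum p u -> hardy_sum p v ->
  glue (a *: u + v) z = a * glue u z + glue v z.
Proof.
move=> [/hardy_upper [M1 [_ h1 _]] /hardy_lower [M2 [_ h2 _]]].
move=> [/hardy_upper [N1 [_ k1 _]] /hardy_lower [N2 [_ k2 _]]].
have E1 := T_linear a z h1 k1; have E2 := T_linear a (- z) h2 k2.
rewrite /glue mulrDr addrACA -E1 -E2; congr (_ + _).
Qed.

Lemma jmap_linear (a : C) f g : jmap (fun z => a * f z + g z) = a *: jmap f + jmap g.
Proof.
apply/pair_equal_spec; split; apply/funext => z.
  rewrite -[RHS]/(a * (jmap f).1 z + (jmap g).1 z).
  by rewrite /jmap /=; case: ifP => _; rewrite ?mulr0 ?addr0 // mulrDr mulrCA.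
rewrite -[RHS]/(a * (jmap f).2 z + (jmap g).2 z).
by rewrite /jmap /=; case: ifP => _; rewrite ?mulr0 ?addr0 // mulrDr mulrCA.
Qed.

(** Each component of [jmap f] agrees with a twist on its half-plane, and by [T_eq] nothing else is
    seen by [T]; [T_reproduces] then applies with a common bound. *)
Lemma glue_jmap f : Ep p f -> glue (jmap f) = f.
Proof.
move=> hf; apply/funext => z.
have [hf' _] := Ep_opp hf.
have ent w : derivable f w (1 : C) by case: hf => H _ _; exact: H.
have [M1 _ [M10 H1]] := Ep_twist hf; have [M2 _ [M20 H2]] := Ep_twist hf'.
rewrite -[RHS](@T_reproduces f (M1 + M2) z ent); first last.
- by move=> a b y y0; apply: (le_trans (H2 a b y y0)); rewrite lerDr.
- by move=> a b y y0; apply: (le_trans (H1 a b y y0)); rewrite lerDl.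
rewrite /glue; congr (_ + _); apply: T_eq => w w0.
  by rewrite /jmap /= w0.
by rewrite jmap2E ?opprK // ImN oppr_lt0.
Qed.

(** The projection is [jmap] after [glue]; idempotence and the range follow from [glue_jmap]. *)
Lemma glue_projection : complemented (V := ((C -> C) * (C -> C))%type)
  (hardy_sum_qnorm p) (hardy_sum p) (@jmap R @` Ep p).
Proof.
have ip : 0 <= p^-1 by rewrite invr_ge0 ltW.
have fin f : Ep p f -> exists M, line_integral p 0 f = M%:E.
  by move=> /Ep_twist [M e _]; exists M.
exists (fun u => jmap (glue u)); split.
- move=> u /glue_Ep [M1 [M2 [_ _ _ hF _]]]; have [M eM] := fin _ hF.
  by have [] := jmap_hardy hF eM.
- move=> a u v hu hv; rewrite -jmap_linear; congr jmap.
  by apply/funext => z; exact: glue_linear.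
- by move=> u /glue_Ep [M1 [M2 [_ _ _ hF _]]]; rewrite glue_jmap.
- apply/seteqP; split => [_ [u hu <-]|_ [f hf <-]].
    by have [M1 [M2 [_ _ _ hF _]]] := glue_Ep hu; exists (glue u).
  have [M eM] := fin _ hf; have [h _ _] := jmap_hardy hf eM.
  by exists (jmap f) => //; rewrite glue_jmap.
- exists (2 * (2 * A) `^ p^-1); first by rewrite mulr_ge0 // powR_ge0.
  move=> u hu; have [M1 [M2 [[M10 M20] e1 e2 hF L]]] := glue_Ep hu.
  have [M eM] := fin _ hF; have [_ n1 n2] := jmap_hardy hF eM.
  have M0 : 0 <= M by rewrite -lee_fin -eM line_ge0.
  rewrite eM lee_fin in L.
  rewrite /hardy_sum_qnorm e1 e2; apply: (le_trans (leeD n1 n2)).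
  rewrite -!EFinD -EFinM lee_fin.
  have A20 : 0 <= 2 * A by rewrite mulr_ge0 // ltW.
  suff K : M `^ p^-1 <= (2 * A) `^ p^-1 * (M1 `^ p^-1 + M2 `^ p^-1).
    by rewrite -[2 * _ * _]mulrA mulr_natl mulr2n; apply: lerD; exact: K.
  (* The exponent 1/p exceeds 1, so the power is not subadditive; the sum is replaced by twice the
     larger term, whence (2 A)^{1/p}. The outer factor 2 counts the two components of [jmap]. *)
  have main (a b : R) : 0 <= a -> 0 <= b -> a <= b -> M <= A * (a + b) ->
      M `^ p^-1 <= (2 * A) `^ p^-1 * (a `^ p^-1 + b `^ p^-1).
    move=> a0 b0 ab hM; have hM' : M <= 2 * A * b.
      apply: (le_trans hM); rewrite [2 * A]mulrC -mulrA; apply: ler_wpM2l; first exact: ltW.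
      by lra.
    apply: (le_trans (powR_le ip M0 hM')); rewrite powRM //.
    by apply: ler_wpM2l; [exact: powR_ge0|rewrite lerDr powR_ge0].
  case: (leP M1 M2) => [|/ltW] h; first exact: main.
  by rewrite addrC; apply: main => //; rewrite addrC.
Qed.

End Projection.
End HardySpaces.

Theorem lemma3p2 (R : realType) (p : R) (hp0 : 0 < p) (hp1 : p < 1) :
  complemented (V := ((cplx R -> cplx R) * (cplx R -> cplx R))%type)
    (hardy_sum_qnorm p) (hardy_sum p) (@jmap R @` Ep p).
Proof.
have [K K0 HK] := amalgam hp0 hp1.
(* Already N p >= 2 holds, so the decay condition (N + 1) p >= 2 does too, and the successor makes N
   positive. *)
pose N := (Num.Def.truncn (2 / p)).+1.
have hN : 2 <= N.+1%:R * p.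
  rewrite -ler_pdivrMr //; apply: (le_trans (ltW (truncnS_gt _))).
  by rewrite ler_nat.
have N0 : (0 < N)%N by [].
have [A A0 HA] := cauchyT_Lp hp0 hp1 N0 hN K0 HK.
apply: (@glue_projection R p hp0 hp1 (cauchyT N) A).
- exact: A0.
- by move=> g M z hg; exact: (@hol_cauchyT R p K N hp0 hp1 N0 hN HK g M z hg).
- by move=> g M; exact: (cauchyT_growth hp0 hp1 N0 hN HK).
- exact: HA.
- by move=> g g' M M' a z; exact: (cauchyT_linear hp0 hp1 N0 hN HK).
- by move=> g g' z; exact: cauchyT_eq.
- by move=> f M z; exact: (cauchyT_reproduces hp0 hp1 N0 hN HK).
Qed.
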